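(* Fix $\beta>0$. As $n\to\infty$, $$\sup_{A\subset\Gamma}\left|\mathbb{P}_x(A)-\mathbb{P}_g(A)\right|=o_n(1),$$ where the supremum is taken over all measurable subsets $A\subset\Gamma$.
   Context: Fix $\beta>0$. For $n\ge 2$ let $\mathbb{T}^n/S_n=\{\theta\in[0,2\pi]^n:\theta_0\le\theta_1\le\dots\le\theta_{n-1}\}$ and let $\theta$ be a random point of $\mathbb{T}^n/S_n$ with probability density $q(\theta)=\frac{1}{Z_n}e^{H_{n,\beta}(\theta)}$, where $H_{n,\beta}(\theta)=-\frac{\beta}{2}\sum_{i\ne j}\frac{1}{\sin^2\left(\frac{\theta_i-\theta_j}{2}\right)}$ (sum over ordered pairs $0\le i\ne j\le n-1$) and $Z_n=\int_{\mathbb{T}^n/S_n}e^{H_{n,\beta}(\theta)}\,d\theta$. Define $\psi=\frac1n\sum_{i=0}^{n-1}\theta_i-\frac{\pi(n-1)}{n}$ and $x=(x_0,\dots,x_{n-1})$ by $\theta_i=\frac{2\pi i}{n}+\psi+\frac{x_i}{n^2}$, so that $x$ lies in the hyperplane $\Gamma=\{x\in\mathbb{R}^n:\sum_{i=0}^{n-1}x_i=0\}$. $\mathbb{P}_x$ denotes the law of $x$ on $\Gamma$ (the image of $q(\theta)\,d\theta$ under $\theta\mapsto x$). Let $$G(x)=\frac{\beta}{4}\sum_{i\neq j}\frac{-\frac32+\sin^2\left(\frac{\pi(i-j)}{n}\right)}{n^4\sin^4\left(\frac{\pi(i-j)}{n}\right)}(x_i-x_j)^2 .$$ $\mathbb{P}_g$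 is the Gaussian probability measure on $\Gamma$ with density $p_g(x)=\frac{1}{Z_g}e^{G(x)}$ with respect to Lebesgue measure on $\Gamma$, $Z_g=\int_\Gamma e^{G(x)}\,dx$. $o_n(1)$ denotes a quantity tending to $0$ as $n\to\infty$. *)

(* Defs.v *)
From HB Require Import structures.
From mathcomp Require Import all_boot all_order all_algebra.
From mathcomp Require Import all_classical all_reals all_analysis.
From mathcomp Require Import measurable_realfun ring.

Set Implicit Arguments.
Unset Strict Implicit.
Unset Printing Implicit Defensive.

Import Order.TTheory GRing.Theory Num.Theory.
Import numFieldNormedType.Exports.

Local Open Scope classical_set_scope.
Local Open Scope ring_scope.

(* R^n with its Borel (product) sigma-algebra. *)
Notation Rn R n := (n.-tuple (measurableTypeR R)).

Section coordinates.
Context {R : realType} {n : nat}.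
Implicit Type x : Rn R n.

Definition coord x (i : 'I_n) : R := tnth x i.

Lemma measurable_coord i : measurable_fun [set: Rn R n] (coord^~ i).
Proof. exact: measurable_tnth. Qed.

Definition csum x : R := \sum_(i < n) coord x i.

Lemma measurable_csum : measurable_fun [set: Rn R n] csum.
Proof. by apply: measurable_sum => i; exact: measurable_coord. Qed.

Definition mean x : R := csum x / n%:R.

Lemma measurable_mean : measurable_fun [set: Rn R n] mean.
Proof. by apply: measurable_funM => //; exact: measurable_csum. Qed.

End coordinates.

Section lebesgue_product_step.
Context {R : realType} (n : nat).
Local Open Scope ereal_scope.

Definition consRn (p : measurableTypeR R * Rn R n) : Rn R n.+1 :=
  [tuple of p.1 :: p.2].

Lemma measurable_consRn : measurable_fun [set: _] consRn.
Proof. exact: measurable_cons. Qed.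

Variable mu : {sigma_finite_measure set (Rn R n) -> \bar R}.

Definition lebesgue_cons (A : set (Rn R n.+1)) : \bar R :=
  pushforward (lebesgue_measure \x mu) consRn A.

Let mpre A : measurable A -> measurable (consRn @^-1` A).
Proof. by move=> mA; rewrite -[X in measurable X]setTI; exact: measurable_consRn. Qed.

Let lebesgue_cons0 : lebesgue_cons set0 = 0.
Proof. by rewrite /lebesgue_cons /pushforward preimage_set0 measure0. Qed.

Let lebesgue_cons_ge0 A : 0 <= lebesgue_cons A.
Proof. by rewrite /lebesgue_cons /pushforward; exact: measure_ge0. Qed.

Let lebesgue_cons_sigma_additive : semi_sigma_additive lebesgue_cons.
Proof.
move=> F mF tF mUF; rewrite /lebesgue_cons /pushforward preimage_bigcup.
apply: measure_semi_sigma_additive.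
- by move=> k; exact: mpre.
- apply/trivIsetP => /= i j _ _ ij; rewrite -preimage_setI.
  by move/trivIsetP : tF => /(_ _ _ _ _ ij) ->//; rewrite preimage_set0.
- by rewrite -preimage_bigcup; exact: mpre.
Qed.

HB.instance Definition _ := isMeasure.Build _ _ _ lebesgue_cons
  lebesgue_cons0 lebesgue_cons_ge0 lebesgue_cons_sigma_additive.

Lemma measurable_headRn :
  measurable_fun [set: Rn R n.+1] (fun x : Rn R n.+1 => thead x).
Proof. exact: measurable_tnth. Qed.

Definition unconsRn (x : Rn R n.+1) : measurableTypeR R * Rn R n :=
  (thead x, [tuple of behead x]).

Lemma measurable_unconsRn : measurable_fun [set: _] unconsRn.
Proof.
apply/measurable_fun_pairP; split; first exact: measurable_headRn.
exact: measurable_behead.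
Qed.

Lemma consRnK : cancel consRn unconsRn.
Proof.
by move=> [a t]; rewrite /unconsRn /= theadE; congr (_, _); exact: val_inj.
Qed.

Let lebesgue_cons_sigma_finite : sigma_finite setT lebesgue_cons.
Proof.
have /sigma_finiteP[F [TF ndF Foo]] := sigma_finiteT (@lebesgue_measure R).
have /sigma_finiteP[G [TG ndG Goo]] := sigma_finiteT mu.
exists (fun k => unconsRn @^-1` (F k `*` G k)).
  rewrite -preimage_bigcup (_ : \bigcup_k _ = setT) ?preimage_setT//.
  apply/seteqP; split => // -[x y] _.
  have : [set: R] x by []. rewrite TF => -[k _ Fkx].
  have : [set: Rn R n] y by []. rewrite TG => -[l _ Gly].
  exists (maxn k l) => //; split.
  - by move: x Fkx; exact/subsetPset/ndF/leq_maxl.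
  - by move: y Gly; exact/subsetPset/ndG/leq_maxr.
move=> k; have [mF Fk] := Foo k; have [mG Gk] := Goo k; split.
  rewrite -[X in measurable X]setTI; apply: measurable_unconsRn => //.
  exact: measurableX.
rewrite /lebesgue_cons /pushforward -comp_preimage.
rewrite (_ : unconsRn \o consRn = id); last by apply/funext => p; exact: consRnK.
by rewrite preimage_id product_measure1E// lte_mul_pinfty// ge0_fin_numE.
Qed.

HB.instance Definition _ := Measure_isSigmaFinite.Build _ _ _ lebesgue_cons
  lebesgue_cons_sigma_finite.

End lebesgue_product_step.

(* Lebesgue measure on R^n, as an n-fold product. *)
Fixpoint lebesgueRn {R : realType} (n : nat) :
    {sigma_finite_measure set (Rn R n) -> \bar R} :=
  match n with
  | 0 => dirac ([tuple] : Rn R 0)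
  | m.+1 => lebesgue_cons (@lebesgueRn R m)
  end.

Lemma lebesgueRn_box (R : realType) (n : nat) (B : 'I_n -> set (measurableTypeR R)) :
  (forall i, measurable (B i)) ->
  lebesgueRn n [set x | forall i, B i (tnth x i)] =
  (\prod_(i < n) lebesgue_measure (B i))%E.
Proof.
elim: n B => [|n IH] B mB.
  rewrite big_ord0 /= diracE mem_set//= => -[]//.
rewrite big_ord_recl -IH; last by move=> i; exact: mB.
rewrite /= /lebesgue_cons /pushforward.
rewrite -product_measure1E//; last first.
  pose C i := (fun x : Rn R n => tnth x i) @^-1` B (lift ord0 i).
  have -> : [set x : Rn R n | forall i, B (lift ord0 i) (tnth x i)] =
            \bigcap_(i in [set: 'I_n]) C i.
    by apply/seteqP; split => x /= h i => [_|]; exact: h.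
  apply: fin_bigcap_measurable; first exact: finite_finset. move=> i _.
  by rewrite -[X in measurable X]setTI; apply: measurable_tnth.
congr (_ _); apply/seteqP; split => -[a t] /=.
  move=> h; split; first exact: (h ord0).
  by move=> i; have := h (lift ord0 i); rewrite tnthS.
move=> [ha ht] i; case: (unliftP ord0 i) => [j ->|->]; last exact: ha.
by rewrite tnthS; exact: ht.
Qed.

Section hyperplane.
Context {R : realType} (n : nat).
Implicit Types x y : Rn R n.

(* The hyperplane Gamma. *)
Definition hyperplane : set (Rn R n) := [set x | csum x = 0].

Definition proj_hyperplane y : Rn R n := [tuple coord y i - mean y | i < n].

Lemma proj_hyperplaneP y : (0 < n)%N -> hyperplane (proj_hyperplane y).
Proof.
move=> n0; rewrite /hyperplane /= /csum /coord.
under eq_bigr do rewrite tnth_mktuple.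
rewrite big_split /= sumr_const card_ord -mulr_natr mulNr /mean.
by rewrite mulfVK ?subrr// pnatr_eq0 -lt0n.
Qed.

Lemma measurable_proj_hyperplane : measurable_fun [set: Rn R n] proj_hyperplane.
Proof.
apply/measurable_fun_tnthP => i.
rewrite (_ : _ \o _ = fun y => coord y i - mean y).
  by apply: measurable_funB; [exact: measurable_coord|exact: measurable_mean].
by apply/funext => y /=; rewrite tnth_mktuple.
Qed.

(* With u := (1, ..., 1) / sqrt n, the unit normal of the hyperplane, this is
   { y | 0 <= <y, u> <= 1 } = Gamma + [0, 1] u. *)
Definition unit_slab : set (Rn R n) :=
  [set y | 0 <= csum y / Num.sqrt n%:R <= 1].

Lemma measurable_unit_slab : measurable unit_slab.
Proof.
have mf : measurable_fun [set: Rn R n] (fun y => csum y / Num.sqrt n%:R : R).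
  by apply: measurable_funM => //; exact: measurable_csum.
have := mf measurableT _ (measurable_itv `[0, 1]).
by rewrite setTI; congr measurable; apply/seteqP; split => y /=; rewrite in_itv.
Qed.

(* (n-1)-dimensional Euclidean Lebesgue measure on Gamma, as a measure on R^n
   carried by Gamma: as R^n = Gamma + R u orthogonally, the Gamma-volume of A
   is the n-volume of the cylinder A + [0, 1] u of height one. *)
Definition lebesgue_hyperplane (A : set (Rn R n)) : \bar R :=
  pushforward (mrestr (lebesgueRn n) measurable_unit_slab) proj_hyperplane A.

Let mpre A : measurable A -> measurable (proj_hyperplane @^-1` A).
Proof.
by move=> mA; rewrite -[X in measurable X]setTI; exact: measurable_proj_hyperplane.
Qed.

Let lebesgue_hyperplane0 : lebesgue_hyperplane set0 = 0%E.
Proof. by rewrite /lebesgue_hyperplane /pushforward preimage_set0 measure0. Qed.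

Let lebesgue_hyperplane_ge0 A : (0 <= lebesgue_hyperplane A)%E.
Proof. by rewrite /lebesgue_hyperplane /pushforward; exact: measure_ge0. Qed.

Let lebesgue_hyperplane_sigma_additive : semi_sigma_additive lebesgue_hyperplane.
Proof.
move=> F mF tF mUF; rewrite /lebesgue_hyperplane /pushforward preimage_bigcup.
apply: measure_semi_sigma_additive.
- by move=> k; exact: mpre.
- apply/trivIsetP => /= i j _ _ ij; rewrite -preimage_setI.
  by move/trivIsetP : tF => /(_ _ _ _ _ ij) ->//; rewrite preimage_set0.
- by rewrite -preimage_bigcup; exact: mpre.
Qed.

HB.instance Definition _ := isMeasure.Build _ _ _ lebesgue_hyperplane
  lebesgue_hyperplane0 lebesgue_hyperplane_ge0 lebesgue_hyperplane_sigma_additive.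

End hyperplane.

Section circle_ensemble.
Context {R : realType} (n : nat) (beta : R).
Implicit Types theta x : Rn R n.

Definition ordered_torus : set (Rn R n) :=
  [set theta | (forall i, 0 <= coord theta i <= 2 * pi) /\
               (forall i j : 'I_n, (i <= j)%N -> coord theta i <= coord theta j)].

(* Where a sine vanishes (two coordinates equal, or equal to 0 and 2 pi),
   division by 0 gives 0 instead of +oo; such points form a Lebesgue-null
   subset of ordered_torus, so neither Zn nor the law of theta is affected. *)
Definition Hn theta : R :=
  - (beta / 2) * \sum_(i < n) \sum_(j < n | i != j)
      1 / sin ((coord theta i - coord theta j) / 2) ^+ 2.

Definition Zn : R := (\int[lebesgueRn n]_(theta in ordered_torus) expR (Hn theta))%R.

Definition qn theta : R := 1 / Zn * expR (Hn theta).

Definition theta_law (B : set (Rn R n)) : \bar R :=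
  (\int[lebesgueRn n]_(theta in ordered_torus `&` B) (qn theta)%:E)%E.

Definition psi theta : R :=
  1 / n%:R * \sum_(i < n) coord theta i - pi * (n%:R - 1) / n%:R.

Definition rescale theta : Rn R n :=
  [tuple n%:R ^+ 2 * (coord theta i - 2 * pi * (i : nat)%:R / n%:R - psi theta)
     | i < n].

Lemma rescaleE theta i : (0 < n)%N ->
  coord theta i = 2 * pi * (i : nat)%:R / n%:R + psi theta
                  + coord (rescale theta) i / n%:R ^+ 2.
Proof.
move=> n0; have nn0 : n%:R != 0 :> R by rewrite pnatr_eq0 -lt0n.
rewrite [coord (rescale _) _]tnth_mktuple; field; exact: nn0.
Qed.

Lemma rescale_hyperplane theta : (0 < n)%N -> hyperplane (rescale theta).
Proof.
move=> n0; have nn0 : n%:R != 0 :> R by rewrite pnatr_eq0 -lt0n.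
rewrite /hyperplane /= /csum /coord; under eq_bigr do rewrite tnth_mktuple.
rewrite -mulr_sumr !big_split /= !sumrN -mulr_suml -mulr_sumr.
rewrite [\sum_(i < n) psi theta]sumr_const card_ord -mulr_natr.
have -> : \sum_(i < n) (i : nat)%:R = n%:R * (n%:R - 1) / 2 :> R.
  rewrite -(big_mkord xpredT (fun i => i%:R)) /=.
  elim: (n) => [|m IH]; first by rewrite big_geq// !mul0r.
  by rewrite big_nat_recr//= IH; field.
by rewrite /psi; field.
Qed.

Definition Px : set (Rn R n) -> \bar R := pushforward theta_law rescale.

Definition Gn x : R :=
  beta / 4 * \sum_(i < n) \sum_(j < n | i != j)
    let s := sin (pi * ((i : nat)%:R - (j : nat)%:R) / n%:R) in
    (- (3 / 2) + s ^+ 2) / (n%:R ^+ 4 * s ^+ 4) * (coord x i - coord x j) ^+ 2.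

Definition Zg : R :=
  (\int[@lebesgue_hyperplane R n]_(x in @hyperplane R n) expR (Gn x))%R.

Definition pg x : R := 1 / Zg * expR (Gn x).

Definition Pg (A : set (Rn R n)) : \bar R :=
  (\int[@lebesgue_hyperplane R n]_(x in A) (pg x)%:E)%E.

End circle_ensemble.

(* Main.v *)
From HB Require Import structures.
Require Import Defs.
From mathcomp Require Import all_boot all_order all_algebra.
From mathcomp Require Import all_classical all_reals all_analysis.
From mathcomp Require Import measurable_realfun ring lra zify.

Set Implicit Arguments.
Unset Strict Implicit.
Unset Printing Implicit Defensive.

Import Order.TTheory GRing.Theory Num.Theory.
Import numFieldNormedType.Exports.

Local Open Scope classical_set_scope.
Local Open Scope ring_scope.

(** The gap energy of a configuration splits exactly as V - V0 = Q + R, where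
   Q is the quadratic form of the Gaussian law and R is a sum of third-order
   Taylor remainders of 1/sin^2; the linear term disappears because the
   displacements sum to zero around the circle. Integrating out the rotation,
   both laws become densities in the m = n - 1 gaps (Px_weight, Pg_gauss), and
   a Cholesky change of variables turns Q into the squared norm of z in R^m.
   It remains to compare, in total variation, the density w with the Gaussian
   e^(-|z|^2).

   The crude bound on R, a sum over the n gaps of terms of order 1/n, is only of
   order one. What is small is its gradient. If h^2 is the density of w relative
   to the Gaussian and the gradient of h is small in mean square, then the
   Gaussian Poincare inequality on R^m (poincare) shows that h has small
   variance, which bounds the total variation distance (tv_poincare). The Poincare inequality is obtained in dimension one from a
   Hardy inequality and in dimension m by tensorization, so that its constant
   does not depend on m.

   The gradient bound: the derivative of R in direction v is at most
   C/n (l E4 + E2(v)/l), with E4 the sum of the fourth powers of the gaps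
   (dRen_bound). Dualising gives a squared gradient of order E4/n^2, small
   wherever E4 is at most eps n^2. A smooth cutoff in E4/(eps n^2) is
   incorporated in h; its own gradient is of order 1/(eps n).

   Two regions have to be discarded. Where the quadratic energy E2 of the gaps
   exceeds K^2 n, convexity of 1/sin^2 gives V(g) - V0 >= 2 (V(g/2) - V0),
   hence w(z) <= 2 e^(-2n) w(z/2), and the scaling z -> z/2 loses only a factor
   2^m. Where E2 is at most K^2 n but E4 > eps^2 n^2, some gap exceeds
   eps sqrt n / K; that is exponentially unlikely in n for the Gaussian, while w
   and the Gaussian differ there by a factor e^(C sqrt n) only. The abstract
   estimate assembling these facts is tv_bound; its hypotheses are verified for
   the gap density in density_bound. *)


(** * Changes of variables *)

Section affine_line.
Context {R : realType}.
Variables (s b : R) (s0 : 0 < s).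

Let T (x : measurableTypeR R) : measurableTypeR R := s * x + b.

Let mT : measurable_fun [set: measurableTypeR R] T.
Proof. by apply: measurable_funD => //; apply: measurable_funM. Qed.

Lemma lebesgue_measure_affine (A : set (measurableTypeR R)) : measurable A ->
  lebesgue_measure A = (s%:E * pushforward lebesgue_measure T A)%E.
Proof.
pose mu1 := mscale (NngNum (ltW s0)) (pushforward (@lebesgue_measure R) T).
move=> mA; suff H X : ocitv X -> lebesgue_measure X = mu1 mT X by exact: (@lebesgue_measure_unique R (mu1 mT) H).
move=> [[u v] _ <-] /=.
rewrite /mu1 /mscale /pushforward /=.
rewrite /pushforward. have -> : T @^-1` `]u, v]%classic = `](u - b) / s, (v - b) / s]%classic.
  apply/seteqP; split=> x /=; rewrite /T !in_itv /= ltr_pdivrMr// ler_pdivlMr//;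
  by rewrite ltrBlDr lerBrDr mulrC.
rewrite !lebesgue_measure_itv /= !lte_fin ltr_pM2r ?invr_gt0// ltrD2r.
case: ifP => _; last by rewrite mule0.
rewrite -EFinM; congr EFin; field; apply: lt0r_neq0; exact: s0.
Qed.

Lemma ge0_integral_affine (F : R -> \bar R) : measurable_fun setT F ->
  (forall x, 0 <= F x)%E ->
  (\int[lebesgue_measure]_x F x = s%:E * \int[lebesgue_measure]_x F (s * x + b)%R)%E.
Proof.
move=> mF F0.
pose mu1 := mscale (NngNum (ltW s0)) (pushforward (@lebesgue_measure R) T).
rewrite (@eq_measure_integral _ _ _ _ (mu1 mT)); last first.
  by move=> A mA _; exact: lebesgue_measure_affine.
rewrite ge0_integral_mscale//; congr *%E.
by rewrite ge0_integral_pushforward.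
Qed.
End affine_line.

Notation consR a z := (@consRn _ _ (a, z)).

Section Tonelli.
Context {R : realType}.
Local Open Scope ereal_scope.
Local Notation leb := (@lebesgue_measure R).

Lemma integral_consRn n (F : Rn R n.+1 -> \bar R) : measurable_fun setT F ->
  (forall x, 0 <= F x) ->
  \int[lebesgueRn n.+1]_x F x =
  \int[leb]_a \int[lebesgueRn n]_z F (consR a z).
Proof.
move=> mF F0.
transitivity (\int[leb \x lebesgueRn n]_p F (consR p.1 p.2)).
  by rewrite -(@ge0_integral_pushforward _ _ _ _ _ _ (@measurable_consRn R n) _ setT F).
rewrite fubini_tonelli1//.
exact: measurableT_comp mF (@measurable_consRn R n).
Qed.

Lemma integral_consRn_swap n (F : Rn R n.+1 -> \bar R) : measurable_fun setT F ->
  (forall x, 0 <= F x) ->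
  \int[lebesgueRn n.+1]_x F x =
  \int[lebesgueRn n]_z \int[leb]_a F (consR a z).
Proof.
move=> mF F0; rewrite integral_consRn//.
rewrite (fubini_tonelli (fun p => F (consR p.1 p.2)))//.
exact: measurableT_comp mF (@measurable_consRn R n).
Qed.
End Tonelli.

Notation headR := (@thead _ _).
Definition tailR {R : realType} {m} (x : Rn R m.+1) : Rn R m := [tuple of behead x].

Section jacobian.
Context {R : realType}.
Local Notation leb := (@lebesgue_measure R).

Lemma consR_eta m (x : Rn R m.+1) : x = consR (headR x) (tailR x).
Proof. by apply: val_inj; rewrite /= [in LHS](tuple_eta x). Qed.

Lemma tnth_consR0 m a (z : Rn R m) : tnth (consR a z) ord0 = a.
Proof. by []. Qed.

Lemma tnth_consRS m a (z : Rn R m) i : tnth (consR a z) (lift ord0 i) = tnth z i.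
Proof. exact: tnthS. Qed.

Lemma consR_ext m a (z : Rn R m) (y : Rn R m.+1) :
  tnth y ord0 = a -> (forall i, tnth y (lift ord0 i) = tnth z i) -> y = consR a z.
Proof.
move=> ya yz; apply: eq_from_tnth => i.
case: (unliftP ord0 i) => [j ->|->]; first by rewrite yz tnth_consRS.
by rewrite ya.
Qed.

Lemma headRK m a (z : Rn R m) : headR (consR a z) = a.
Proof. by []. Qed.

Lemma tailRK m a (z : Rn R m) : tailR (consR a z) = z.
Proof. exact: val_inj. Qed.

Lemma measurable_headR m : measurable_fun [set: Rn R m.+1] (fun x => headR x).
Proof. exact: measurable_tnth. Qed.

Lemma measurable_tailR m : measurable_fun [set: Rn R m.+1] (@tailR R m).
Proof. exact: measurable_behead. Qed.

(** Only triangular maps with constant Jacobian occur, and for these the change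
   of variables formula follows from Tonelli's theorem one coordinate at a
   time; c is the absolute value of the determinant. *)
Definition jac m (T : Rn R m -> Rn R m) (c : R) :=
  [/\ measurable_fun setT T, 0 < c &
   forall F : Rn R m -> \bar R, measurable_fun setT F -> (forall x, 0 <= F x)%E ->
   (\int[lebesgueRn m]_x F x = c%:E * \int[lebesgueRn m]_x F (T x))%E].

Lemma jac_ext m (T T' : Rn R m -> Rn R m) c : T =1 T' -> jac T c -> jac T' c.
Proof. by move=> /funext ->. Qed.

Lemma jac_comp m (T T' : Rn R m -> Rn R m) c c' :
  jac T c -> jac T' c' -> jac (T \o T') (c * c').
Proof.
move=> [mT c0 HT] [mT' c'0 HT']; split; first exact: measurableT_comp.
  exact: mulr_gt0.
move=> F mF F0; rewrite HT// (HT' (F \o T)) ?EFinM ?muleA//.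
- exact: measurableT_comp.
- by move=> x; exact: F0.
Qed.

Lemma jac0 (T : Rn R 0 -> Rn R 0) : jac T 1.
Proof.
have TE : T = id by apply/funext => x; rewrite tuple0 [RHS]tuple0.
by rewrite TE; split => // F mF F0; rewrite mul1e.
Qed.

Lemma measurable_int_head m (F : Rn R m.+1 -> \bar R) : measurable_fun setT F ->
  (forall x, 0 <= F x)%E ->
  measurable_fun setT (fun z => \int[leb]_a F (consR a z))%E.
Proof.
move=> mF F0.
have mG : measurable_fun setT (fun p => F (@consRn R m p)).
  exact: measurableT_comp mF (@measurable_consRn R m).
exact: (measurable_fun_fubini_tonelli_G (m1 := leb) _ mG).
Qed.

Lemma measurable_int_tail m (F : Rn R m.+1 -> \bar R) : measurable_fun setT F ->
  (forall x, 0 <= F x)%E ->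
  measurable_fun setT (fun a => \int[lebesgueRn m]_z F (consR a z))%E.
Proof.
move=> mF F0.
have mG : measurable_fun setT (fun p => F (@consRn R m p)).
  exact: measurableT_comp mF (@measurable_consRn R m).
exact: (measurable_fun_fubini_tonelli_F (m2 := lebesgueRn m) _ mG).
Qed.

(** For fixed tail the head undergoes an affine change of variable, so the inner
   integral picks up the factor s before the tail is transformed. *)
Lemma jac_head m (s : R) (f : Rn R m -> R) (T : Rn R m -> Rn R m) c :
  0 < s -> measurable_fun setT f -> jac T c ->
  jac (fun x => consR (s * headR x + f (tailR x)) (T (tailR x))) (s * c).
Proof.
move=> s0 mf [mT c0 HT].
have mS : measurable_fun setT (fun x : Rn R m.+1 => consR (s * headR x + f (tailR x)) (T (tailR x))).
  apply: measurable_cons.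
    apply: measurable_funD.
      by apply: measurable_funM => //; exact: measurable_headR.
    exact: measurableT_comp mf (@measurable_tailR m).
  exact: measurableT_comp mT (@measurable_tailR m).
split; [exact: mS|exact: mulr_gt0|] => F mF F0.
rewrite integral_consRn_swap// HT; [|exact: measurable_int_head|]; last first.
  by move=> z; apply: integral_ge0.
rewrite integral_consRn_swap//; last exact: measurableT_comp.
rewrite (mulrC s) EFinM -muleA; congr *%E.
rewrite -ge0_integralZl_EFin//; last 3 first.
- by move=> z _; apply: integral_ge0.
- have := @measurable_int_head m _ (measurableT_comp mF mS).
  by apply => x; exact: F0.
- exact: ltW.
apply: eq_integral => z _.
rewrite (@ge0_integral_affine _ s (f z) s0 (fun a => F (consR a (T z))))//.
  by congr *%E; apply: eq_integral => a _; rewrite headRK tailRK.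
apply: (measurableT_comp mF); apply: measurable_cons; first exact: measurable_id.
exact: measurable_cst.
Qed.

(** Integrating the tail first, the map may depend measurably on the head as
   long as its Jacobian does not. *)
Lemma jac_tail m (T : R -> Rn R m -> Rn R m) c :
  measurable_fun setT (fun p : measurableTypeR R * Rn R m => T p.1 p.2) ->
  (forall a, jac (T a) c) ->
  jac (fun x => consR (headR x) (T (headR x) (tailR x))) c.
Proof.
move=> mT HT.
have mS : measurable_fun setT (fun x : Rn R m.+1 => consR (headR x) (T (headR x) (tailR x))).
  apply: measurable_cons; first exact: measurable_headR.
  exact: measurableT_comp mT (@measurable_unconsRn R m).
split; [exact: mS|by case: (HT 0)|] => F mF F0.
rewrite !integral_consRn//; last exact: measurableT_comp.
rewrite -ge0_integralZl_EFin//; last 3 first.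
- by move=> z _; apply: integral_ge0.
- have := @measurable_int_tail m _ (measurableT_comp mF mS).
  by apply => x; exact: F0.
- by apply: ltW; case: (HT 0).
apply: eq_integral => a _; case: (HT a) => _ _ -> //.
  by congr *%E; apply: eq_integral => z _; rewrite headRK tailRK.
apply: (measurableT_comp mF); apply: measurable_cons; first exact: measurable_cst.
exact: measurable_id.
Qed.

Lemma measurable_coordT d (X : measurableType d) m (T : X -> Rn R m) :
  (forall i, measurable_fun setT (fun x => tnth (T x) i)) -> measurable_fun setT T.
Proof. by move=> mT; apply/measurable_fun_tnthP => i; exact: mT. Qed.

Lemma jac_affine m (s : R) (b : 'I_m -> R) : 0 < s ->
  jac (fun x : Rn R m => [tuple s * tnth x i + b i | i < m]) (s ^+ m).
Proof.
move=> s0; elim: m b => [|m IH] b; first by rewrite expr0; exact: jac0.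
rewrite exprS; apply: jac_ext (jac_head s0 (f := cst (b ord0)) _ (IH (fun i => b (lift ord0 i)))) => //.
move=> x; apply/esym/consR_ext; first by rewrite tnth_mktuple.
by move=> i; rewrite !tnth_mktuple /= [in LHS](consR_eta x) tnth_consRS.
Qed.

End jacobian.

Section linear_changes.
Context {R : realType}.

Definition cumT m (g : Rn R m) : Rn R m :=
  [tuple \sum_(l < m | (l <= i)%N) tnth g l | i < m].

(** Partial sums are a unipotent triangular map: add the head to every partial
   sum of the tail. *)
Lemma jac_cumT m : jac (@cumT m) 1.
Proof.
elim: m => [|m IH]; first exact: jac0.
pose T (a : R) := (fun x : Rn R m => [tuple 1 * tnth x i + a | i < m]) \o @cumT m.
have HT a : jac (T a) 1.
  rewrite -[1]mul1r; apply: jac_comp => //.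
  have := @jac_affine R m 1 (fun=> a) ltr01; rewrite expr1n.
  by [].
apply: jac_ext (jac_tail (T := T) _ HT).
  move=> x; apply/esym/consR_ext.
    rewrite tnth_mktuple (bigD1 ord0)//= big1 ?addr0// => i /andP[] /=.
    by rewrite leqn0 => /eqP i0; rewrite -val_eqE /= i0.
  move=> i; rewrite !tnth_mktuple big_mkcond big_ord_recl /= addrC mul1r.
  congr (_ + _); rewrite [RHS]big_mkcond /=; apply: eq_bigr => l _.
  rewrite /bump leq0n !add1n ltnS; case: ifP => // _.
  by rewrite [in LHS](consR_eta x) tnth_consRS.
apply: measurable_coordT => i.
apply: (@eq_measurable_fun _ _ _ _ _ (fun p : measurableTypeR R * Rn R m => 1 * tnth (cumT p.2) i + p.1)).
  by move=> p _; rewrite [RHS]tnth_mktuple.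
apply: measurable_funD; last exact: measurable_fst.
apply: measurable_funM => //.
apply: (measurableT_comp (measurable_tnth i)).
by apply: measurableT_comp measurable_snd; case: IH.
Qed.

Definition lin m (L : 'I_m -> 'I_m -> R) (z : Rn R m) : Rn R m :=
  [tuple \sum_(j < m) L i j * tnth z j | i < m].

Definition qform m (A : 'I_m -> 'I_m -> R) (z : Rn R m) : R :=
  \sum_(i < m) \sum_(j < m) A i j * (tnth z i * tnth z j).

Definition sqn m (z : Rn R m) : R := \sum_(i < m) tnth z i ^+ 2.

Lemma measurable_linear_form m (c : 'I_m -> R) :
  measurable_fun setT (fun z : Rn R m => \sum_(j < m) c j * tnth z j).
Proof.
by apply: measurable_sum => j; apply: measurable_funM => //; exact: measurable_tnth.
Qed.

(** Completing the square in the first coordinate leaves a form in the others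
   that inherits the lower bound r: evaluate the whole form at the point where
   the square vanishes. The resulting L is upper triangular, which is what
   gives it a Jacobian without any theory of determinants. *)
Lemma cholesky m (A : 'I_m -> 'I_m -> R) (r : R) : 0 < r ->
  (forall i j, A i j = A j i) -> (forall z, r * sqn z <= qform A z) ->
  exists L c, jac (lin L) c /\ forall z, qform A (lin L z) = sqn z.
Proof.
move=> r0; elim: m A => [|m IH] A symA posA.
  exists A, 1; split; first exact: jac0.
  by move=> z; rewrite /qform /sqn !big_ord0.
pose a := A ord0 ord0; pose S := lift (@ord0 m).
have a0 : 0 < a.
  have := posA [tuple (i == ord0)%:R | i < m.+1].
  rewrite /sqn /qform !(big_ord_recl m) !tnth_mktuple /= big1 ?addr0; last first.
    by move=> i _; rewrite tnth_mktuple /= expr0n.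
  rewrite expr1n !mulr1 [X in _ + X + _]big1; last by move=> i _; rewrite tnth_mktuple /= !mulr0.
  rewrite [X in _ + X]big1; first by rewrite !addr0; exact: lt_le_trans.
  move=> i _; apply: big1 => j _; rewrite !tnth_mktuple /= mul0r mulr0//.
pose b j := A ord0 (S j) / a.
pose B i j := A (S i) (S j) - b i * b j * a.
pose be (y : Rn R m) := \sum_(j < m) b j * tnth y j.
have qE (t : R) (y : Rn R m) : qform A (consR t y) = a * (t + be y) ^+ 2 + qform B y.
  rewrite /qform big_ord_recl big_ord_recl /= -/a.
  rewrite (_ : \sum_(i < m) A ord0 (lift ord0 i) * _ = t * a * be y); last first.
    rewrite /be mulr_sumr; apply: eq_bigr => j _; rewrite tnth_consRS /b tnth_consR0 /S.
    by field; rewrite gt_eqF.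
  rewrite [X in _ + X = _](_ : _ = t * a * be y + \sum_(i < m) \sum_(j < m) A (S i) (S j) * (tnth y i * tnth y j)); last first.
    rewrite /be mulr_sumr -big_split /=; apply: eq_bigr => i _.
    rewrite big_ord_recl; congr (_ + _).
      rewrite tnth_consRS tnth_consR0 /b /S symA.
      by field; rewrite gt_eqF.
    by apply: eq_bigr => j _; rewrite !tnth_consRS.
  have -> : \sum_(i < m) \sum_(j < m) A (S i) (S j) * (tnth y i * tnth y j) =
     \sum_(i < m) \sum_(j < m) B i j * (tnth y i * tnth y j) + a * be y ^+ 2.
    rewrite expr2 {1}/be mulr_suml mulr_sumr -big_split /=; apply: eq_bigr => i _.
    rewrite /= /be !mulr_sumr -big_split; apply: eq_bigr => j _ /=.
    by rewrite /B; ring.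
  by rewrite tnth_consR0; ring.
have [L' [c [jL' qL']]] : exists L c, jac (lin L) c /\ forall z, qform B (lin L z) = sqn z.
  apply: IH.
    by move=> i j; rewrite /B (symA (S i)) (mulrC (b i)).
  move=> y; have := posA (consR (- be y) y).
  rewrite qE addNr expr0n mulr0 add0r; apply: le_trans.
  have -> : sqn (consR (- be y) y) = be y ^+ 2 + sqn y.
    rewrite /sqn big_ord_recl tnth_consR0 sqrrN; congr (_ + _).
    by apply: eq_bigr => i _; rewrite tnth_consRS.
  by rewrite ler_pM2l// lerDr sqr_ge0.
pose L i j : R := match unlift ord0 i, unlift ord0 j with
  | None, None => (Num.sqrt a)^-1
  | None, Some j' => - \sum_(k < m) b k * L' k j'
  | Some _, None => 0
  | Some i', Some j' => L' i' j' end.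
have LE z : lin L z = consR ((Num.sqrt a)^-1 * headR z + - be (lin L' (tailR z))) (lin L' (tailR z)).
  apply: consR_ext.
    rewrite tnth_mktuple big_ord_recl /L unlift_none; congr (_ + _).
    rewrite /be; under [in RHS]eq_bigr do rewrite tnth_mktuple mulr_sumr.
    rewrite exchange_big /= -sumrN; apply: eq_bigr => j _.
    rewrite liftK mulNr mulr_suml; congr (- _); apply: eq_bigr => k _.
    by rewrite [in LHS](consR_eta z) tnth_consRS mulrA.
  move=> i; rewrite !tnth_mktuple big_ord_recl /L liftK unlift_none mul0r add0r.
  by apply: eq_bigr => j _; rewrite liftK [in LHS](consR_eta z) tnth_consRS.
have sa0 : 0 < Num.sqrt a by rewrite sqrtr_gt0.
exists L, ((Num.sqrt a)^-1 * c); split.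
  apply: jac_ext (jac_head (T := lin L') (f := fun y => - be (lin L' y)) _ _ jL').
  - by move=> z; rewrite LE.
  - by rewrite invr_gt0.
  - apply: measurableT_comp => //.
    by apply: (measurableT_comp (measurable_linear_form b)); case: jL'.
move=> z; rewrite LE qE qL' addrNK [in RHS](consR_eta z) /sqn big_ord_recl; congr (_ + _).
  rewrite exprMn exprVn sqr_sqrtr; last exact: ltW.
  by rewrite mulrA divff ?mul1r// gt_eqF.
by apply: eq_bigr => i _; rewrite tnth_consRS.
Qed.
End linear_changes.

(** * The Gaussian Poincare inequality *)

Section hardy.
Context {R : realType}.
Local Notation leb := (@lebesgue_measure R).

Lemma integral_FTC (W w : R -> R) (a b : R) : a < b ->
  (forall x, a <= x <= b -> is_derive x 1 W (w x)) ->
  (forall x, a <= x <= b -> {for x, continuous w}) ->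
  (\int[leb]_(x in `[a, b]) (w x)%:E = (W b - W a)%:E)%E.
Proof.
move=> ab dW cw; rewrite EFinB.
have cW x : a <= x <= b -> {for x, continuous W}.
  by move=> /dW ?; apply/differentiable_continuous/derivable1_diffP.
apply: continuous_FTC2 => //.
- apply: continuous_in_subspaceT => x /[!inE] /=; rewrite in_itv /=; exact: cw.
- split.
  + move=> x; rewrite in_itv /= => /andP[ax xb].
    by apply: (@ex_derive _ _ _ _ _ _ (w x)); apply: dW; rewrite (ltW ax) (ltW xb).
  + by apply: cvg_at_right_filter; apply: cW; rewrite lexx ltW.
  + by apply: cvg_at_left_filter; apply: cW; rewrite lexx ltW.
- move=> x; rewrite in_itv /= => /andP[ax xb].
  have dWx : is_derive x 1 W (w x) by apply: dW; rewrite (ltW ax) (ltW xb).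
  by rewrite derive1E derive_val.
Qed.

Lemma continuous_is_derive (f f' : R -> R) :
  (forall x : R, is_derive x 1 f (f' x)) -> continuous f.
Proof.
by move=> df x; apply/differentiable_continuous/derivable1_diffP; case: (df x).
Qed.

Lemma is_derive_gauss (x : R) : is_derive x 1 (@gauss_fun R) (- (2 * x) * gauss_fun x).
Proof.
have : is_derive x 1 (expR \o (fun y : R => - y ^+ 2)) (expR (- x ^+ 2) * (- (2 * x))).
  apply: is_derive1_comp; apply: is_derive_eq.
  by rewrite /GRing.scale /= !mulr1; ring.
by rewrite mulrC.
Qed.

Variables (f f' : R -> R).
Hypothesis df : forall x : R, is_derive x 1 f (f' x).
Hypothesis cf' : continuous f'.
Local Notation g := (@gauss_fun R).

Let cf : continuous f := continuous_is_derive df.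
Let u x := f x - f 0.

Let cu : continuous u.
Proof. by move=> x; apply: cvgB; [exact: cf|exact: cvg_cst]. Qed.

Let W x := u x ^+ 2 * x^-1 * g x.
Let w x := (2 * u x * f' x * x^-1 - u x ^+ 2 * x^-2 - 2 * u x ^+ 2) * g x.

Let dW (x : R) : 0 < x -> is_derive x 1 W (w x).
Proof.
move=> x0; have x_neq0 : x != 0 by rewrite gt_eqF.
have du : is_derive x 1 u (f' x).
  have -> : f' x = f' x - 0 by rewrite subr0.
  by apply: is_deriveB.
have dx : is_derive x 1 (fun y : R => y^-1) (- x^-2).
  by apply: is_derive_eq; [apply: is_deriveV|rewrite /GRing.scale /= mulr1].
have dg := is_derive_gauss x.
have dW0 := is_deriveM (is_deriveM (is_deriveM du du) dx) dg.
apply: (is_derive_eq dW0).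
rewrite /w /GRing.scale /= -[(u * u * _) x]/(u x * u x * x^-1) -[(u * u) x]/(u x * u x).
by field.
Qed.

(** With u = f - f 0 and weight g = e^(-x^2), the derivative w of u^2 g / x
   satisfies 2 u^2 g + w = f'^2 g - (f' - u/x)^2 g, so integrating w gives a
   weighted Hardy inequality with boundary terms W of known sign. *)
Lemma hardy_segment (a b : R) : 0 < a -> a < b ->
  (\int[leb]_(x in `[a, b]) (2 * u x ^+ 2 * g x)%:E <=
   \int[leb]_(x in `[a, b]) (f' x ^+ 2 * g x)%:E + (W a)%:E)%E.
Proof.
move=> a0 ab.
have xgt0 x : a <= x <= b -> 0 < x by move=> /andP[ax _]; exact: lt_le_trans ax.
have cg : continuous g := @continuous_gauss_fun R.
have c1 : continuous (fun x => 2 * u x ^+ 2 * g x).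
  move=> x; apply: cvgM; last exact: cg.
  by apply: cvgM; [exact: cvg_cst|apply: cvgM; exact: cu].
have c2 : continuous (fun x => f' x ^+ 2 * g x).
  by move=> x; apply: cvgM; [apply: cvgM; exact: cf'|exact: cg].
have cw x : a <= x <= b -> {for x, continuous w}.
  move=> /xgt0 x0; apply: cvgM; last exact: cg.
  have cV : {for x, continuous (fun y : R => y^-1)} by apply: cvgV; rewrite ?gt_eqF.
  apply: cvgB; last by apply: cvgM; [exact: cvg_cst|apply: cvgM; exact: cu].
  apply: cvgB.
    apply: cvgM; last exact: cV.
    by apply: cvgM; [apply: cvgM; [exact: cvg_cst|exact: cu]|exact: cf'].
  apply: cvgM; first by apply: cvgM; exact: cu.
  apply: (@cvgV _ _ _ _ (fun y : R => y ^+ 2)); first by rewrite expf_neq0// gt_eqF.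
  by apply: cvgM.
have := integral_FTC ab (fun x xab => dW (xgt0 x xab)) cw.
have int h : continuous h -> leb.-integrable `[a, b] (EFin \o h).
  move=> ch; apply: continuous_compact_integrable; first exact: segment_compact.
  exact: continuous_subspaceT.
have iw : leb.-integrable `[a, b] (EFin \o w).
  apply: continuous_compact_integrable; first exact: segment_compact.
  by apply: continuous_in_subspaceT => x /[!inE] /=; rewrite in_itv /=; exact: cw.
move=> FTC.
have W0 : 0 <= W b.
  rewrite /W mulr_ge0 ?gauss_fun_ge0// mulr_ge0 ?sqr_ge0// invr_ge0.
  by apply: ltW; exact: lt_trans ab.
apply: (@le_trans _ _ (\int[leb]_(x in `[a, b]) (2 * u x ^+ 2 * g x)%:E + (W b - W a)%:E + (W a)%:E)%E).
  rewrite -addeA -EFinD addrNK leeDl// lee_fin//.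
rewrite leeD2r// -FTC -integralD; [|exact: measurable_itv|exact: (int _ c1)|exact: iw].
apply: le_integral => //.
- by apply: integrableD => //; exact: (int _ c1).
- exact: (int _ c2).
move=> x; rewrite inE /= in_itv /= => /xgt0 x0.
rewrite -EFinD lee_fin -mulrDl ler_pM2r ?expR_gt0//.
rewrite -subr_ge0 [leRHS](_ : _ = (f' x - u x * x^-1) ^+ 2) ?sqr_ge0//.
by field; rewrite gt_eqF.
Qed.

Let W_cvg : W (k.+1%:R^-1) @[k --> \oo] --> 0.
Proof.
have h0 : (fun k : nat => k.+1%:R^-1 : R) @ \oo --> 0 by exact: cvg_harmonic.
have hq : (fun k : nat => u (k.+1%:R^-1) / k.+1%:R^-1) @ \oo --> f' 0.
  have d0 : (fun h : R => h^-1 * (f h - f 0)) @ 0^' --> f' 0.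
    have := @ex_derive _ _ _ _ _ _ _ (df 0); rewrite /derivable => /cvg_ex[l hl].
    have := @derive_val _ _ _ _ _ _ _ (df 0); rewrite /derive => <-.
    rewrite (cvg_lim _ hl)//; apply: cvg_trans hl; apply: near_eq_cvg.
    by near=> h; rewrite /GRing.scale /= mulr1 addr0.
  have h0' : (fun k : nat => k.+1%:R^-1 : R) @ \oo --> 0^'.
    move=> A [e e0 HA]; have := h0; move/cvgrPdist_lt => /(_ e e0).
    apply: filterS => k ke; apply: (HA _ ke).
    by apply: invr_neq0; rewrite pnatr_eq0.
  have := cvg_comp _ _ h0' d0; apply: cvg_trans; apply: near_eq_cvg.
  by near=> k; rewrite /= /u mulrC.
have hu : (fun k : nat => u (k.+1%:R^-1)) @ \oo --> 0.
  have -> : 0 = u 0 by rewrite /u subrr.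
  by apply: (cvg_comp _ _ h0); exact: cu.
have hg : (fun k : nat => g (k.+1%:R^-1)) @ \oo --> g 0.
  by apply: (cvg_comp _ _ h0); exact: continuous_gauss_fun.
have := cvgM (cvgM hu hq) hg; rewrite mul0r mul0r.
move=> H; apply: (cvg_trans _ (H _ _)); apply: near_eq_cvg; near=> k.
by rewrite /W /= expr2 !mulrA.
Unshelve. all: by end_near. Qed.

(** The lower boundary term tends to zero since u vanishes to first order at
   the origin, while the integrals increase to those over the half line. *)
Lemma hardy_halfline :
  (\int[leb]_(x in `]0%R, +oo[) (2 * u x ^+ 2 * g x)%:E <=
   \int[leb]_(x in `]0%R, +oo[) (f' x ^+ 2 * g x)%:E)%E.
Proof.
have cg : continuous g := @continuous_gauss_fun R.
have c1 : continuous (fun x => 2 * u x ^+ 2 * g x).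
  move=> x; apply: cvgM; last exact: cg.
  by apply: cvgM; [exact: cvg_cst|apply: cvgM; exact: cu].
have c2 : continuous (fun x => f' x ^+ 2 * g x).
  by move=> x; apply: cvgM; [apply: cvgM; exact: cf'|exact: cg].
pose F (k : nat) : set (measurableTypeR R) := `[(k.+1%:R^-1 : R), k.+2%:R]%classic.
have FU : \bigcup_k F k = `]0, +oo[%classic.
  apply/seteqP; split => [x [k _]|x] /=.
    rewrite /F /= !in_itv /= andbT => /andP[+ _].
    by apply: lt_le_trans; rewrite invr_gt0.
  rewrite in_itv /= andbT => x0.
  exists (maxn (Num.truncn x) (Num.truncn x^-1)) => //=; rewrite /F /= in_itv /=; apply/andP; split.
    rewrite -[leRHS]invrK lef_pV2 ?posrE ?invr_gt0 ?ltr0n//.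
    apply: (le_trans (ltW (truncnS_gt _))).
    by rewrite ler_nat ltnS leq_maxr.
  apply: (le_trans (ltW (truncnS_gt _))).
  by rewrite ler_nat ltnS; apply: (leq_trans (leq_maxl _ _)); exact: leqnSn.
have H : (\int[leb]_(x in F k) (2 * u x ^+ 2 * g x)%:E @[k --> \oo] -->
  \int[leb]_(x in `]0%R, +oo[) (2 * u x ^+ 2 * g x)%:E)%E.
  rewrite -FU; apply: ge0_nondecreasing_set_cvg_integral.
  - move=> i j ij; apply/subsetPset => x; rewrite /F /= !in_itv /= => /andP[h1 h2].
    apply/andP; split.
      by apply: le_trans h1; rewrite lef_pV2 ?posrE// ler_nat.
    by apply: (le_trans h2); rewrite ler_nat !ltnS.
  - by move=> i; exact: measurable_itv.
  - by move=> i; apply/measurable_EFinP/measurable_funTS; exact: continuous_measurable_fun.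
  - by move=> i x _; rewrite lee_fin mulr_ge0 ?gauss_fun_ge0// mulr_ge0 ?sqr_ge0.
set I2 := (X in (_ <= X)%E).
have I2W : (I2 + (W k.+1%:R^-1)%:E @[k --> \oo] --> I2)%E.
  rewrite -[X in _ --> X]adde0; apply: cvgeD => //.
  - by case: I2.
  - exact: cvg_cst.
  - by apply: cvg_EFin; [exact: nearW|exact: W_cvg].
rewrite -(cvg_lim _ H)// -[leRHS](cvg_lim _ I2W)//.
apply: lee_lim; [by apply/cvg_ex; eexists; exact: H|by apply/cvg_ex; eexists; exact: I2W|].
apply: nearW => k.
have ab : (k.+1%:R^-1 : R) < k.+2%:R.
  apply: (@le_lt_trans _ _ 1); first by rewrite invf_le1// ler1n.
  by rewrite ltr1n.
apply: le_trans (hardy_segment _ ab) _; first by rewrite invr_gt0.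
apply: leeD => //; apply: ge0_subset_integral => //.
- apply/measurable_EFinP/measurable_funTS; exact: continuous_measurable_fun.
- by move=> x _; rewrite lee_fin mulr_ge0 ?gauss_fun_ge0// ?sqr_ge0.
- by rewrite -FU => x Fx; exists k.
Qed.

End hardy.

Section poincare_line.
Context {R : realType}.
Local Notation leb := (@lebesgue_measure R).
Local Notation g := (@gauss_fun R).

Lemma integral_half_split (k : R -> R) : measurable_fun setT k -> (forall x, 0 <= k x) ->
  (\int[leb]_x (k x)%:E = \int[leb]_(x in `]0%R, +oo[) (k (- x))%:E +
     \int[leb]_(x in `]0%R, +oo[) (k x)%:E)%E.
Proof.
move=> mk k0.
have mkN : measurable_fun setT (fun x : R => k (- x)).
  by apply: measurableT_comp mk _; exact: oppr_measurable.
have -> : [set: R] = `]-oo, 0]%classic `|` `]0, +oo[%classic.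
  by rewrite -itv_bndbnd_setU//= set_itvNyy.
rewrite ge0_integral_setU//=; last 3 first.
- exact/measurable_EFinP/measurable_funTS.
- by move=> x _; rewrite lee_fin.
- apply/disj_setPS => x [] /=; rewrite !in_itv /= andbT => h1 h2.
  by have := lt_le_trans h2 h1; rewrite ltxx.
congr (_ + _)%E.
have := @ge0_integration_by_substitution0 R (fun x => (k (- x))%:E).
rewrite -integral_itv_obnd_cbnd; last exact/measurable_EFinP/measurable_funTS.
move=> ->//; last 2 first.
- exact/measurable_EFinP.
- by move=> r; rewrite lee_fin.
by apply: eq_integral => x _; rewrite opprK.
Qed.

Variables (f f' : R -> R).
Hypothesis df : forall x : R, is_derive x 1 f (f' x).
Hypothesis cf' : continuous f'.

Let cf : continuous f := continuous_is_derive df.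

Let mf : measurable_fun setT f := continuous_measurable_fun cf.
Let mf' : measurable_fun setT f' := continuous_measurable_fun cf'.

Lemma hardy_line :
  (\int[leb]_x (2 * (f x - f 0) ^+ 2 * g x)%:E <=
   \int[leb]_x (f' x ^+ 2 * g x)%:E)%E.
Proof.
have mg : measurable_fun setT g := @measurable_gauss_fun R.
rewrite integral_half_split; last 2 first.
- by apply: measurable_funM => //; apply: measurable_funM => //;
    apply: measurable_funX; apply: measurable_funB.
- by move=> x; rewrite mulr_ge0 ?gauss_fun_ge0// mulr_ge0 ?sqr_ge0.
rewrite [leRHS]integral_half_split; last 2 first.
- by apply: measurable_funM => //; apply: measurable_funX.
- by move=> x; rewrite mulr_ge0 ?gauss_fun_ge0// ?sqr_ge0.
apply: leeD; last exact: hardy_halfline.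
have gN x : g (- x) = g x by rewrite /gauss_fun sqrrN.
have dfN (x : R) : is_derive x 1 (f \o -%R) (- f' (- x)).
  have dN : is_derive x 1 (-%R : R -> R) (-1) by exact: is_deriveNid.
  by apply: (is_derive_eq (is_derive1_comp (df (- x)) dN)); rewrite mulrN1.
have cfN : continuous (fun x => - f' (- x)).
  by move=> x; apply: cvgN; apply: continuous_comp; [exact: opp_continuous|exact: cf'].
have := hardy_halfline dfN cfN; rewrite /= oppr0.
under eq_integral do rewrite -gN.
under [X in (_ <= X)%E -> _]eq_integral do rewrite sqrrN -gN.
by [].
Qed.

(** Compare both f x and f y with f 0 and use the Hardy inequality on the two
   half lines; f 0 need not be the mean. *)
Lemma poincare_line :
  (\int[leb]_x \int[leb]_y ((f x - f y) ^+ 2 * (g x * g y))%:E <=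
   2%:E * \int[leb]_x (g x)%:E * \int[leb]_x (f' x ^+ 2 * g x)%:E)%E.
Proof.
have mg : measurable_fun setT g := @measurable_gauss_fun R.
have g0 x : 0 <= g x := gauss_fun_ge0 x.
pose v x := 2 * (f x - f 0) ^+ 2 * g x.
have mv : measurable_fun setT v.
  by apply: measurable_funM => //; apply: measurable_funM => //;
    apply: measurable_funX; apply: measurable_funB.
have v0 x : 0 <= v x by rewrite mulr_ge0// mulr_ge0// sqr_ge0.
pose G := (\int[leb]_x (g x)%:E)%E.
pose H := (\int[leb]_x (v x)%:E)%E.
have G0 : (0 <= G)%E by apply: integral_ge0 => x _; rewrite lee_fin.
have H0 : (0 <= H)%E by apply: integral_ge0 => x _; rewrite lee_fin.
apply: (@le_trans _ _ (\int[leb]_x ((v x)%:E * G + (g x)%:E * H))%E).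
  apply: ge0_le_integral => //.
  - by move=> x _; apply: integral_ge0 => y _; rewrite lee_fin mulr_ge0 ?sqr_ge0// mulr_ge0.
  - apply: (measurable_fun_fubini_tonelli_F (m2 := leb) (fun p : R * R => ((f p.1 - f p.2) ^+ 2 * (g p.1 * g p.2))%:E)).
      apply/measurable_EFinP; apply: measurable_funM.
        apply: measurable_funX; apply: measurable_funB.
          exact: measurableT_comp mf measurable_fst.
        exact: measurableT_comp mf measurable_snd.
      apply: measurable_funM.
        exact: measurableT_comp mg measurable_fst.
      exact: measurableT_comp mg measurable_snd.
    by move=> p; rewrite lee_fin mulr_ge0 ?sqr_ge0// mulr_ge0.
  - apply: emeasurable_funD; apply: emeasurable_funM => //; exact/measurable_EFinP.
  - move=> x _; rewrite /G /H -!ge0_integralZl//; [|exact/measurable_EFinP|by move=> ? _; rewrite lee_fin|by rewrite lee_fin|exact/measurable_EFinP|by move=> ? _; rewrite lee_fin|by rewrite lee_fin].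
    rewrite -ge0_integralD//; last 4 first.
    + by move=> y _; rewrite -EFinM lee_fin mulr_ge0.
    + by apply: emeasurable_funM => //; exact/measurable_EFinP.
    + by move=> y _; rewrite -EFinM lee_fin mulr_ge0.
    + by apply: emeasurable_funM => //; exact/measurable_EFinP.
    apply: ge0_le_integral => //.
    + by move=> y _; rewrite lee_fin mulr_ge0 ?sqr_ge0// mulr_ge0.
    + apply/measurable_EFinP; apply: measurable_funM; last exact: measurable_funM.
      by apply: measurable_funX; exact: measurable_funB.
    + by apply: emeasurable_funD; apply: emeasurable_funM => //; exact/measurable_EFinP.
    + move=> y _; rewrite -!EFinM -EFinD lee_fin /v.
      have -> : 2 * (f x - f 0) ^+ 2 * g x * g y + g x * (2 * (f y - f 0) ^+ 2 * g y) =
        (2 * (f x - f 0) ^+ 2 + 2 * (f y - f 0) ^+ 2) * (g x * g y) by ring.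
      apply: ler_wpM2r; first exact: mulr_ge0.
      have := sqr_ge0 ((f x - f 0) + (f y - f 0)); lra.
rewrite ge0_integralD//; last 4 first.
- by move=> x _; rewrite mule_ge0// lee_fin.
- by apply: emeasurable_funM => //; exact/measurable_EFinP.
- by move=> x _; rewrite mule_ge0// lee_fin.
- by apply: emeasurable_funM => //; exact/measurable_EFinP.
rewrite !ge0_integralZr//; [|exact/measurable_EFinP|by move=> ? _; rewrite lee_fin|exact/measurable_EFinP|by move=> ? _; rewrite lee_fin].
rewrite -/G -/H [(H * G)%E]muleC -mule2n -mule_natl muleA.
by apply: lee_wpmul2l; [rewrite mule_ge0|exact: hardy_line].
Qed.
End poincare_line.

Section sum_inequality.
Context {R : realType} (d : measure_display) (T : measurableType d).
Variable mu : {measure set T -> \bar R}.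
Local Open Scope ereal_scope.

Lemma ge0_le_integral_sum (f1 f2 g1 g2 g3 g4 : T -> R) :
  [/\ measurable_fun setT f1, measurable_fun setT f2, measurable_fun setT g1,
     measurable_fun setT g2 & measurable_fun setT g3 /\ measurable_fun setT g4] ->
  (forall x, [/\ 0 <= f1 x, 0 <= f2 x, 0 <= g1 x, 0 <= g2 x & 0 <= g3 x /\ 0 <= g4 x]%R) ->
  (forall x, f1 x + f2 x <= (g1 x + g2 x) + (g3 x + g4 x))%R ->
  \int[mu]_x (f1 x)%:E + \int[mu]_x (f2 x)%:E <=
  (\int[mu]_x (g1 x)%:E + \int[mu]_x (g2 x)%:E) +
  (\int[mu]_x (g3 x)%:E + \int[mu]_x (g4 x)%:E).
Proof.
move=> [/measurable_EFinP mf1 /measurable_EFinP mf2 /measurable_EFinP mg1 /measurable_EFinP mg2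
  [/measurable_EFinP mg3 /measurable_EFinP mg4]] pos le.
have m12 := emeasurable_funD mf1 mf2.
have n12 := emeasurable_funD mg1 mg2.
have n34 := emeasurable_funD mg3 mg4.
have p x : [/\ 0 <= (f1 x)%:E, 0 <= (f2 x)%:E, 0 <= (g1 x)%:E, 0 <= (g2 x)%:E & 0 <= (g3 x)%:E /\ 0 <= (g4 x)%:E].
  by have [] := pos x; rewrite !lee_fin.
rewrite -!ge0_integralD//; try by move=> x _; case: (p x) => ? ? ? ? [? ?]; rewrite ?adde_ge0.
apply: ge0_le_integral => //.
- by move=> x _; case: (p x) => ? ? ? ? [? ?]; rewrite ?adde_ge0.
- exact: emeasurable_funD.
- by move=> x _; rewrite -!EFinD lee_fin.
Qed.
End sum_inequality.

Section exchange.
Context {R : realType} (d1 d2 dS dU : measure_display) (T1 : measurableType d1) (T2 : measurableType d2).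
Context (S : measurableType dS) (U : measurableType dU).
Variables (nu1 : {sigma_finite_measure set S -> \bar R}).
Variables (nu2 : {sigma_finite_measure set U -> \bar R}).
Variables (a b : S -> T1) (x y : U -> T2) (sS : S -> S) (sU : U -> U).
Variables (f : T1 * T2 -> R) (w1 : S -> R) (w2 : U -> R).
Hypothesis ma : measurable_fun setT a.
Hypothesis mb : measurable_fun setT b.
Hypothesis mx : measurable_fun setT x.
Hypothesis my : measurable_fun setT y.
Hypothesis mf : measurable_fun setT f.
Hypothesis mw1 : measurable_fun setT w1.
Hypothesis mw2 : measurable_fun setT w2.
Hypothesis w10 : forall s, 0 <= w1 s.
Hypothesis w20 : forall s, 0 <= w2 s.
Hypothesis aS : forall s, a (sS s) = b s.
Hypothesis bS : forall s, b (sS s) = a s.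
Hypothesis xU : forall s, x (sU s) = y s.
Hypothesis yU : forall s, y (sU s) = x s.
Hypothesis w1S : forall s, w1 (sS s) = w1 s.
Hypothesis w2U : forall s, w2 (sU s) = w2 s.
Local Open Scope ereal_scope.
Hypothesis nuS : forall phi : S -> \bar R, measurable_fun setT phi ->
  (forall s, 0 <= phi s) -> \int[nu1]_s phi (sS s) = \int[nu1]_s phi s.
Hypothesis nuU : forall phi : U -> \bar R, measurable_fun setT phi ->
  (forall s, 0 <= phi s) -> \int[nu2]_s phi (sU s) = \int[nu2]_s phi s.

Let Q (u u' : S -> T1) (v v' : U -> T2) (p : S * U) : R :=
  ((f (u p.1, v p.2) - f (u' p.1, v' p.2)) ^+ 2 * (w1 p.1 * w2 p.2))%R.

Let mfc (u : S -> T1) (v : U -> T2) : measurable_fun setT u -> measurable_fun setT v ->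
  measurable_fun setT (fun p : S * U => f (u p.1, v p.2)).
Proof.
move=> mu mv; apply: (measurableT_comp mf).
exact: measurable_fun_pair (measurableT_comp mu measurable_fst) (measurableT_comp mv measurable_snd).
Qed.

Let mQ u u' v v' : measurable_fun setT u -> measurable_fun setT u' ->
  measurable_fun setT v -> measurable_fun setT v' ->
  measurable_fun setT (fun p => (Q u u' v v' p)%:E).
Proof.
move=> mu mu' mv mv'; apply/measurable_EFinP; apply: measurable_funM.
  by apply: measurable_funX; apply: measurable_funB; exact: mfc.
apply: measurable_funM; first exact: measurableT_comp mw1 measurable_fst.
exact: measurableT_comp mw2 measurable_snd.
Qed.
Let Q0 u u' v v' p : 0 <= (Q u u' v v' p)%:E.
Proof. by rewrite lee_fin; apply: mulr_ge0; [exact: sqr_ge0|exact: mulr_ge0]. Qed.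

Let I u u' v v' := \int[nu1]_s \int[nu2]_t (Q u u' v v' (s, t))%:E.

Let IE u u' v v' : measurable_fun setT u -> measurable_fun setT u' ->
  measurable_fun setT v -> measurable_fun setT v' ->
  I u u' v v' = \int[nu1 \x nu2]_p (Q u u' v v' p)%:E.
Proof. by move=> mu mu' mv mv'; rewrite fubini_tonelli1//; exact: mQ. Qed.

Let swapS v v' : measurable_fun setT v -> measurable_fun setT v' -> I b a v v' = I a b v v'.
Proof.
move=> mv mv'; rewrite /I.
rewrite -[RHS]nuS; last 2 first.
- exact: (measurable_fun_fubini_tonelli_F (m2 := nu2) _ (mQ ma mb mv mv') (@Q0 a b v v')).
- by move=> s; apply: integral_ge0 => t _; exact: Q0.
by apply: eq_integral => s _; apply: eq_integral => t _; rewrite /Q /= aS bS w1S.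
Qed.

Let swapSd v v' : measurable_fun setT v -> measurable_fun setT v' -> I b b v v' = I a a v v'.
Proof.
move=> mv mv'; rewrite /I.
rewrite -[RHS]nuS; last 2 first.
- exact: (measurable_fun_fubini_tonelli_F (m2 := nu2) _ (mQ ma ma mv mv') (@Q0 a a v v')).
- by move=> s; apply: integral_ge0 => t _; exact: Q0.
by apply: eq_integral => s _; apply: eq_integral => t _; rewrite /Q /= aS w1S.
Qed.

Let swapUd : I a b y y = I a b x x.
Proof.
apply: eq_integral => s _; rewrite -[RHS]nuU; last 2 first.
- exact: measurableT_comp (mQ ma mb mx mx) (pair1_measurable s).
- by move=> t; exact: Q0.
by apply: eq_integral => t _; rewrite /Q /= xU w2U.
Qed.

(** For four points, (p1 - p4)^2 + (p2 - p3)^2 <= (p1 - p2)^2 + (p3 - p4)^2 +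
   (p1 - p3)^2 + (p2 - p4)^2, because the difference is the square of
   p1 - p2 - p3 + p4. After integration the terms on either side coincide in
   pairs, thanks to the symmetry of the measures under exchange of the two
   copies. It is stated for abstract swaps rather than for pairs, which keeps
   the four-fold product measures out of the argument. *)
Lemma exchange_inequality : I a b x y <= I a b x x + I a a x y.
Proof.
have E2 (r : \bar R) : r + r = 2%:E * r by rewrite -mule2n -mule_natl.
have h : I a b x y + I b a x y <= (I a b x x + I a b y y) + (I a a x y + I b b x y).
  rewrite (IE ma mb mx my) (IE mb ma mx my) (IE ma mb mx mx) (IE ma mb my my) (IE ma ma mx my) (IE mb mb mx my).
  apply: ge0_le_integral_sum.
  - have mQ' u u' v v' mu mu' mv mv' := (measurable_EFinP _ _).1 (@mQ u u' v v' mu mu' mv mv').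
    by split; first [exact: mQ'|split; exact: mQ'].
  - have Q0' u u' v v' p : (0 <= Q u u' v v' p)%R by rewrite -lee_fin; exact: Q0.
    by move=> p; split; first [exact: Q0'|split; exact: Q0'].
  move=> p; rewrite /Q -!mulrDl.
  apply: ler_wpM2r; first exact: mulr_ge0.
  move: (f _) (f _) (f _) (f _) => p1 p4 p2 p3.
  rewrite -subr_ge0 [leRHS](_ : _ = (p1 - p2 - p3 + p4) ^+ 2)%R; last by ring.
  exact: sqr_ge0.
have I0 u u' v v' : 0 <= I u u' v v'.
  by apply: integral_ge0 => s _; apply: integral_ge0 => t _; exact: Q0.
move: h; rewrite swapUd (swapS mx my) (swapSd mx my).
move: (I a b x y) (I a b x x) (I a a x y) (I0 a b x x) (I0 a a x y) => D A B A0 B0.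
by rewrite !E2 -ge0_muleDr// lee_pmul2l.
Qed.
End exchange.

Section sigma_finite_product.
Context (d1 d2 : measure_display) (T1 : measurableType d1) (T2 : measurableType d2) (R : realType).
Variable m1 : {sigma_finite_measure set T1 -> \bar R}.
Variable m2 : {sigma_finite_measure set T2 -> \bar R}.

(** The product measure under a name of its own, so that it can be given a
   sigma-finite structure and serve again as a factor of a product. *)
Definition sf_product : set (T1 * T2)%type -> \bar R := (m1 \x m2)%E.
HB.instance Definition _ := Measure.on sf_product.

Let sf_product_sigma_finite : sigma_finite setT sf_product.
Proof.
have /sigma_finiteP[F [TF ndF Foo]] := sigma_finiteT m1.
have /sigma_finiteP[G [TG ndG Goo]] := sigma_finiteT m2.
exists (fun n => F n `*` G n).
  rewrite -setXTT TF TG predeqE => -[x y]; split => [[[n _ Fx] [k _ Gy]]|[n _ [Fx Gy]]].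
    exists (maxn n k) => //; split.
    - by have /subsetPset := ndF _ _ (leq_maxl n k); exact.
    - by have /subsetPset := ndG _ _ (leq_maxr n k); exact.
  by split; exists n.
move=> k; have [mF Fk] := Foo k; have [mG Gk] := Goo k.
split; first exact: measurableX.
by rewrite /sf_product product_measure1E// lte_mul_pinfty// ge0_fin_numE.
Qed.
HB.instance Definition _ := Measure_isSigmaFinite.Build _ _ _ sf_product
  sf_product_sigma_finite.
End sigma_finite_product.

Section tensor.
Context {R : realType} (d1 d2 : measure_display) (T1 : measurableType d1) (T2 : measurableType d2).
Variables (mu1 : {sigma_finite_measure set T1 -> \bar R}).
Variables (mu2 : {sigma_finite_measure set T2 -> \bar R}).
Variables (g1 : T1 -> R) (g2 : T2 -> R) (f : T1 * T2 -> R).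
Hypothesis mg1 : measurable_fun setT g1.
Hypothesis mg2 : measurable_fun setT g2.
Hypothesis g10 : forall x, 0 <= g1 x.
Hypothesis g20 : forall x, 0 <= g2 x.
Hypothesis mf : measurable_fun setT f.

Local Open Scope ereal_scope.

Let G1 := \int[mu1]_a (g1 a)%:E.
Let G2 := \int[mu2]_x (g2 x)%:E.
Let q a x b y : R := ((f (a, x) - f (b, y)) ^+ 2)%R.
Let V1 x := \int[mu1]_a \int[mu1]_b (q a x b x * (g1 a * g1 b))%:E.
Let V2 a := \int[mu2]_x \int[mu2]_y (q a x a y * (g2 x * g2 y))%:E.

Let q0 a x b y : (0 <= q a x b y)%R. Proof. exact: sqr_ge0. Qed.

Let w1 (s : T1 * T1) : R := (g1 s.1 * g1 s.2)%R.
Let w2 (s : T2 * T2) : R := (g2 s.1 * g2 s.2)%R.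
Let w10 s : (0 <= w1 s)%R. Proof. exact: mulr_ge0. Qed.
Let w20 s : (0 <= w2 s)%R. Proof. exact: mulr_ge0. Qed.
Let mw1 : measurable_fun setT w1.
Proof.
exact: measurable_funM (measurableT_comp mg1 measurable_fst) (measurableT_comp mg1 measurable_snd).
Qed.
Let mw2 : measurable_fun setT w2.
Proof.
exact: measurable_funM (measurableT_comp mg2 measurable_fst) (measurableT_comp mg2 measurable_snd).
Qed.

Let mq (d : measure_display) (X : measurableType d) (a b : X -> T1) (x y : X -> T2) :
  measurable_fun setT a -> measurable_fun setT b ->
  measurable_fun setT x -> measurable_fun setT y ->
  measurable_fun setT (fun s => q (a s) (x s) (b s) (y s)).
Proof.
move=> ma mb mx my; apply: measurable_funX; apply: measurable_funB.
  exact: measurableT_comp mf (measurable_fun_pair ma mx).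
exact: measurableT_comp mf (measurable_fun_pair mb my).
Qed.

Local Ltac pos := repeat first
  [exact: q0 | exact: w10 | exact: w20 | exact: g10 | exact: g20 | apply: mulr_ge0].

Let S11 : {sigma_finite_measure set (T1 * T1)%type -> \bar R} := sf_product mu1 mu1.
Let S22 : {sigma_finite_measure set (T2 * T2)%type -> \bar R} := sf_product mu2 mu2.

Let split22 (phi : T2 * T2 -> R) : measurable_fun setT phi -> (forall p, 0 <= phi p)%R ->
  \int[S22]_t (phi t)%:E = \int[mu2]_x \int[mu2]_y (phi (x, y))%:E.
Proof.
move=> mphi phi0; rewrite /S22 (fubini_tonelli1 (fun t => (phi t)%:E)) => //.
exact/measurable_EFinP.
Qed.

Let split11 (phi : T1 * T1 -> \bar R) : measurable_fun setT phi -> (forall p, 0 <= phi p) ->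
  \int[S11]_s phi s = \int[mu1]_a \int[mu1]_b phi (a, b).
Proof. by move=> mphi phi0; rewrite /S11 (fubini_tonelli1 phi). Qed.

Let scale2 (d : measure_display) (X : measurableType d) (mu : {measure set X -> \bar R})
    (phi : X -> R) (c : R) : (0 <= c)%R -> measurable_fun setT phi -> (forall p, 0 <= phi p)%R ->
  \int[mu]_s (c * phi s)%:E = c%:E * \int[mu]_s (phi s)%:E.
Proof.
move=> c0 mphi phi0; rewrite -ge0_integralZl.
- by apply: eq_integral => s _; rewrite EFinM.
- exact: measurableT.
- exact/measurable_EFinP.
- by move=> s _; rewrite lee_fin.
- by rewrite lee_fin.
Qed.

Let G10 : 0 <= G1. Proof. by apply: integral_ge0 => a _; rewrite lee_fin. Qed.
Let G20 : 0 <= G2. Proof. by apply: integral_ge0 => a _; rewrite lee_fin. Qed.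

Let V2E a : V2 a = \int[S22]_t (q a t.1 a t.2 * w2 t)%:E.
Proof.
rewrite split22 => //.
  apply: measurable_funM => //.
  exact: mq (measurable_cst a) (measurable_cst a) measurable_fst measurable_snd.
by move=> t; pos.
Qed.

Let V20 a : 0 <= V2 a.
Proof. by apply: integral_ge0 => x _; apply: integral_ge0 => y _; rewrite lee_fin; pos. Qed.

Let V1E x : V1 x = \int[S11]_s (q s.1 x s.2 x * w1 s)%:E.
Proof.
rewrite (split11 (phi := fun s => (q s.1 x s.2 x * w1 s)%:E)) => //.
  apply/measurable_EFinP; apply: measurable_funM => //.
  exact: mq measurable_fst measurable_snd (measurable_cst x) (measurable_cst x).
by move=> t; rewrite lee_fin; pos.
Qed.

Lemma measurable_V2 : measurable_fun setT V2.
Proof.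
pose h (p : T1 * (T2 * T2)) : R := (q p.1 p.2.1 p.1 p.2.2 * w2 p.2)%R.
have mh : measurable_fun setT (fun p => (h p)%:E).
  apply/measurable_EFinP; apply: measurable_funM.
    have m1 := measurableT_comp (@measurable_fst _ _ T2 T2) (@measurable_snd _ _ T1 (T2 * T2)%type).
    have m2 := measurableT_comp (@measurable_snd _ _ T2 T2) (@measurable_snd _ _ T1 (T2 * T2)%type).
    exact: (mq measurable_fst measurable_fst m1 m2).
  exact: measurableT_comp mw2 measurable_snd.
have h0 p : 0 <= (h p)%:E by rewrite lee_fin; pos.
have mF := measurable_fun_fubini_tonelli_F (m2 := S22) _ mh h0.
have -> // : V2 = fubini_F S22 (fun p => (h p)%:E).
by apply/funext => a; rewrite V2E.
Qed.

Lemma measurable_V1 : measurable_fun setT V1.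
Proof.
pose h (p : T1 * T1 * T2) : R := (q p.1.1 p.2 p.1.2 p.2 * w1 p.1)%R.
have mh : measurable_fun setT (fun p => (h p)%:E).
  apply/measurable_EFinP; apply: measurable_funM.
    have m1 := measurableT_comp (@measurable_fst _ _ T1 T1) (@measurable_fst _ _ (T1 * T1)%type T2).
    have m2 := measurableT_comp (@measurable_snd _ _ T1 T1) (@measurable_fst _ _ (T1 * T1)%type T2).
    exact: (mq m1 m2 measurable_snd measurable_snd).
  exact: measurableT_comp mw1 measurable_fst.
have h0 p : 0 <= (h p)%:E by rewrite lee_fin; pos.
have mF := measurable_fun_fubini_tonelli_G (m1 := S11) _ mh h0.
have -> // : V1 = fubini_G S11 (fun p => (h p)%:E).
by apply/funext => a; rewrite V1E.
Qed.

Let termA : \int[S11]_s \int[S22]_t (q s.1 t.1 s.2 t.1 * (w1 s * w2 t))%:E =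
  G2 * \int[mu2]_x ((g2 x)%:E * V1 x).
Proof.
pose psi (p : T1 * T1 * T2) : R := (q p.1.1 p.2 p.1.2 p.2 * w1 p.1 * g2 p.2)%R.
have psi0 p : (0 <= psi p)%R by rewrite /psi; pos.
have mpsi : measurable_fun setT psi.
  apply: measurable_funM; last exact: measurableT_comp mg2 measurable_snd.
  apply: measurable_funM; last exact: measurableT_comp mw1 measurable_fst.
  apply: mq; [| |exact: measurable_snd|exact: measurable_snd].
    exact: measurableT_comp measurable_fst measurable_fst.
  exact: measurableT_comp measurable_snd measurable_fst.
have mpsi' : measurable_fun setT (fun p => (psi p)%:E) by exact/measurable_EFinP.
have psi0' p : 0 <= (psi p)%:E by rewrite lee_fin.
have mF := measurable_fun_fubini_tonelli_F (m2 := mu2) _ mpsi' psi0'.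
transitivity (\int[S11]_s (G2 * \int[mu2]_x (psi (s, x))%:E)).
  apply: eq_integral => s _; rewrite split22; last 2 first.
  - apply: measurable_funM.
      exact: mq (measurable_cst _) (measurable_cst _) measurable_fst measurable_fst.
    exact: measurable_funM.
  - by move=> p; pos.
  have mpsis : measurable_fun setT (fun x => psi (s, x)).
    exact: measurableT_comp mpsi (pair1_measurable s).
  rewrite -ge0_integralZl; [|exact: measurableT|exact/measurable_EFinP|by move=> x _; rewrite lee_fin|exact: G20].
  apply: eq_integral => x _.
  transitivity (\int[mu2]_y (psi (s, x) * g2 y)%:E).
    by apply: eq_integral => y _; rewrite /psi /w2 /=; congr EFin; ring.
  by rewrite scale2 // muleC.
rewrite ge0_integralZl; [|exact: measurableT|exact: mF|by move=> s _; apply: integral_ge0|exact: G20].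
congr (_ * _).
rewrite (fubini_tonelli (m1 := S11) (m2 := mu2) _ mpsi' psi0').
apply: eq_integral => x _; rewrite V1E -scale2 => //.
- by apply: eq_integral => s _; rewrite /psi mulrC.
- apply: measurable_funM => //.
  exact: mq measurable_fst measurable_snd (measurable_cst x) (measurable_cst x).
- by move=> p; pos.
Qed.

Let termB : \int[S11]_s \int[S22]_t (q s.1 t.1 s.1 t.2 * (w1 s * w2 t))%:E =
  G1 * \int[mu1]_a ((g1 a)%:E * V2 a).
Proof.
transitivity (\int[S11]_s ((w1 s)%:E * V2 s.1)).
  apply: eq_integral => s _; rewrite V2E -scale2 => //.
  - by apply: eq_integral => t _; congr EFin; ring.
  - apply: measurable_funM => //.
    exact: mq (measurable_cst _) (measurable_cst _) measurable_fst measurable_snd.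
  - by move=> p; pos.
have mw1' : measurable_fun setT (fun s => (w1 s)%:E) by exact/measurable_EFinP.
have mg1' : measurable_fun setT (fun s => (g1 s)%:E) by exact/measurable_EFinP.
rewrite (split11 (phi := fun s => (w1 s)%:E * V2 s.1)); last 2 first.
- exact: emeasurable_funM mw1' (measurableT_comp measurable_V2 measurable_fst).
- by move=> s; rewrite mule_ge0 ?lee_fin.
rewrite -ge0_integralZl; last 4 first.
- exact: measurableT.
- exact: emeasurable_funM mg1' measurable_V2.
- by move=> a _; rewrite mule_ge0 ?lee_fin.
- exact: G10.
apply: eq_integral => a _; rewrite muleC -ge0_integralZl; last 4 first.
- exact: measurableT.
- exact: mg1'.
- by move=> b _; rewrite lee_fin.
- by rewrite mule_ge0 ?lee_fin.
by apply: eq_integral => b _; rewrite /w1 /= EFinM muleAC.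
Qed.

Let termD : \int[mu1]_a \int[mu2]_x \int[mu1]_b \int[mu2]_y
    (q a x b y * (g1 a * g2 x * (g1 b * g2 y)))%:E =
  \int[S11]_s \int[S22]_t (q s.1 t.1 s.2 t.2 * (w1 s * w2 t))%:E.
Proof.
pose k (p : T1 * T1 * (T2 * T2)) : R := (q p.1.1 p.2.1 p.1.2 p.2.2 * (w1 p.1 * w2 p.2))%R.
have mk : measurable_fun setT (fun p => (k p)%:E).
  apply/measurable_EFinP; apply: measurable_funM.
    have m1 := measurableT_comp (@measurable_fst _ _ T1 T1) (@measurable_fst _ _ (T1 * T1)%type (T2 * T2)%type).
    have m2 := measurableT_comp (@measurable_snd _ _ T1 T1) (@measurable_fst _ _ (T1 * T1)%type (T2 * T2)%type).
    have m3 := measurableT_comp (@measurable_fst _ _ T2 T2) (@measurable_snd _ _ (T1 * T1)%type (T2 * T2)%type).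
    have m4 := measurableT_comp (@measurable_snd _ _ T2 T2) (@measurable_snd _ _ (T1 * T1)%type (T2 * T2)%type).
    exact: (mq m1 m2 m3 m4).
  apply: measurable_funM; first exact: measurableT_comp mw1 measurable_fst.
  exact: measurableT_comp mw2 measurable_snd.
have k0 p : 0 <= (k p)%:E by rewrite lee_fin; pos.
rewrite (split11 (phi := fun s => \int[S22]_t (q s.1 t.1 s.2 t.2 * (w1 s * w2 t))%:E)); last 2 first.
- exact: (measurable_fun_fubini_tonelli_F (m2 := S22) _ mk k0).
- by move=> s; apply: integral_ge0 => t _; exact: (k0 (s, t)).
apply: eq_integral => a _.
pose h (p : T2 * T1 * T2) := (q a p.1.1 p.1.2 p.2 * (g1 a * g2 p.1.1 * (g1 p.1.2 * g2 p.2)))%R.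
have m1 : measurable_fun setT (fun q : T2 * T1 * T2 => q.1.1).
  exact: measurableT_comp measurable_fst measurable_fst.
have m2 : measurable_fun setT (fun q : T2 * T1 * T2 => q.1.2).
  exact: measurableT_comp measurable_snd measurable_fst.
have mh : measurable_fun setT (EFin \o h).
  apply/measurable_EFinP; apply: measurable_funM.
    exact: mq (measurable_cst a) m2 m1 measurable_snd.
  apply: measurable_funM.
    exact: measurable_funM (measurable_cst _) (measurableT_comp mg2 m1).
  exact: measurable_funM (measurableT_comp mg1 m2) (measurableT_comp mg2 measurable_snd).
have h0 p : 0 <= (EFin \o h) p by rewrite /= lee_fin; pos.
have mF := measurable_fun_fubini_tonelli_F (m2 := mu2) _ mh h0.
have F0 p : 0 <= fubini_F mu2 (EFin \o h) p by apply: integral_ge0 => y _; exact: h0.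
rewrite [LHS](fubini_tonelli (m1 := mu2) (m2 := mu1) _ mF F0).
apply: eq_integral => b _; rewrite split22; last 2 first.
- apply: measurable_funM.
    exact: mq (measurable_cst _) (measurable_cst _) measurable_fst measurable_snd.
  exact: measurable_funM.
- by move=> p; pos.
apply: eq_integral => x _; apply: eq_integral => y _.
by rewrite /h /w1 /w2 /=; congr EFin; ring.
Qed.

(** The variance on a product space, written as a double integral of squared
   differences over two independent copies, is at most the sum of the mean
   variances in each factor (Efron-Stein for two factors). *)
Lemma tensor_variance :
  \int[mu1]_a \int[mu2]_x \int[mu1]_b \int[mu2]_y
    ((f (a, x) - f (b, y)) ^+ 2 * (g1 a * g2 x * (g1 b * g2 y)))%:E <=
  G2 * \int[mu2]_x ((g2 x)%:E * V1 x) + G1 * \int[mu1]_a ((g1 a)%:E * V2 a).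
Proof.
have swp (d : measure_display) (X : measurableType d) (mu : {sigma_finite_measure set X -> \bar R})
    (phi : X * X -> \bar R) : measurable_fun setT phi -> (forall s, 0 <= phi s) ->
    \int[mu \x mu]_s phi (s.2, s.1) = \int[mu \x mu]_s phi s.
  move=> mphi phi0; rewrite (fubini_tonelli2 phi)//.
  rewrite (fubini_tonelli1 (fun s => phi (s.2, s.1)))//.
  exact: measurableT_comp mphi (measurable_fun_pair measurable_snd measurable_fst).
rewrite [leLHS]termD -termA -termB.
apply: (@exchange_inequality R _ _ _ _ T1 T2 (T1 * T1)%type (T2 * T2)%type S11 S22
  fst snd fst snd (fun s => (s.2, s.1)) (fun s => (s.2, s.1)) f w1 w2 measurable_fst measurable_snd measurable_fst measurable_snd
  mf mw1 mw2 w10 w20).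
- by [].
- by [].
- by [].
- by move=> s; rewrite /w1 mulrC.
- by move=> s; rewrite /w2 mulrC.
- exact: swp.
- exact: swp.
Qed.
End tensor.

Section gauss_space.
Context {R : realType}.
Local Notation leb := (@lebesgue_measure R).
Local Notation g := (@gauss_fun R).

Lemma sqr_mul_ge0 (a b c : R) : 0 <= b -> 0 <= c -> 0 <= a ^+ 2 * (b * c).
Proof. by move=> b0 c0; apply: mulr_ge0; [exact: sqr_ge0|exact: mulr_ge0]. Qed.

Definition gsn m (z : Rn R m) : R := expR (- sqn z).

Lemma sqn_cons m a (z : Rn R m) : sqn (consR a z) = a ^+ 2 + sqn z.
Proof.
rewrite /sqn big_ord_recl tnth_consR0; congr (_ + _).
by apply: eq_bigr => i _; rewrite tnth_consRS.
Qed.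

Lemma gsn_cons m a (z : Rn R m) : gsn (consR a z) = g a * gsn z.
Proof. by rewrite /gsn sqn_cons opprD expRD. Qed.

Lemma gsn_ge0 m (z : Rn R m) : 0 <= gsn z. Proof. exact: expR_ge0. Qed.

Lemma measurable_sqn m : measurable_fun setT (@sqn R m).
Proof.
by apply: measurable_sum => i; apply: measurable_funX; exact: measurable_tnth.
Qed.

Lemma measurable_gsn m : measurable_fun setT (@gsn m).
Proof. by apply: measurableT_comp => //; apply: measurableT_comp => //; exact: measurable_sqn. Qed.

Definition gmass m : \bar R := (\int[lebesgueRn m]_z (gsn z)%:E)%E.

Lemma gmass_ge0 m : (0 <= gmass m)%E.
Proof. by apply: integral_ge0 => z _; rewrite lee_fin gsn_ge0. Qed.

Lemma gmassS m : (gmass m.+1 = \int[leb]_x (g x)%:E * gmass m)%E.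
Proof.
rewrite {1}/gmass integral_consRn; last 2 first.
- by apply/measurable_EFinP; exact: measurable_gsn.
- by move=> z; rewrite lee_fin gsn_ge0.
transitivity (\int[leb]_a ((g a)%:E * gmass m))%E.
  apply: eq_integral => a _; rewrite /gmass -ge0_integralZl//; last 3 first.
  - by apply/measurable_EFinP; exact: measurable_gsn.
  - by move=> z _; rewrite lee_fin gsn_ge0.
  - by rewrite lee_fin gauss_fun_ge0.
  by apply: eq_integral => z _; rewrite gsn_cons EFinM.
rewrite ge0_integralZr//; last 3 first.
- by apply/measurable_EFinP; exact: measurable_gauss_fun.
- by move=> z _; rewrite lee_fin gauss_fun_ge0.
- exact: gmass_ge0.
Qed.

Lemma gmassE m : gmass m = ((Num.sqrt pi) ^+ m)%:E.
Proof.
elim: m => [|m IH]; last by rewrite gmassS integralT_gauss IH -EFinM exprS.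
rewrite /gmass integral_dirac//=; last by apply/measurable_EFinP; exact: measurable_gsn.
by rewrite diracT mul1e /gsn /sqn big_ord0 oppr0 expR0 expr0.
Qed.

Lemma gmass_gt0 m : 0 < Num.sqrt pi ^+ m :> R.
Proof. by rewrite exprn_gt0// sqrtr_gt0 pi_gt0. Qed.

Definition shift m (z : Rn R m) (k : 'I_m) (s : R) : Rn R m :=
  [tuple tnth z i + s * (i == k)%:R | i < m].

Lemma shift0 m a (z : Rn R m) s : shift (consR a z) ord0 s = consR (a + s) z.
Proof.
apply: consR_ext => [|i]; first by rewrite tnth_mktuple eqxx mulr1 tnth_consR0.
by rewrite tnth_mktuple /= mulr0 addr0 tnth_consRS.
Qed.

Lemma shiftS m a (z : Rn R m) k s : shift (consR a z) (lift ord0 k) s = consR a (shift z k s).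
Proof.
apply: consR_ext => [|i]; first by rewrite tnth_mktuple /= mulr0 addr0 tnth_consR0.
by rewrite !tnth_mktuple tnth_consRS (inj_eq lift_inj).
Qed.

(** Differentiability is asked for along coordinate lines only: tensorization
   never looks in any other direction. *)
Definition C1partials m (f : Rn R m -> R) (df : 'I_m -> Rn R m -> R) :=
  [/\ measurable_fun setT f, forall k, measurable_fun setT (df k),
   forall k z (t : R), is_derive t 1 (fun s => f (shift z k s)) (df k (shift z k t)) &
   forall k z, continuous (fun t : R => df k (shift z k t))].

(** Induction on the dimension: tensor_variance separates the first coordinate,
   where poincare_line applies, from the others. The constant does not grow
   with m, which is essential since m tends to infinity. *)
Lemma poincare m (f : Rn R m -> R) df : C1partials f df ->
  (\int[lebesgueRn m]_x \int[lebesgueRn m]_y ((f x - f y) ^+ 2 * (gsn x * gsn y))%:E <=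
   2%:E * gmass m * \int[lebesgueRn m]_x ((\sum_(k < m) df k x ^+ 2) * gsn x)%:E)%E.
Proof.
elim: m f df => [|m IH] f df [mf mdf Df cdf].
  rewrite integral0_eq ?mule_ge0//.
  - exact: gmass_ge0.
  - by apply: integral_ge0 => x _; rewrite big_ord0 mul0r.
  by move=> x _; apply: integral0_eq => y _; rewrite tuple0 [y]tuple0 subrr expr0n mul0r.
have mc := @measurable_consRn R m.
have mg := @measurable_gauss_fun R.
have mG := @measurable_gsn.
have meas2 : measurable_fun setT (fun p : Rn R m.+1 * Rn R m.+1 =>
    ((f p.1 - f p.2) ^+ 2 * (gsn p.1 * gsn p.2))%:E).
  apply/measurable_EFinP; apply: measurable_funM.
    apply: measurable_funX; apply: measurable_funB.
      exact: measurableT_comp mf measurable_fst.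
    exact: measurableT_comp mf measurable_snd.
  apply: measurable_funM.
    exact: measurableT_comp (mG _) measurable_fst.
  exact: measurableT_comp (mG _) measurable_snd.
have ge2 (p : Rn R m.+1 * Rn R m.+1) :
    (0 <= ((f p.1 - f p.2) ^+ 2 * (gsn p.1 * gsn p.2))%:E)%E.
  by rewrite lee_fin sqr_mul_ge0 ?gsn_ge0.
rewrite integral_consRn; last 2 first.
- exact: (measurable_fun_fubini_tonelli_F (m2 := lebesgueRn m.+1) _ meas2 ge2).
- by move=> x; apply: integral_ge0 => y _; exact: (ge2 (x, y)).
have -> : (\int[leb]_a \int[lebesgueRn m]_z \int[lebesgueRn m.+1]_y
    ((f (consR a z) - f y) ^+ 2 * (gsn (consR a z) * gsn y))%:E =
  \int[leb]_a \int[lebesgueRn m]_x \int[leb]_b \int[lebesgueRn m]_y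
    (((f \o @consRn _ m) (a, x) - (f \o @consRn _ m) (b, y)) ^+ 2 * (g a * gsn x * (g b * gsn y)))%:E)%E.
  apply: eq_integral => a _; apply: eq_integral => x _.
  rewrite integral_consRn; last 2 first.
  - exact: measurableT_comp meas2 (pair1_measurable _).
  - by move=> y; exact: (ge2 (_, _)).
  by apply: eq_integral => b _; apply: eq_integral => y _; rewrite !gsn_cons.
apply: (le_trans (@tensor_variance R _ _ _ _ leb (lebesgueRn m) g (@gsn m) (f \o @consRn _ m) mg (mG m) (@gauss_fun_ge0 R) (@gsn_ge0 m) (measurableT_comp mf mc))).
pose S0 x := df ord0 x ^+ 2.
pose S1 x := \sum_(k < m) df (lift ord0 k) x ^+ 2.
have mS0 : measurable_fun setT S0 by exact: measurable_funX.
have mS1 : measurable_fun setT S1 by apply: measurable_sum => k; exact: measurable_funX.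
have S00 x : 0 <= S0 x by exact: sqr_ge0.
have S10 x : 0 <= S1 x by apply: sumr_ge0 => k _; exact: sqr_ge0.
have {IH}V2 a : (\int[lebesgueRn m]_x \int[lebesgueRn m]_y
   (((f \o @consRn _ m) (a, x) - (f \o @consRn _ m) (a, y)) ^+ 2 * (gsn x * gsn y))%:E <=
   2%:E * gmass m * \int[lebesgueRn m]_x (S1 (consR a x) * gsn x)%:E)%E.
  apply: (IH (fun x => f (consR a x)) (fun k x => df (lift ord0 k) (consR a x))).
  split.
  - exact: measurableT_comp mf (measurableT_comp mc (pair1_measurable a)).
  - by move=> k; exact: measurableT_comp (mdf _) (measurableT_comp mc (pair1_measurable a)).
  - move=> k z t; have := Df (lift ord0 k) (consR a z) t.
    by rewrite shiftS; under eq_fun do rewrite shiftS.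
  - move=> k z; have := cdf (lift ord0 k) (consR a z).
    by under eq_fun do rewrite shiftS.
have V1 x : (\int[leb]_a \int[leb]_b
   (((f \o @consRn _ m) (a, x) - (f \o @consRn _ m) (b, x)) ^+ 2 * (g a * g b))%:E <=
   2%:E * \int[leb]_a (g a)%:E * \int[leb]_a (S0 (consR a x) * g a)%:E)%E.
  apply: (@poincare_line R (fun a => f (consR a x)) (fun a => df ord0 (consR a x))).
  - move=> t; have := Df ord0 (consR 0 x) t.
    by rewrite shift0 add0r; under eq_fun do rewrite shift0 add0r.
  - have := cdf ord0 (consR 0 x).
    by under eq_fun do rewrite shift0 add0r.
rewrite -/(gmass m).
set G1 := (\int[leb]_a (g a)%:E)%E in V1 *.
have G10 : (0 <= G1)%E by apply: integral_ge0 => a _; rewrite lee_fin gauss_fun_ge0.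
have gm0 := gmass_ge0 m.
have mSg0 : measurable_fun setT (fun y : Rn R m.+1 => (S0 y * gsn y)%:E).
  by apply/measurable_EFinP; exact: measurable_funM mS0 (mG _).
have mSg1 : measurable_fun setT (fun y : Rn R m.+1 => (S1 y * gsn y)%:E).
  by apply/measurable_EFinP; exact: measurable_funM mS1 (mG _).
have p0 (y : Rn R m.+1) : (0 <= (S0 y * gsn y)%:E)%E.
  by rewrite lee_fin; apply: mulr_ge0 => //; exact: gsn_ge0.
have p1 (y : Rn R m.+1) : (0 <= (S1 y * gsn y)%:E)%E.
  by rewrite lee_fin; apply: mulr_ge0 => //; exact: gsn_ge0.
have mh0 := measurable_int_head mSg0 p0.
have mt1 := measurable_int_tail mSg1 p1.
have -> : (\int[lebesgueRn m.+1]_x ((\sum_(k < m.+1) df k x ^+ 2) * gsn x)%:E =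
   \int[lebesgueRn m.+1]_x (S0 x * gsn x)%:E + \int[lebesgueRn m.+1]_x (S1 x * gsn x)%:E)%E.
  rewrite -ge0_integralD//.
  by apply: eq_integral => x _; rewrite big_ord_recl mulrDl EFinD.
rewrite [leRHS]ge0_muleDr; last 2 first.
- by apply: integral_ge0 => x _; rewrite lee_fin; apply: mulr_ge0 => //; exact: gsn_ge0.
- by apply: integral_ge0 => x _; rewrite lee_fin; apply: mulr_ge0 => //; exact: gsn_ge0.
rewrite gmassS -/G1; apply: leeD.
- rewrite integral_consRn_swap//.
  rewrite (muleC G1) (muleA 2%:E) (muleC 2%:E) -2!muleA; apply: lee_wpmul2l => //.
  rewrite muleA -ge0_integralZl; [|exact: measurableT|exact: mh0|by move=> x _; apply: integral_ge0|by rewrite mule_ge0].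
  have mSx x : measurable_fun setT (fun a => (S0 (consR a x) * g a)%:E).
    apply/measurable_EFinP; apply: measurable_funM => //.
    exact: measurableT_comp mS0 (measurableT_comp mc (pair2_measurable x)).
  have EE x : (\int[leb]_a (S0 (consR a x) * gsn (consR a x))%:E =
     (gsn x)%:E * \int[leb]_a (S0 (consR a x) * g a)%:E)%E.
    rewrite -ge0_integralZl//; last 2 first.
    - by move=> a _; rewrite lee_fin; apply: mulr_ge0 => //; exact: gauss_fun_ge0.
    - by rewrite lee_fin gsn_ge0.
    by apply: eq_integral => a _; rewrite gsn_cons -EFinM; congr EFin; ring.
  apply: ge0_le_integral => //.
  - move=> x _; rewrite mule_ge0 ?lee_fin ?gsn_ge0//.
    by do 2!(apply: integral_ge0 => ? _); rewrite lee_fin sqr_mul_ge0 ?gauss_fun_ge0.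
  - apply: emeasurable_funM; first by apply/measurable_EFinP; exact: mG.
    exact: (@measurable_V1 R _ _ _ _ leb g (f \o @consRn _ m) mg (@gauss_fun_ge0 R) (measurableT_comp mf mc)).
  - exact: emeasurable_funM (measurable_cst _) mh0.
  - move=> x _; rewrite EE muleCA; apply: lee_wpmul2l; first by rewrite lee_fin gsn_ge0.
    exact: V1.
- rewrite integral_consRn//.
  rewrite (muleA 2%:E) (muleC 2%:E) -2!muleA; apply: lee_wpmul2l => //.
  rewrite muleA -ge0_integralZl; [|exact: measurableT|exact: mt1|by move=> x _; apply: integral_ge0|by rewrite mule_ge0].
  have EE a : (\int[lebesgueRn m]_x (S1 (consR a x) * gsn (consR a x))%:E =
     (g a)%:E * \int[lebesgueRn m]_x (S1 (consR a x) * gsn x)%:E)%E.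
    have mSa : measurable_fun setT (fun x => (S1 (consR a x) * gsn x)%:E).
      apply/measurable_EFinP; apply: measurable_funM (mG _).
      exact: measurableT_comp mS1 (measurableT_comp mc (pair1_measurable a)).
    rewrite -ge0_integralZl; [|exact: measurableT|exact: mSa| |by rewrite lee_fin gauss_fun_ge0].
      2: by move=> x _; rewrite lee_fin; apply: mulr_ge0 => //; exact: gsn_ge0.
    by apply: eq_integral => x _; rewrite gsn_cons -EFinM; congr EFin; ring.
  apply: ge0_le_integral => //.
  - move=> a _; rewrite mule_ge0 ?lee_fin ?gauss_fun_ge0//.
    by do 2!(apply: integral_ge0 => ? _); rewrite lee_fin sqr_mul_ge0 ?gsn_ge0.
  - apply: emeasurable_funM; first by apply/measurable_EFinP; exact: mg.
    exact: (@measurable_V2 R _ _ _ _ (lebesgueRn m) (@gsn m) (f \o @consRn _ m) (mG m) (@gsn_ge0 m) (measurableT_comp mf mc)).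
  - exact: emeasurable_funM (measurable_cst _) mt1.
  - move=> a _; rewrite EE muleCA; apply: lee_wpmul2l; first by rewrite lee_fin gauss_fun_ge0.
    exact: V2.
Qed.
End gauss_space.

(** * Integrals of nonnegative real functions *)

Section nnint.
Context {R : realType} (d : measure_display) (T : measurableType d).
Variable mu : {measure set T -> \bar R}.
Implicit Types F G : T -> R.

Definition nnint F :=
  [/\ measurable_fun setT F, (forall x, 0 <= F x) & (\int[mu]_x (F x)%:E < +oo)%E].

Definition rint F : R := fine (\int[mu]_x (F x)%:E)%E.

Lemma rintE F : nnint F -> (\int[mu]_x (F x)%:E)%E = (rint F)%:E.
Proof.
move=> [_ F0 Foo]; rewrite /rint fineK// ge0_fin_numE//.
by apply: integral_ge0 => x _; rewrite lee_fin.
Qed.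

Lemma rint_ge0 F : (forall x, 0 <= F x) -> 0 <= rint F.
Proof. by move=> F0; apply/fine_ge0/integral_ge0 => x _; rewrite lee_fin. Qed.

Lemma nnint_le F G : measurable_fun setT F -> (forall x, 0 <= F x) ->
  (forall x, F x <= G x) -> nnint G -> nnint F.
Proof.
move=> mF F0 FG [mG G0 Goo]; split => //.
apply: le_lt_trans Goo; apply: ge0_le_integral => //.
- by move=> x _; rewrite lee_fin.
- exact/measurable_EFinP.
- exact/measurable_EFinP.
- by move=> x _; rewrite lee_fin.
Qed.

Lemma rint_le F G : nnint F -> nnint G -> (forall x, F x <= G x) -> rint F <= rint G.
Proof.
move=> iF iG FG; rewrite -lee_fin -!rintE//.
case: iF iG => mF F0 _ [mG G0 _]; apply: ge0_le_integral => //.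
- by move=> x _; rewrite lee_fin.
- exact/measurable_EFinP.
- exact/measurable_EFinP.
- by move=> x _; rewrite lee_fin.
Qed.

Lemma integral_add F G : nnint F -> nnint G ->
  (\int[mu]_x (F x + G x)%:E = \int[mu]_x (F x)%:E + \int[mu]_x (G x)%:E)%E.
Proof.
move=> [mF F0 _] [mG G0 _]; rewrite -ge0_integralD//.
- by move=> x _; rewrite lee_fin.
- exact/measurable_EFinP.
- by move=> x _; rewrite lee_fin.
- exact/measurable_EFinP.
Qed.

Lemma nnint_add F G : nnint F -> nnint G -> nnint (fun x => F x + G x).
Proof.
move=> iF iG; have E := integral_add iF iG.
case: iF iG => mF F0 Foo [mG G0 Goo]; split.
- exact: measurable_funD.
- by move=> x; exact: addr_ge0.
- by rewrite E lte_add_pinfty.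
Qed.

Lemma rint_add F G : nnint F -> nnint G -> rint (fun x => F x + G x) = rint F + rint G.
Proof.
move=> iF iG; apply: EFin_inj; rewrite -rintE; last exact: nnint_add.
by rewrite integral_add// EFinD !rintE.
Qed.

Lemma integral_scale F c : 0 <= c -> measurable_fun setT F -> (forall x, 0 <= F x) ->
  (\int[mu]_x (c * F x)%:E = c%:E * \int[mu]_x (F x)%:E)%E.
Proof.
move=> c0 mF F0; rewrite -ge0_integralZl//.
- exact/measurable_EFinP.
- by move=> x _; rewrite lee_fin.
Qed.

Lemma nnint_scale F c : 0 <= c -> nnint F -> nnint (fun x => c * F x).
Proof.
move=> c0 [mF F0 Foo]; split.
- exact: measurable_funM.
- by move=> x; exact: mulr_ge0.
- by rewrite integral_scale// lte_mul_pinfty// lee_fin.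
Qed.

Lemma rint_scale F c : 0 <= c -> nnint F -> rint (fun x => c * F x) = c * rint F.
Proof.
move=> c0 iF; apply: EFin_inj; rewrite -rintE; last exact: nnint_scale.
by case: (iF) => ? ? ?; rewrite integral_scale// EFinM rintE.
Qed.

Lemma nnint_sum n (F : 'I_n -> T -> R) : (forall i, nnint (F i)) ->
  nnint (fun x => \sum_(i < n) F i x).
Proof.
elim: n F => [|n IH] F iF.
  split.
  - by under eq_fun do rewrite big_ord0; exact: measurable_cst.
  - by move=> x; rewrite big_ord0.
  - by rewrite integral0_eq// => x _; rewrite big_ord0.
have -> : (fun x => \sum_(i < n.+1) F i x) =
    (fun x => F ord0 x + \sum_(i < n) F (lift ord0 i) x).
  by apply/funext => x; rewrite big_ord_recl.
by apply: nnint_add => //; apply: IH.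
Qed.

Lemma rint_sum n (F : 'I_n -> T -> R) : (forall i, nnint (F i)) ->
  rint (fun x => \sum_(i < n) F i x) = \sum_(i < n) rint (F i).
Proof.
elim: n F => [|n IH] F iF.
  by rewrite big_ord0 /rint integral0_eq// => x _; rewrite big_ord0.
have -> : (fun x => \sum_(i < n.+1) F i x) =
    (fun x => F ord0 x + \sum_(i < n) F (lift ord0 i) x).
  by apply/funext => x; rewrite big_ord_recl.
by rewrite rint_add ?IH ?big_ord_recl//; exact: nnint_sum.
Qed.

Lemma nnint_restr F (A : set T) : measurable A -> nnint F -> nnint (fun x => F x * \1_A x).
Proof.
move=> mA iF; case: (iF) => mF F0 _; apply: nnint_le iF.
- exact: measurable_funM.
- by move=> x; rewrite mulr_ge0.
- by move=> x; rewrite ler_piMr// indicE; case: (_ \in _).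
Qed.

(** Replacing F by G changes both the numerator and the normalisation, each by
   at most the integral of |F - G|. *)
Lemma tv_density F G (A : set T) : measurable A -> nnint F -> nnint G ->
  nnint (fun x => `|F x - G x|) -> 0 < rint F -> 0 < rint G ->
  `|rint (fun x => F x * \1_A x) / rint F - rint (fun x => G x * \1_A x) / rint G| <=
  2 * rint (fun x => `|F x - G x|) / rint F.
Proof.
move=> mA iF iG iFG F0 G0.
set D := rint (fun x => `|F x - G x|).
have bnd (H K : T -> R) : nnint H -> nnint K ->
    (forall x, H x <= K x + `|F x - G x|) -> rint H <= rint K + D.
  move=> iH iK HK; rewrite -rint_add//; apply: rint_le => //.
  exact: nnint_add.
have iFA := nnint_restr mA iF; have iGA := nnint_restr mA iG.
have pw x : `|F x * \1_A x - G x * \1_A x| <= `|F x - G x|.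
  rewrite -mulrBl normrM ler_piMr// indicE; case: (_ \in _); by rewrite ?normr1 ?normr0.
have h1 : `|rint F - rint G| <= D.
  rewrite ler_distl; apply/andP; split; first rewrite lerBlDr; apply: bnd => // x;
  have := ler_norm (F x - G x); have := ler_norm (G x - F x); rewrite (distrC (G x)); lra.
have h2 : `|rint (fun x => F x * \1_A x) - rint (fun x => G x * \1_A x)| <= D.
  rewrite ler_distl; apply/andP; split; first rewrite lerBlDr; apply: bnd => // x;
  have := pw x; rewrite ler_norml => /andP[]; lra.
have h3 : rint (fun x => G x * \1_A x) <= rint G.
  apply: rint_le => // x; apply: ler_piMr; first by case: iG.
  by rewrite indicE; case: (_ \in _).
have h4 : 0 <= rint (fun x => G x * \1_A x) by apply: rint_ge0 => x; case: iGA.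
move: h1 h2 h3 h4.
move: (rint (fun x => F x * \1_A x)) (rint (fun x => G x * \1_A x)) => a b.
move: (rint F) (rint G) F0 G0 => f g f0 g0 h1 h2 h3 h4.
have -> : a / f - b / g = ((a - b) + b / g * (g - f)) / f.
  by field; rewrite ?gt_eqF.
rewrite normrM [`|f^-1|]gtr0_norm ?invr_gt0// ler_pM2r ?invr_gt0//.
have bg0 : 0 <= b / g by rewrite divr_ge0// ltW.
have bg1 : b / g <= 1 by rewrite ler_pdivrMr// mul1r.
have hb : `|b / g * (g - f)| <= D.
  rewrite normrM (ger0_norm bg0) distrC.
  by apply: le_trans h1; rewrite ler_piMl.
by apply: (le_trans (ler_normD _ _)); lra.
Qed.
End nnint.

Section product_nnint.
Context {R : realType} (d1 d2 : measure_display) (T1 : measurableType d1) (T2 : measurableType d2).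
Variable m1 : {sigma_finite_measure set T1 -> \bar R}.
Variable m2 : {sigma_finite_measure set T2 -> \bar R}.

Lemma integral_prod (u : T1 -> R) (v : T2 -> R) : nnint m1 u -> nnint m2 v ->
  (\int[m1 \x m2]_p (u p.1 * v p.2)%:E = (rint m1 u * rint m2 v)%:E)%E.
Proof.
move=> iu iv; case: (iu) (iv) => mu u0 _ [mv v0 _].
have muv : measurable_fun setT (fun p : T1 * T2 => (u p.1 * v p.2)%:E).
  apply/measurable_EFinP.
  exact: measurable_funM (measurableT_comp mu measurable_fst) (measurableT_comp mv measurable_snd).
rewrite (fubini_tonelli1 _ muv); last by move=> p; rewrite lee_fin; exact: mulr_ge0.
transitivity (\int[m1]_x (rint m2 v * u x)%:E)%E.
  apply: eq_integral => x _; rewrite /fubini_F /= integral_scale// rintE// -EFinM.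
  by rewrite mulrC.
by rewrite integral_scale ?rint_ge0// rintE// -EFinM mulrC.
Qed.

Lemma nnint_prod (u : T1 -> R) (v : T2 -> R) : nnint m1 u -> nnint m2 v ->
  nnint (m1 \x m2)%E (fun p => u p.1 * v p.2).
Proof.
move=> iu iv; split; last by rewrite integral_prod// ltry.
- case: iu iv => mu _ _ [mv _ _].
  exact: measurable_funM (measurableT_comp mu measurable_fst) (measurableT_comp mv measurable_snd).
- by case: iu iv => _ u0 _ [_ v0 _] p; exact: mulr_ge0.
Qed.

Lemma rint_prod (u : T1 -> R) (v : T2 -> R) : nnint m1 u -> nnint m2 v ->
  rint (m1 \x m2)%E (fun p => u p.1 * v p.2) = rint m1 u * rint m2 v.
Proof. by move=> iu iv; rewrite /rint integral_prod. Qed.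
End product_nnint.

(** * Gaussian tails *)

Section gauss_estimates.
Context {R : realType} (m : nat).
Local Notation mu := (@lebesgueRn R m).
Local Notation I := (rint mu).
Local Notation G := (@gsn R m).
Implicit Types (F : Rn R m -> R) (z : Rn R m).

Definition Gam : R := Num.sqrt pi ^+ m.

Lemma Gam_gt0 : 0 < Gam. Proof. exact: gmass_gt0. Qed.

Lemma nnint_gsn : nnint mu G.
Proof.
split; [exact: measurable_gsn|exact: gsn_ge0|].
by have := @gmassE R m; rewrite /gmass => ->; rewrite ltry.
Qed.

Lemma rint_gsn : I G = Gam.
Proof. by have := @gmassE R m; rewrite /rint /gmass => ->. Qed.

Lemma integral_jac (T : Rn R m -> Rn R m) c F : jac T c -> nnint mu F ->
  nnint mu (F \o T) /\ c * I (F \o T) = I F.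
Proof.
move=> [mT c0 HT] iF; case: (iF) => mF F0 Foo.
have mFT : measurable_fun setT (F \o T) by exact: measurableT_comp mF mT.
have E : ((I F)%:E = c%:E * \int[mu]_x (F (T x))%:E)%E.
  rewrite -rintE// (HT (EFin \o F))//; exact/measurable_EFinP.
have iFT : nnint mu (F \o T).
  split => //; first by move=> x; exact: F0.
  rewrite ltNge leye_eq; apply/negP => /eqP oo.
  by move: E; rewrite oo mulry gtr0_sg// mul1e.
split => //; apply: EFin_inj; rewrite E EFinM; congr (_ * _)%E.
by rewrite -rintE.
Qed.

Definition half z : Rn R m := [tuple 2^-1 * tnth z i + 0 | i < m].

Lemma sqn_half z : sqn (half z) = sqn z / 4.
Proof.
rewrite /sqn mulr_suml; apply: eq_bigr => i _; rewrite tnth_mktuple; by field.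
Qed.

Lemma rint_half F : nnint mu F -> nnint mu (F \o half) /\ I (F \o half) = 2 ^+ m * I F.
Proof.
move=> iF; have h0 : 0 < 2^-1 :> R by rewrite invr_gt0.
have [iH <-] := integral_jac (jac_affine (fun=> 0) h0) iF.
split => //; rewrite mulrA -exprMn divff ?expr1n ?mul1r//.
Qed.

(** Compare e^(-|z|^2) with its dilation e^(-|z/2|^2), whose integral is 2^m times
   larger: on B the quotient is at most e^(-3b/4). *)
Lemma gauss_norm_tail (B : set (Rn R m)) (b : R) : measurable B ->
  (forall z, B z -> b <= sqn z) ->
  I (fun z => G z * \1_B z) <= expR (- (3 / 4) * b) * 2 ^+ m * Gam.
Proof.
move=> mB hB; have [iH EH] := rint_half nnint_gsn.
rewrite -mulrA -rint_gsn -EH -(rint_scale (expR_ge0 _) iH).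
apply: rint_le.
- exact: nnint_restr nnint_gsn.
- by apply: nnint_scale => //; exact: expR_ge0.
move=> z; rewrite indicE; case: (boolP (z \in B)) => zB; last first.
  by rewrite mulr0 mulr_ge0 ?expR_ge0.
rewrite mulr1 /= /gsn -expRD ler_expR sqn_half.
by have := hB z (set_mem zB); lra.
Qed.

Lemma sqn_shift z (b : 'I_m -> R) :
  sqn [tuple 1 * tnth z i + b i | i < m] =
  sqn z + 2 * (\sum_(i < m) b i * tnth z i) + \sum_(i < m) b i ^+ 2.
Proof.
rewrite /sqn mulr_sumr -!big_split /=; apply: eq_bigr => i _.
by rewrite tnth_mktuple; ring.
Qed.

Lemma gauss_mgf (b : 'I_m -> R) :
  nnint mu (fun z => expR (\sum_(i < m) b i * tnth z i) * G z) /\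
  I (fun z => expR (\sum_(i < m) b i * tnth z i) * G z) =
    expR ((\sum_(i < m) b i ^+ 2) / 4) * Gam.
Proof.
have [iH EH] := integral_jac (jac_affine (fun i => - (b i / 2)) ltr01) nnint_gsn.
set S := \sum_(i < m) b i ^+ 2.
have -> : (fun z => expR (\sum_(i < m) b i * tnth z i) * G z) =
   (fun z => expR (S / 4) * (G \o (fun x : Rn R m => [tuple 1 * tnth x i + - (b i / 2)  | i < m])) z).
  apply/funext => z; rewrite /= /gsn -!expRD; congr expR; rewrite sqn_shift.
  have -> : \sum_(i < m) (- (b i / 2)) ^+ 2 = S / 4.
    by rewrite /S mulr_suml; apply: eq_bigr => i _; field.
  have -> : \sum_(i < m) (- (b i / 2)) * tnth z i = - (\sum_(i < m) b i * tnth z i) / 2.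
    by rewrite -sumrN mulr_suml; apply: eq_bigr => i _; field.
  by field.
split; first by apply: nnint_scale => //; exact: expR_ge0.
rewrite rint_scale ?expR_ge0//; congr (_ * _).
by rewrite -[Gam]rint_gsn -EH expr1n mul1r.
Qed.

Lemma one_le_exp_pair (l s x : R) : 0 <= l -> s <= `|x| ->
  1 <= expR (- l * s) * (expR (l * x) + expR (- l * x)).
Proof.
move=> l0 sx; rewrite mulrDr -!expRD.
have pos y : 0 <= expR y := expR_ge0 y.
case: (lerP 0 x) => x0.
  rewrite ger0_norm// in sx; apply: (@le_trans _ _ (expR (- l * s + l * x))).
    by rewrite -expR0 ler_expR mulNr addrC subr_ge0 ler_wpM2l.
  by rewrite lerDl.
rewrite ltr0_norm// in sx; apply: (@le_trans _ _ (expR (- l * s + - l * x))).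
  by rewrite -expR0 ler_expR -mulrDr mulNr oppr_ge0 mulr_ge0_le0// -lerBrDr sub0r.
by rewrite lerDr.
Qed.

(** Chernoff's bound with the sum of the two exponentials e^(+-l <c, z>), whose
   Gaussian integrals are explicit; l = 2 rho s is the optimal choice. *)
Lemma gauss_linear_tail (B : set (Rn R m)) (c : 'I_m -> R) (rho s : R) : measurable B ->
  0 < rho -> \sum_(i < m) c i ^+ 2 <= rho^-1 ->  0 <= s ->
  (forall z, B z -> s <= `|\sum_(i < m) c i * tnth z i|) ->
  I (fun z => G z * \1_B z) <= 2 * expR (- rho * s ^+ 2) * Gam.
Proof.
move=> mB rho0 c1 s0 hB; pose l := 2 * rho * s.
have l0 : 0 <= l by rewrite /l !mulr_ge0// ltW.
have [i1 E1] := gauss_mgf (fun i => l * c i).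
have [i2 E2] := gauss_mgf (fun i => - l * c i).
have S1 a : \sum_(i < m) (a * c i) ^+ 2 = a ^+ 2 * \sum_(i < m) c i ^+ 2.
  by rewrite mulr_sumr; apply: eq_bigr => i _; rewrite exprMn.
have S2 a z : \sum_(i < m) a * c i * tnth z i = a * \sum_(i < m) c i * tnth z i.
  by rewrite mulr_sumr; apply: eq_bigr => i _; rewrite mulrA.
have key : l ^+ 2 * (\sum_(i < m) c i ^+ 2) / 4 - l * s <= - rho * s ^+ 2.
  have : l ^+ 2 * (\sum_(i < m) c i ^+ 2) <= l ^+ 2 * rho^-1.
    by rewrite ler_wpM2l// sqr_ge0.
  have -> : l ^+ 2 * rho^-1 = 4 * rho * s ^+ 2 by rewrite /l; field; rewrite gt_eqF.
  move=> h; rewrite (_ : - rho * s ^+ 2 = 4 * rho * s ^+ 2 / 4 - l * s); last by rewrite /l; field.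
  by rewrite lerD2r ler_pM2r// invr_gt0.
have i12 := nnint_add i1 i2.
apply: (@le_trans _ _ (I (fun z => expR (- l * s) *
   (expR (\sum_(i < m) l * c i * tnth z i) * G z + expR (\sum_(i < m) - l * c i * tnth z i) * G z)))).
  apply: rint_le; [exact: nnint_restr nnint_gsn|by apply: nnint_scale => //; exact: expR_ge0|].
  move=> z; rewrite -mulrDl !S2 indicE mulrA; case: (boolP (z \in B)) => zB.
    by rewrite mulr1 ler_peMl ?gsn_ge0//; apply: one_le_exp_pair => //; exact: hB (set_mem zB).
  rewrite mulr0; apply: mulr_ge0; last exact: gsn_ge0.
  by apply: mulr_ge0; [exact: expR_ge0|apply: addr_ge0; exact: expR_ge0].
rewrite (rint_scale (expR_ge0 _) i12) (rint_add i1 i2) E1 E2 !S1 sqrrN.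
set e := expR (_ / 4); rewrite [leLHS](_ : _ = 2 * (expR (- l * s) * e) * Gam); last by ring.
apply: ler_wpM2r; first exact: ltW Gam_gt0.
by rewrite ler_wpM2l// /e -expRD ler_expR mulNr addrC.
Qed.
End gauss_estimates.

(** * Total variation from a small gradient *)

Section total_variation.
Context {R : realType} (m : nat).
Local Notation mu := (@lebesgueRn R m).
Local Notation I := (rint mu).
Local Notation G := (@gsn R m).
Local Notation Gam := (@Gam R m).
Implicit Types (F : Rn R m -> R) (z : Rn R m).

Lemma sqr_sub_le (a b k : R) : 0 < k ->
  `|a ^+ 2 - b ^+ 2| <= (2 * k)^-1 * (a - b) ^+ 2 + k * (a ^+ 2 + b ^+ 2).
Proof.
move=> k0.
have k2 : 0 < 2 * k by rewrite mulr_gt0.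
have E1 : (2 * k) * ((2 * k)^-1 * (a - b) ^+ 2 + k * (a ^+ 2 + b ^+ 2)) =
    (a - b) ^+ 2 + 2 * k ^+ 2 * (a ^+ 2 + b ^+ 2).
  by field; rewrite gt_eqF.
rewrite -(ler_pM2l k2) E1.
have h1 := sqr_ge0 (a - b - k * (a + b)).
have h2 := sqr_ge0 (a - b + k * (a + b)).
have h3 : 0 <= k ^+ 2 * (a - b) ^+ 2 by rewrite mulr_ge0 ?sqr_ge0.
rewrite -[X in X * `|_|]gtr0_norm// -normrM ler_norml; apply/andP; split.
- rewrite -subr_ge0 (_ : _ - _ = (a - b + k * (a + b)) ^+ 2 + k ^+ 2 * (a - b) ^+ 2); first exact: addr_ge0.
  by ring.
- rewrite -subr_ge0 (_ : _ - _ = (a - b - k * (a + b)) ^+ 2 + k ^+ 2 * (a - b) ^+ 2); first exact: addr_ge0.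
  by ring.
Qed.

(** Write the difference as a double integral of h(x)^2 - h(y)^2, and apply
   sqr_sub_le: the squared differences are bounded by the Poincare inequality,
   the other term contributes k times the total mass. *)
Lemma tv_poincare (h : Rn R m -> R) df (k : R) (A : set (Rn R m)) :
  measurable A -> C1partials h df ->
  nnint mu (fun z => h z ^+ 2 * G z) ->
  nnint mu (fun z => (\sum_(i < m) df i z ^+ 2) * G z) ->
  0 < k -> 0 < I (fun z => h z ^+ 2 * G z) ->
  I (fun z => (\sum_(i < m) df i z ^+ 2) * G z) <= k ^+ 2 * I (fun z => h z ^+ 2 * G z) ->
  `|I (fun z => h z ^+ 2 * G z * \1_A z) / I (fun z => h z ^+ 2 * G z) -
    I (fun z => G z * \1_A z) / Gam| <= 3 * k.
Proof.
move=> mA hh iF iS k0 F0 SF; pose F z := h z ^+ 2 * G z.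
rewrite -/F in iF F0 SF *.
have iG := @nnint_gsn R m.
have [mh _ _ _] := hh.
pose mu2 := (mu \x mu)%E.
pose K (p : Rn R m * Rn R m) : R := (h p.1 - h p.2) ^+ 2 * (G p.1 * G p.2).
have K0 p : 0 <= K p by apply: sqr_mul_ge0; exact: gsn_ge0.
have mK : measurable_fun setT K.
  apply: measurable_funM.
    apply: measurable_funX; apply: measurable_funB.
      exact: measurableT_comp mh measurable_fst.
    exact: measurableT_comp mh measurable_snd.
  apply: measurable_funM.
    exact: measurableT_comp (@measurable_gsn R m) measurable_fst.
  exact: measurableT_comp (@measurable_gsn R m) measurable_snd.
have KE : (\int[mu2]_p (K p)%:E <= (2 * Gam * I (fun z => (\sum_(i < m) df i z ^+ 2) * G z))%:E)%E.
  have mK' : measurable_fun setT (fun p => (K p)%:E) by exact/measurable_EFinP.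
  have K0' p : (0 <= (K p)%:E)%E by rewrite lee_fin.
  rewrite /mu2 (fubini_tonelli1 _ mK' K0').
  have := poincare hh; rewrite gmassE (rintE iS) -!EFinM.
  by [].
have iK : nnint mu2 K by split => //; apply: le_lt_trans KE _; exact: ltry.
have rK : rint mu2 K <= 2 * k ^+ 2 * Gam * I F.
  rewrite -lee_fin -rintE//; apply: (le_trans KE); rewrite lee_fin.
  rewrite (_ : 2 * k ^+ 2 * Gam * I F = 2 * Gam * (k ^+ 2 * I F)); last by ring.
  by rewrite ler_pM2l// mulr_gt0// Gam_gt0.
have iFA := nnint_restr mA iF; have iGA := nnint_restr mA iG.
have i1 := nnint_prod iF iG; have r1 := rint_prod iF iG.
have i2 := nnint_prod iG iF; have r2 := rint_prod iG iF.
have i1A := nnint_prod iFA iG; have r1A := rint_prod iFA iG.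
have i2A := nnint_prod iGA iF; have r2A := rint_prod iGA iF.
have i12 := nnint_add i1 i2; have r12 := rint_add i1 i2.
have k2 : 0 <= (2 * k)^-1 by rewrite invr_ge0 mulr_ge0// ltW.
have iE := nnint_add (nnint_scale k2 iK) (nnint_scale (ltW k0) i12).
have rE := rint_add (nnint_scale k2 iK) (nnint_scale (ltW k0) i12).
rewrite (rint_scale k2 iK) (rint_scale (ltW k0) i12) r12 r1 r2 rint_gsn in rE.
set E := rint mu2 _ in rE.
have pw p : `|F p.1 * \1_A p.1 * G p.2 - G p.1 * \1_A p.1 * F p.2| <=
    (2 * k)^-1 * K p + k * (F p.1 * G p.2 + G p.1 * F p.2).
  have -> : F p.1 * \1_A p.1 * G p.2 - G p.1 * \1_A p.1 * F p.2 =
     \1_A p.1 * ((h p.1 ^+ 2 - h p.2 ^+ 2) * (G p.1 * G p.2)) by rewrite /F; ring.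
  have -> : (2 * k)^-1 * K p + k * (F p.1 * G p.2 + G p.1 * F p.2) =
    ((2 * k)^-1 * (h p.1 - h p.2) ^+ 2 + k * (h p.1 ^+ 2 + h p.2 ^+ 2)) * (G p.1 * G p.2).
    by rewrite /F /K; ring.
  have GG : 0 <= G p.1 * G p.2 by apply: mulr_ge0; exact: gsn_ge0.
  apply: (@le_trans _ _ `|(h p.1 ^+ 2 - h p.2 ^+ 2) * (G p.1 * G p.2)|).
    rewrite normrM ler_piMl// indicE; case: (_ \in _); by rewrite ?normr1 ?normr0.
  rewrite normrM (ger0_norm GG); apply: ler_wpM2r => //.
  exact: sqr_sub_le.
have le12 : rint mu2 (fun p => F p.1 * \1_A p.1 * G p.2) <=
    rint mu2 (fun p => G p.1 * \1_A p.1 * F p.2) + E.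
  rewrite -(rint_add i2A iE); apply: rint_le => //; first exact: nnint_add.
  by move=> p; have := pw p; rewrite ler_norml => /andP[_]; rewrite lerBlDl.
have le21 : rint mu2 (fun p => G p.1 * \1_A p.1 * F p.2) <=
    rint mu2 (fun p => F p.1 * \1_A p.1 * G p.2) + E.
  rewrite -(rint_add i1A iE); apply: rint_le => //; first exact: nnint_add.
  by move=> p; have := pw p; rewrite distrC ler_norml => /andP[_]; rewrite lerBlDl.
have g0 := @Gam_gt0 R m.
rewrite r1A r2A rint_gsn in le12 le21.
have EE : E <= 3 * k * (I F * Gam).
  rewrite rE; apply: (@le_trans _ _ ((2 * k)^-1 * (2 * k ^+ 2 * Gam * I F) + k * (I F * Gam + Gam * I F))).
    by rewrite lerD2r ler_wpM2l.
  move: (I F) Gam => a b; rewrite le_eqVlt; apply/orP; left; apply/eqP; field.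
  by rewrite gt_eqF.
move: le12 le21 EE g0 F0; rewrite -/F.
move: (I (fun z => F z * \1_A z)) (I (fun z => G z * \1_A z)) (I F) Gam => a b f g.
move=> le12 le21 EE g0 f0.
have fg : 0 < f * g by exact: mulr_gt0.
rewrite -(ler_pM2r fg); apply: le_trans EE.
rewrite -[X in _ * X <= _](gtr0_norm fg) -normrM.
rewrite [X in `|X|](_ : _ = a * g - b * f); last by field; rewrite !gt_eqF.
by rewrite ler_distl lerBlDr le21 le12.
Qed.
End total_variation.

(** An abstract comparison of a density w on R^m with the Gaussian one. The
   linear forms p_r play the role of the gaps; E2 and E4 are the sums of their
   squares and fourth powers. The density is controlled by H3 in the bulk, by
   H4 where E2 is large, and h is an approximate square root of w relative to
   the Gaussian, accurate where E4 is small. *)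
Section tv_bound.
Context {R : realType} (n m : nat).
Local Notation mu := (@lebesgueRn R m).
Local Notation I := (rint mu).
Local Notation G := (@gsn R m).
Local Notation Gam := (@Gam R m).
Implicit Types (F : Rn R m -> R) (z : Rn R m).
Variable (M : 'I_n -> 'I_m -> R).
Definition lform (r : 'I_n) z := \sum_(k < m) M r k * tnth z k.
Local Notation p := lform.
Local Notation E2 z := (\sum_(r < n) p r z ^+ 2).
Local Notation E4 z := (\sum_(r < n) p r z ^+ 4).

Lemma lform_coef (rho : R) : (forall z, E2 z <= sqn z / rho) -> 0 < rho ->
  forall r, \sum_(k < m) M r k ^+ 2 <= rho^-1.
Proof.
move=> H1 rho0 r; set S := \sum_(k < m) _.
have S0 : 0 <= S by apply: sumr_ge0 => k _; exact: sqr_ge0.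
have := H1 [tuple M r k | k < m].
have -> : sqn [tuple M r k | k < m] = S by apply: eq_bigr => k _; rewrite tnth_mktuple.
rewrite (bigD1 r)//=.
have -> : p r [tuple M r k | k < m] = S.
  by apply: eq_bigr => k _; rewrite tnth_mktuple expr2.
have : 0 <= \sum_(i < n | i != r) p i [tuple M r k | k < m] ^+ 2.
  by apply: sumr_ge0 => k _; exact: sqr_ge0.
set T := \sum_(i < n | _) _ => T0 H.
have {}H : S * S <= S * rho^-1 by move: H; rewrite expr2; lra.
have [->|Sn0] := eqVneq S 0; first by rewrite invr_ge0 ltW.
by rewrite -(ler_pM2l (_ : 0 < S))// lt_neqAle eq_sym Sn0.
Qed.

Lemma measurable_lform r : measurable_fun setT (p r).
Proof. exact: measurable_linear_form. Qed.

Lemma expR_bound2 (k : nat) : 2 ^+ k <= expR k%:R :> R.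
Proof.
elim: k => [|k IH]; first by rewrite expr0 expR0.
rewrite exprS -[k.+1%:R]natr1 expRD mulrC; apply: ler_pM => //.
by have := @expR_ge1Dx R 1; lra.
Qed.

Variables (w h : Rn R m -> R) (df : 'I_m -> Rn R m -> R).
Variables (rho K C kap eta eps : R) (A : set (Rn R m)).
Local Notation sn := (Num.sqrt (n%:R : R)).
Hypotheses (n2 : (2 <= n)%N) (mn : (m <= n)%N).
Hypotheses (rho0 : 0 < rho) (K0 : 0 < K) (C0 : 0 <= C) (kap0 : 0 < kap)
  (eta0 : 0 <= eta) (eps0 : 0 < eps).
Hypothesis HK : 2 <= rho * K ^+ 2.
Hypothesis H1 : forall z, E2 z <= sqn z / rho.
Hypothesis iw : nnint mu w.
Hypothesis H3 : forall z, E2 z <= K ^+ 2 * n%:R ->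
  w z <= 2 * expR (C * sn) * G z /\ G z <= 2 * expR (C * sn) * w z.
Hypothesis H4 : forall z, K ^+ 2 * n%:R < E2 z -> w z <= 2 * expR (- 2 * n%:R) * w (half z).
Hypothesis H5 : C1partials h df.
Hypothesis H5k : forall z, (\sum_(i < m) df i z ^+ 2) * G z <= kap ^+ 2 * w z.
Hypothesis H6 : forall z, `|w z - h z ^+ 2 * G z| <= 2 * w z.
Hypothesis H7 : forall z, E4 z <= eps ^+ 2 * n%:R ^+ 2 ->
  `|w z - h z ^+ 2 * G z| <= eta * w z.
Hypothesis mA : measurable A.

Definition bad_mass : R := 2 * expR (- n%:R) +
  16 * n%:R * expR (2 * C * sn - rho * (eps ^+ 2 * n%:R / K ^+ 2)).

Let B1 : set (Rn R m) := [set z | K ^+ 2 * n%:R < E2 z].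
Let S r : set (Rn R m) := [set z | eps * sn / K <= `|p r z|].
Let B2 : set (Rn R m) := [set z | E2 z <= K ^+ 2 * n%:R /\ eps ^+ 2 * n%:R ^+ 2 < E4 z].

Let mE k : measurable_fun setT (fun z => \sum_(r < n) p r z ^+ k).
Proof. by apply: measurable_sum => r; apply: measurable_funX; exact: measurable_lform. Qed.

Let msetlt (u v : Rn R m -> R) : measurable_fun setT u -> measurable_fun setT v ->
  measurable [set z | u z < v z].
Proof.
move=> mu' mv; rewrite -[X in measurable X]setTI.
exact: (measurable_fun_ltr mu' mv measurableT (Y := [set true])).
Qed.

Let msetle (u v : Rn R m -> R) : measurable_fun setT u -> measurable_fun setT v ->
  measurable [set z | u z <= v z].
Proof.
move=> mu' mv; rewrite -[X in measurable X]setTI.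
exact: (measurable_fun_ler mu' mv measurableT (Y := [set true])).
Qed.

Let mB1 : measurable B1. Proof. exact: msetlt. Qed.
Let mS r : measurable (S r).
Proof.
by apply: msetle => //; apply: measurableT_comp => //; exact: measurable_lform.
Qed.
Let mB2 : measurable B2.
Proof. by apply: measurableI; [exact: msetle|exact: msetlt]. Qed.

Let nR2 : 2 <= n%:R :> R. Proof. by rewrite ler_nat. Qed.
Let sn2 : sn ^+ 2 = n%:R. Proof. by rewrite sqr_sqrtr. Qed.

Let powm : 2 ^+ m <= expR n%:R :> R.
Proof.
by apply: le_trans (expR_bound2 m) _; rewrite ler_expR ler_nat.
Qed.

(** The dilation by two multiplies Lebesgue measure by 2^m <= e^n, which the
   factor e^(-2n) in H4 absorbs. *)
Let mass_bad1 : I (fun z => w z * \1_B1 z) <= 2 * expR (- n%:R) * I w.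
Proof.
have [ih eh] := rint_half iw.
have c0 : 0 <= 2 * expR (- 2 * n%:R) :> R by rewrite mulr_ge0 ?expR_ge0.
apply: (@le_trans _ _ (I (fun z => 2 * expR (- 2 * n%:R) * (w \o half (m:=m)) z))).
  apply: rint_le; [exact: nnint_restr|exact: nnint_scale|].
  move=> z; rewrite indicE; case: (boolP (z \in B1)) => zB.
    by rewrite mulr1; apply: H4; exact: (set_mem zB).
  by rewrite mulr0; apply: mulr_ge0 => //; case: ih.
rewrite (rint_scale c0 ih) eh mulrA; apply: ler_wpM2r; first by apply: rint_ge0; case: iw.
rewrite -mulrA ler_pM2l//; apply: (@le_trans _ _ (expR (- 2 * n%:R) * expR n%:R)).
  by rewrite ler_wpM2l ?expR_ge0.
by rewrite -expRD ler_expR; lra.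
Qed.

(** H3 bounds the Gaussian by w only in the bulk, but the bulk carries at least
   half of the Gaussian mass. *)
Let gauss_mass : Gam <= 4 * expR (C * sn) * I w.
Proof.
have iG := @nnint_gsn R m; have g0 := @Gam_gt0 R m.
have tail : I (fun z => G z * \1_B1 z) <= 2^-1 * Gam.
  apply: le_trans (gauss_norm_tail (b := rho * K ^+ 2 * n%:R) mB1 _) _.
    move=> z zB; have := lt_le_trans zB (H1 z).
    by rewrite ltr_pdivlMr// => /ltW; rewrite mulrC mulrA.
  apply: ler_wpM2r; first exact: ltW.
  apply: (@le_trans _ _ (expR (- (3 / 4) * (2 * n%:R)) * expR n%:R)).
    apply: ler_pM => //.
    rewrite ler_expR !mulNr lerN2; apply: ler_wpM2l; first by rewrite divr_ge0.
    by apply: ler_wpM2r.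
  rewrite -expRD; apply: (@le_trans _ _ (expR (- 1))).
    by rewrite ler_expR; have := nR2; lra.
  rewrite expRN lef_pV2 ?posrE ?expR_gt0//.
  by have := @expR_ge1Dx R 1; lra.
have iB := nnint_restr mB1 iG.
have c0 : 0 <= 2 * expR (C * sn) by rewrite mulr_ge0 ?expR_ge0.
have iS := nnint_scale c0 iw.
have : Gam <= I (fun z => G z * \1_B1 z) + 2 * expR (C * sn) * I w.
  rewrite -[X in X <= _]rint_gsn -(rint_scale c0 iw) -(rint_add iB iS).
  apply: rint_le => //; first exact: nnint_add.
  move=> z; rewrite indicE; case: (boolP (z \in B1)) => zB.
    by rewrite mulr1 lerDl; case: iS.
  rewrite mulr0 add0r; apply: (H3 _).2; rewrite leNgt; apply/negP => h'.
  by move/negP: zB; apply; rewrite inE.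
lra.
Qed.

(** If E2 <= K^2 n and E4 > eps^2 n^2 then some |p_r| exceeds eps sqrt n / K; a
   union bound over the n forms leaves room for the factors e^(C sqrt n). *)
Let mass_bad2 : I (fun z => w z * \1_B2 z) <=
  16 * n%:R * expR (2 * C * sn - rho * (eps ^+ 2 * n%:R / K ^+ 2)) * I w.
Proof.
have iG := @nnint_gsn R m.
have s0 : 0 <= eps * sn / K by rewrite !mulr_ge0 ?invr_ge0 ?sqrtr_ge0 ?ltW.
have iGS r := nnint_restr (mS r) iG.
have iSum := nnint_sum iGS.
have c0 : 0 <= 2 * expR (C * sn) by rewrite mulr_ge0 ?expR_ge0.
apply: (@le_trans _ _ (I (fun z => 2 * expR (C * sn) * \sum_(r < n) (G z * \1_(S r) z)))).
  apply: rint_le; [exact: nnint_restr|exact: nnint_scale|].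
  move=> z; have sum0 : 0 <= \sum_(r < n) G z * \1_(S r) z by case: iSum.
  rewrite indicE; case: (boolP (z \in B2)) => zB; last by rewrite mulr0 mulr_ge0.
  have [zE zE4] := set_mem zB.
  rewrite mulr1; apply: (le_trans (H3 zE).1); apply: ler_wpM2l => //.
  have [r zr] : exists r, S r z.
    apply: contrapT => nex.
    have small r : p r z ^+ 2 <= eps ^+ 2 * n%:R / K ^+ 2.
      have : `|p r z| <= eps * sn / K.
        by rewrite leNgt; apply/negP => /ltW hr; apply: nex; exists r.
      move=> hr; rewrite -sn2 -[X in X <= _]real_normK ?num_real//.
      rewrite (_ : _ / _ = (eps * sn / K) ^+ 2); first by rewrite ler_sqr ?nnegrE.
      by rewrite !exprMn exprVn.
    have : E4 z <= eps ^+ 2 * n%:R / K ^+ 2 * E2 z.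
      rewrite mulr_sumr; apply: ler_sum => r _.
      rewrite -[4%N]/(2 + 2)%N exprD; apply: ler_wpM2r; [exact: sqr_ge0|exact: small].
    move=> /(lt_le_trans zE4); apply/negP; rewrite -leNgt.
    apply: (@le_trans _ _ (eps ^+ 2 * n%:R / K ^+ 2 * (K ^+ 2 * n%:R))).
      apply: ler_wpM2l zE; apply: divr_ge0; last exact: sqr_ge0.
      by apply: mulr_ge0 => //; exact: sqr_ge0.
    by rewrite le_eqVlt; apply/orP; left; apply/eqP; field; rewrite gt_eqF.
  rewrite (bigD1 r)//= indicE mem_set// mulr1 lerDl.
  by apply: sumr_ge0 => i _; apply: mulr_ge0; [exact: gsn_ge0|rewrite indicE].
rewrite (rint_scale c0 iSum) rint_sum//.
set e := expR (- rho * (eps * sn / K) ^+ 2).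
have : \sum_(i < n) I (fun z => G z * \1_(S i) z) <= n%:R * (2 * e * Gam).
  rewrite mulr_natl -[X in _ *+ X]card_ord -sumr_const; apply: ler_sum => r _.
  apply: (gauss_linear_tail (c := M r)) => //.
  exact: lform_coef.
move=> /(ler_wpM2l c0)/le_trans; apply.
apply: (@le_trans _ _ (2 * expR (C * sn) * (n%:R * (2 * e * (4 * expR (C * sn) * I w))))).
  apply: ler_wpM2l => //; apply: ler_wpM2l => //; apply: ler_wpM2l gauss_mass.
  by rewrite mulr_ge0 ?expR_ge0.
rewrite le_eqVlt; apply/orP; left; apply/eqP.
have -> : expR (2 * C * sn - rho * (eps ^+ 2 * n%:R / K ^+ 2)) = expR (C * sn) * expR (C * sn) * e.
  rewrite /e -!expRD; congr expR.
  have -> : (eps * sn / K) ^+ 2 = eps ^+ 2 * n%:R / K ^+ 2 by rewrite !exprMn exprVn sn2.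
  by ring.
by ring.
Qed.

(** First w is replaced by h^2 times the Gaussian, at the cost of eta and of
   the mass of the two bad regions, then tv_poincare applies to h. *)
Lemma tv_bound : eta + 2 * bad_mass <= 2^-1 ->
  `|I (fun z => w z * \1_A z) / I w - I (fun z => G z * \1_A z) / Gam| <=
  2 * (eta + 2 * bad_mass) + 6 * kap.
Proof.
move=> small; have w0 : 0 < I w.
  have := lt_le_trans (@Gam_gt0 R m) gauss_mass.
  by rewrite pmulr_rgt0// mulr_gt0// expR_gt0.
pose F z := h z ^+ 2 * G z.
have [mh mdf _ _] := H5.
have w_ge0 z : 0 <= w z by case: iw.
have F0 z : 0 <= F z by rewrite /F mulr_ge0 ?sqr_ge0 ?gsn_ge0.
have mF : measurable_fun setT F.
  by apply: measurable_funM; [exact: measurable_funX|exact: measurable_gsn].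
have iF : nnint mu F.
  apply: (@nnint_le _ _ _ _ _ (fun z => 3 * w z)) => //; last exact: nnint_scale.
  by move=> z; have := H6 z; rewrite -/(F z) ler_norml => /andP[]; lra.
have mw : measurable_fun setT w by case: iw.
have iD : nnint mu (fun z => `|w z - F z|).
  apply: (@nnint_le _ _ _ _ _ (fun z => 2 * w z)) => //; last exact: nnint_scale.
  by apply: measurableT_comp => //; exact: measurable_funB.
have D1 : I (fun z => `|w z - F z|) <= (eta + 2 * bad_mass) * I w.
  have i1 := nnint_scale eta0 iw.
  have i2 := nnint_scale (ler0n R 2) (nnint_restr mB1 iw).
  have i3 := nnint_scale (ler0n R 2) (nnint_restr mB2 iw).
  apply: (@le_trans _ _ (I (fun z => eta * w z + (2 * (w z * \1_B1 z) + 2 * (w z * \1_B2 z))))).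
    apply: rint_le => //; first by apply: nnint_add => //; exact: nnint_add.
    move=> z; have b1 : 0 <= 2 * (w z * \1_B1 z) by case: i2.
    have b2 : 0 <= 2 * (w z * \1_B2 z) by case: i3.
    have b0 : 0 <= eta * w z by case: i1.
    case: (lerP (E4 z) (eps ^+ 2 * n%:R ^+ 2)) => z4.
      by have := H7 z4; rewrite -/(F z); lra.
    have := H6 z; rewrite -/(F z) => h6.
    case: (lerP (E2 z) (K ^+ 2 * n%:R)) => z2.
      have : \1_B2 z = 1 :> R by rewrite indicE mem_set.
      by move: b1 b0 h6 => + + + ->; lra.
    have : \1_B1 z = 1 :> R by rewrite indicE mem_set.
    by move: b2 b0 h6 => + + + ->; lra.
  rewrite (rint_add i1 (nnint_add i2 i3)) (rint_add i2 i3) (rint_scale eta0 iw).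
  rewrite (rint_scale (ler0n R 2) (nnint_restr mB1 iw)) (rint_scale (ler0n R 2) (nnint_restr mB2 iw)).
  rewrite /bad_mass; have := mass_bad1; have := mass_bad2.
  set a1 := I (fun z => w z * \1_B1 z); set a2 := I (fun z => w z * \1_B2 z).
  set x1 := 2 * expR _; set x2 := 16 * _ * _ => h2 h1.
  by rewrite -subr_ge0 (_ : _ - _ = 2 * (x1 * I w - a1) + 2 * (x2 * I w - a2));
    [rewrite addr_ge0// mulr_ge0// subr_ge0|ring].
have FW : 2^-1 * I w <= I F.
  have : I w <= I (fun z => `|w z - F z|) + I F.
    rewrite -(rint_add iD iF); apply: rint_le => //; first exact: nnint_add.
    by move=> z; have := ler_norm (w z - F z); lra.
  have : I (fun z => `|w z - F z|) <= 2^-1 * I w.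
    by apply: le_trans D1 _; rewrite ler_pM2r.
  lra.
have IF0 : 0 < I F by apply: lt_le_trans FW; rewrite mulr_gt0.
have iS : nnint mu (fun z => (\sum_(i < m) df i z ^+ 2) * G z).
  apply: (@nnint_le _ _ _ _ _ (fun z => kap ^+ 2 * w z)) => //.
  - apply: measurable_funM; last exact: measurable_gsn.
    by apply: measurable_sum => i; exact: measurable_funX.
  - move=> z; apply: mulr_ge0; last exact: gsn_ge0.
    by apply: sumr_ge0 => i _; exact: sqr_ge0.
  - by apply: nnint_scale => //; exact: sqr_ge0.
have SF : I (fun z => (\sum_(i < m) df i z ^+ 2) * G z) <= (2 * kap) ^+ 2 * I F.
  apply: (@le_trans _ _ (kap ^+ 2 * I w)).
    rewrite -(rint_scale (sqr_ge0 _) iw); apply: rint_le => //.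
    by apply: nnint_scale => //; exact: sqr_ge0.
  have k20 : 0 <= kap ^+ 2 := sqr_ge0 _.
  have := ler_wpM2l k20 FW.
  have : 0 <= kap ^+ 2 * I F by rewrite mulr_ge0// ltW.
  rewrite exprMn; lra.
have T1 := tv_density mA iw iF iD w0 IF0.
have T2 := tv_poincare mA H5 iF iS (mulr_gt0 (ltr0n R 2) kap0) IF0 SF.
have D2 : 2 * I (fun z => `|w z - F z|) / I w <= 2 * (eta + 2 * bad_mass).
  by rewrite ler_pdivrMr// -mulrA ler_pM2l.
apply: le_trans (ler_distD (I (fun z => F z * \1_A z) / I F) _ _) _.
rewrite -/F in T2.
move: T1 T2 D2; lra.
Qed.
End tv_bound.

(** * Taylor expansion of 1/sin^2 *)

Section cosecant.
Context {R : realType}.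
Implicit Types (u a t d s C : R).

Lemma mvt_bound (f df : R -> R) a d C :
  (forall t, `|t| <= `|d| -> is_derive (a + t) 1 f (df (a + t))) ->
  (forall t, `|t| <= `|d| -> `|df (a + t)| <= C) ->
  `|f (a + d) - f a| <= C * `|d|.
Proof.
move=> Df Cf.
have small s : 0 <= s <= 1 -> `|s * d| <= `|d|.
  by move=> /andP[s0 s1]; rewrite normrM ger0_norm// ler_piMl.
pose g s := f (a + s * d).
have dg s : 0 <= s <= 1 -> is_derive s 1 g (df (a + s * d) * d).
  move=> s01.
  have dl : is_derive s 1 (fun s : R => a + s * d) d.
    apply: is_derive_eq.
    by rewrite /GRing.scale /=; ring.
  exact: (@is_derive1_comp _ f (fun s : R => a + s * d) s _ _ (Df _ (small _ s01)) dl).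
have [c c01 E] : exists2 c, c \in `]0, 1[ & g 1 - g 0 = df (a + c * d) * d * (1 - 0).
  apply: (@MVT R g (fun s => df (a + s * d) * d)) => //.
    by move=> s; rewrite in_itv /= => /andP[s0 s1]; apply: dg; rewrite !ltW.
  apply: continuous_in_subspaceT => s; rewrite inE /= in_itv /= => s01.
  by have := dg s s01 => ?; apply/differentiable_continuous/derivable1_diffP.
move: E; rewrite /g mul1r mul0r addr0 subr0 mulr1 => ->.
rewrite normrM ler_wpM2r//; apply: Cf; apply: small.
by move: c01; rewrite in_itv /= => /andP[c0 c1]; rewrite !ltW.
Qed.

Lemma sin_lipschitz a d : `|sin (a + d) - sin a| <= `|d|.
Proof.
rewrite -[leRHS]mul1r; apply: (@mvt_bound sin cos) => t _; last exact: cos_max.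
Qed.

Lemma sin_ge_half u : 0 <= u <= pi / 2 -> u / 2 <= sin u.
Proof.
move=> /andP[u0 u1].
have [->|un0] := eqVneq u 0; first by rewrite mul0r sin0.
have {un0} u_gt0 : 0 < u by rewrite lt_neqAle eq_sym un0.
have pi0 := @pi_gt0 R.
have h0 : 0 < u / 2 by rewrite divr_gt0.
have [c c01 E] : exists2 c, c \in `]0, u / 2[ & sin (u / 2) - sin 0 = cos c * (u / 2 - 0).
  apply: (@MVT R sin cos) => //.
  by apply: continuous_subspaceT => s; exact: continuous_sin.
move: c01 E; rewrite in_itv /= => /andP[c0 c1]; rewrite sin0 !subr0 => E.
have cc : cos (u / 2) <= cos c.
  by apply: ltW; rewrite ltr_cos// in_itv /=; apply/andP; split; lra.
have cpos : 0 <= cos (u / 2) by apply: cos_ge0_pihalf; apply/andP; split; lra.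
have sE : sin u = 2 * cos c * cos (u / 2) * (u / 2).
  rewrite {1}(_ : u = u / 2 *+ 2); last by rewrite -mulr_natr; field.
  by rewrite sin_mulr2n E -mulr_natr; ring.
have cu : 0 <= cos u by apply: cos_ge0_pihalf; apply/andP; split; lra.
have c2 : cos u = 2 * cos (u / 2) ^+ 2 - 1.
  rewrite {1}(_ : u = u / 2 *+ 2); last by rewrite -mulr_natr; field.
  by rewrite cos_mulr2n -mulr_natl.
rewrite sE; apply: ler_peMl; first exact: ltW.
have : cos (u / 2) * cos (u / 2) <= cos c * cos (u / 2) by apply: ler_wpM2r.
move: cu; rewrite c2 expr2 -mulrA.
by move: (cos (u / 2) * cos (u / 2)) (cos c * cos (u / 2)) => x y; lra.
Qed.

(** sin u >= u / 2 on [0, pi/2], applied to the distance from pi k / n to the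
   nearer end of [0, pi]. *)
Lemma sin_pi_frac (n k : nat) : (0 < k)%N -> (k < n)%N ->
  (minn k (n - k))%:R / n%:R <= sin (pi * k%:R / n%:R :> R).
Proof.
move=> k0 kn; have pi0 := @pi_gt0 R; have pi2 := @pi_ge2 R.
have n0 : 0 < n%:R :> R by rewrite ltr0n; apply: leq_trans kn.
wlog kn2 : k k0 kn / (2 * k <= n)%N.
  move=> W; case: (leqP (2 * k)%N n) => h; first exact: W.
  have -> : sin (pi * k%:R / n%:R) = sin (pi * (n - k)%:R / n%:R :> R).
    rewrite natrB; last exact: ltnW.
    rewrite (_ : pi * (n%:R - k%:R) / n%:R = - (pi * k%:R / n%:R) + pi :> R); last first.
      by field; rewrite gt_eqF.
    by rewrite sinDpi sinN opprK.
  have H := W (n - k)%N; rewrite subKn in H; last exact: ltnW.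
  by rewrite minnC in H; apply: H; lia.
have -> : minn k (n - k) = k by apply/minn_idPl; lia.
have k2 : 2 * k%:R <= n%:R :> R by rewrite -natrM ler_nat.
have kR : 0 <= k%:R / n%:R :> R by rewrite divr_ge0.
have k2' : k%:R / n%:R <= 2^-1 :> R by rewrite ler_pdivrMr//; lra.
apply: le_trans (sin_ge_half _).
  rewrite (_ : pi * k%:R / n%:R / 2 = pi / 2 * (k%:R / n%:R)); last by field; rewrite gt_eqF.
  by apply: ler_peMl => //; lra.
by rewrite -mulrA; apply/andP; split; [rewrite mulr_ge0// ltW|rewrite ler_pM2l].
Qed.

Definition csc2 u : R := (sin (u / 2) ^+ 2)^-1.
Definition dcsc2 u : R := - cos (u / 2) / sin (u / 2) ^+ 3.
Definition ddcsc2 u : R := (3 / 2 - sin (u / 2) ^+ 2) / sin (u / 2) ^+ 4.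
Definition dddcsc2 u : R :=
  - 2 * cos (u / 2) / sin (u / 2) ^+ 3 - 3 * cos (u / 2) ^+ 3 / sin (u / 2) ^+ 5.

Let is_derive_half u : is_derive u 1 (fun u => u / 2) (2^-1 : R).
Proof. by apply: is_derive_eq; rewrite /GRing.scale /=; ring. Qed.

Let is_derive_sinh u : is_derive u 1 (fun u => sin (u / 2)) (cos (u / 2) / 2).
Proof. exact: (is_derive1_comp (is_derive_sin _) (is_derive_half u)). Qed.

Let is_derive_cosh u : is_derive u 1 (fun u => cos (u / 2)) (- sin (u / 2) / 2).
Proof. exact: (is_derive1_comp (is_derive_cos _) (is_derive_half u)). Qed.

Let is_derive_sinXV k u : sin (u / 2) != 0 ->
  is_derive u 1 (fun u => (sin (u / 2) ^+ k.+1)^-1) (- k.+1%:R * (cos (u / 2) / 2) / sin (u / 2) ^+ k.+2).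
Proof.
move=> s0.
have D : is_derive u 1 (fun u => sin (u / 2) ^+ k.+1) (k.+1%:R * sin (u / 2) ^+ k * (cos (u / 2) / 2)).
  rewrite (_ : (fun u => sin (u / 2) ^+ k.+1) = (fun u => sin (u / 2)) ^+ k.+1); last first.
    by apply/funext => v; rewrite exprfctE.
  apply: (is_derive_eq (is_deriveX k.+1 (is_derive_sinh u))).
  by rewrite /GRing.scale /= mulr_natl.
apply: (is_derive_eq (is_deriveV _ D)); first by rewrite expf_neq0.
rewrite /GRing.scale /=.
have -> : sin (u / 2) ^+ k.+1 ^+ 2 = sin (u / 2) ^+ k * sin (u / 2) ^+ k.+2.
  by rewrite -exprM -exprD; congr (_ ^+ _); lia.
move: (cos _) (sin _) s0 => c s s0.
have h1 : s ^+ k != 0 by rewrite expf_neq0.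
have h2 : s ^+ k.+2 != 0 by rewrite expf_neq0.
by move: (s ^+ k) (s ^+ k.+2) h1 h2 => x y h1 h2; field; rewrite h1 h2.
Qed.

Lemma is_derive_csc2 u : sin (u / 2) != 0 -> is_derive u 1 csc2 (dcsc2 u).
Proof.
move=> s0; apply: (is_derive_eq (is_derive_sinXV 1 s0)).
by rewrite /dcsc2; field.
Qed.

Lemma is_derive_dcsc2 u : sin (u / 2) != 0 -> is_derive u 1 dcsc2 (ddcsc2 u).
Proof.
move=> s0; apply: (is_derive_eq (is_deriveM (is_deriveN (is_derive_cosh u)) (is_derive_sinXV 2 s0))).
rewrite /GRing.scale /= /ddcsc2.
have := cos2Dsin2 (u / 2); rewrite -[(- _) u]/(- cos (u / 2)).
move: (cos (u / 2)) (sin (u / 2)) s0 => c s s0 cs.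
have c2 : c ^+ 2 = 1 - s ^+ 2 by rewrite -cs; ring.
rewrite [LHS](_ : _ = ((3 / 2) * c ^+ 2 + s ^+ 2 / 2) / s ^+ 4); last by field.
by rewrite c2; congr (_ / _); field.
Qed.

Lemma is_derive_ddcsc2 u : sin (u / 2) != 0 -> is_derive u 1 ddcsc2 (dddcsc2 u).
Proof.
move=> s0.
have D := is_deriveB (is_deriveZ (3 / 2) (is_derive_sinXV 3 s0)) (is_derive_sinXV 1 s0).
have E : \forall v \near u, (((3 / 2) \*: (fun u => (sin (u / 2) ^+ 4)^-1)) - (fun u => (sin (u / 2) ^+ 2)^-1)) v = ddcsc2 v.
  have cs : {for u, continuous (fun u => sin (u / 2))}.
    by have := is_derive_sinh u => ?; apply/differentiable_continuous/derivable1_diffP.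
  have : \forall v \near u, sin (v / 2) != 0.
    exact: (cvgr_neq0 _ cs s0).
  apply: filterS => v v0; rewrite /ddcsc2.
  rewrite -[LHS]/((3 / 2) * (sin (v / 2) ^+ 4)^-1 - (sin (v / 2) ^+ 2)^-1).
  by field.
apply: (near_eq_is_derive E); apply: (is_derive_eq D).
rewrite /GRing.scale /= /dddcsc2.
have := cos2Dsin2 (u / 2); move: (cos (u / 2)) (sin (u / 2)) s0 => c s s0 cs.
rewrite (_ : 3 * c ^+ 3 = 3 * c * (1 - s ^+ 2)); first by field.
by rewrite -cs; ring.
Qed.

Lemma dddcsc2_bound u s : 0 < s -> s <= `|sin (u / 2)| -> `|dddcsc2 u| <= 5 / s ^+ 5.
Proof.
move=> s0 hs; have := cos_max (u / 2); have := sin_max (u / 2).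
rewrite /dddcsc2; move: (cos _) (sin _) hs => c x hs x1 c1.
have x0 : 0 < `|x| by exact: lt_le_trans hs.
have xn0 : x != 0 by rewrite -normr_gt0.
have -> : - 2 * c / x ^+ 3 - 3 * c ^+ 3 / x ^+ 5 = - (c * (2 * x ^+ 2 + 3 * c ^+ 2)) / x ^+ 5.
  by field.
rewrite normrM normrN normrM normfV normrX; apply: ler_pM => //.
- rewrite -[X in _ <= X]mul1r; apply: ler_pM => //.
  have sq1 (y : R) : `|y| <= 1 -> y ^+ 2 <= 1.
    rewrite ler_norml => /andP[y1 y2].
    rewrite -subr_ge0 (_ : 1 - y ^+ 2 = (1 - y) * (y - -1)); last by ring.
    by rewrite mulr_ge0// subr_ge0.
  have := sq1 _ x1; have := sq1 _ c1 => h1 h2.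
  have h3 : 0 <= 2 * x ^+ 2 + 3 * c ^+ 2 by rewrite addr_ge0// mulr_ge0// sqr_ge0.
  by rewrite ger0_norm//; lra.
- rewrite lef_pV2 ?posrE ?exprn_gt0//.
  by apply: lerXn2r => //; rewrite nnegrE ltW.
Qed.

Definition tay1 a d : R := dcsc2 (a + d) - dcsc2 a - ddcsc2 a * d.
Definition tay0 a d : R := csc2 (a + d) - csc2 a - dcsc2 a * d - ddcsc2 a / 2 * d ^+ 2.

Let sin_lb a d s t : 2 * s <= sin (a / 2) -> `|d| <= 2 * s -> `|t| <= `|d| ->
  s <= sin ((a + t) / 2).
Proof.
move=> ha hd ht; have := sin_lipschitz (a / 2) (t / 2).
rewrite -mulrDl normrM (ger0_norm (_ : 0 <= 2^-1)) ?invr_ge0// => h.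
have : sin (a / 2) - sin ((a + t) / 2) <= `|t| / 2.
  by apply: le_trans h; rewrite distrC ler_norm.
lra.
Qed.

Let is_derive_shift1 (f : R -> R) a t l : is_derive (a + t) 1 f l ->
  is_derive t 1 (fun t => f (a + t)) l.
Proof.
move=> H.
have D : is_derive t 1 (fun t : R => a + t) 1.
  by apply: (is_derive_eq (is_deriveD (is_derive_cst a t 1) (is_derive_id t 1))); rewrite add0r.
have := @is_derive1_comp _ f (fun t : R => a + t) t _ _ H D.
by rewrite mulr1.
Qed.

Section taylor.
Variables (a d s : R).
Hypotheses (s0 : 0 < s) (ha : 2 * s <= sin (a / 2)) (hd : `|d| <= 2 * s).

Let sne t : `|t| <= `|d| -> sin ((a + t) / 2) != 0.
Proof. by move=> td; rewrite gt_eqF// (lt_le_trans s0)//; exact: sin_lb td. Qed.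

Let dd_bound t : `|t| <= `|d| -> `|ddcsc2 (a + t) - ddcsc2 a| <= 5 / s ^+ 5 * `|t|.
Proof.
move=> td; apply: (mvt_bound (df := dddcsc2)) => r rt.
- by apply: is_derive_ddcsc2; apply: sne; exact: le_trans td.
- apply: dddcsc2_bound => //; apply: le_trans (ler_norm _).
  by apply: sin_lb hd _ => //; exact: le_trans td.
Qed.

Lemma is_derive_tay1 t : `|t| <= `|d| -> is_derive t 1 (tay1 a) (ddcsc2 (a + t) - ddcsc2 a).
Proof.
move=> td.
have D1 := is_derive_shift1 (is_derive_dcsc2 (sne td)).
have D2 : is_derive t 1 (fun t : R => ddcsc2 a * t) (ddcsc2 a).
  by apply: is_derive_eq; rewrite /GRing.scale /=; ring.
have D3 := is_deriveB (is_deriveB D1 (is_derive_cst (dcsc2 a) t 1)) D2.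
by apply: (is_derive_eq D3); rewrite subr0.
Qed.

Lemma is_derive_tay0 t : `|t| <= `|d| -> is_derive t 1 (tay0 a) (tay1 a t).
Proof.
move=> td.
have D1 := is_derive_shift1 (is_derive_csc2 (sne td)).
have D2 : is_derive t 1 (fun t : R => dcsc2 a * t) (dcsc2 a).
  by apply: is_derive_eq; rewrite /GRing.scale /=; ring.
have D4 : is_derive t 1 (fun t : R => ddcsc2 a / 2 * t ^+ 2) (ddcsc2 a * t).
  by apply: is_derive_eq; rewrite /GRing.scale /=; field.
have D3 := is_deriveB (is_deriveB (is_deriveB D1 (is_derive_cst (csc2 a) t 1)) D2) D4.
by apply: (is_derive_eq D3); rewrite subr0.
Qed.

Lemma tay1_bound t : `|t| <= `|d| -> `|tay1 a t| <= 5 / s ^+ 5 * t ^+ 2.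
Proof.
move=> td.
have t10 : tay1 a 0 = 0 by rewrite /tay1 addr0 mulr0; ring.
have := @mvt_bound (tay1 a) (fun t => ddcsc2 (a + t) - ddcsc2 a) 0 t (5 / s ^+ 5 * `|t|).
have E : `|t| * `|t| = t ^+ 2 by rewrite -expr2 real_normK ?num_real.
rewrite add0r t10 subr0 -[X in _ <= X]mulrA E; apply => r rt; rewrite add0r.
- by apply: is_derive_tay1; exact: le_trans td.
- apply: le_trans (dd_bound (le_trans rt td)) _.
  by apply: ler_wpM2l => //; rewrite divr_ge0// exprn_ge0// ltW.
Qed.

Lemma tay0_bound : `|tay0 a d| <= 5 / s ^+ 5 * `|d| ^+ 3.
Proof.
have t00 : tay0 a 0 = 0 by rewrite /tay0 addr0 !mulr0 expr0n mulr0; ring.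
have := @mvt_bound (tay0 a) (tay1 a) 0 d (5 / s ^+ 5 * `|d| ^+ 2).
rewrite add0r t00 subr0 -[X in _ <= X]mulrA -exprSr; apply => t td; rewrite add0r.
- exact: is_derive_tay0.
- apply: le_trans (tay1_bound td) _.
  apply: ler_wpM2l; first by rewrite divr_ge0// exprn_ge0// ltW.
  by rewrite -real_normK ?num_real// lerXn2r ?nnegrE.
Qed.

Lemma tay1_bound_d : `|tay1 a d| <= 5 / s ^+ 5 * d ^+ 2.
Proof. exact: tay1_bound. Qed.
End taylor.

(** The sine is log-concave on [0, pi], and the mean of the inverse squares
   dominates the product of the inverses. *)
Lemma csc2_midpoint a d : 0 < a < 2 * pi -> 0 < a + d < 2 * pi ->
  2 * csc2 (a + d / 2) <= csc2 (a + d) + csc2 a.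
Proof.
move=> /andP[a0 a1] /andP[b0 b1]; rewrite /csc2.
set p := (a + d) / 2; set q := a / 2.
have -> : (a + d / 2) / 2 = (p + q) / 2 by rewrite /p /q; field.
have p0 : 0 < sin p by apply: sin_gt0_pi; rewrite /p; apply/andP; split; lra.
have q0 : 0 < sin q by apply: sin_gt0_pi; rewrite /q; apply/andP; split; lra.
have m0 : 0 < sin ((p + q) / 2) by apply: sin_gt0_pi; rewrite /p /q; apply/andP; split; lra.
have key : sin p * sin q <= sin ((p + q) / 2) ^+ 2.
  have pE : sin p = sin ((p + q) / 2) * cos ((p - q) / 2) + cos ((p + q) / 2) * sin ((p - q) / 2).
    by rewrite -sinD; congr sin; field.
  have qE : sin q = sin ((p + q) / 2) * cos ((p - q) / 2) - cos ((p + q) / 2) * sin ((p - q) / 2).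
    by rewrite -sinB; congr sin; field.
  rewrite pE qE -subr_ge0.
  have := cos2Dsin2 ((p + q) / 2); have := cos2Dsin2 ((p - q) / 2).
  move: (sin ((p + q) / 2)) (cos ((p + q) / 2)) (sin ((p - q) / 2)) (cos ((p - q) / 2)) => x y z w h1 h2.
  rewrite (_ : _ - _ = z ^+ 2 * (x ^+ 2 + y ^+ 2) + x ^+ 2 * (1 - (w ^+ 2 + z ^+ 2))); last by ring.
  by rewrite h1 subrr mulr0 addr0 mulr_ge0 ?sqr_ge0// addr_ge0 ?sqr_ge0.
have h : (sin ((p + q) / 2) ^+ 2)^-1 <= (sin p)^-1 * (sin q)^-1.
  by rewrite -invfM lef_pV2 ?posrE ?exprn_gt0// mulr_gt0.
rewrite -!exprVn in h *.
have := sqr_ge0 ((sin p)^-1 - (sin q)^-1).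
move: h; move: (sin ((p + q) / 2))^-1 (sin p)^-1 (sin q)^-1 => x y z; rewrite sqrrB -mulr_natl; lra.
Qed.
End cosecant.

(** * Arcs of a loop of gaps *)

Section loops.
Context {R : realType} (n : nat).
Implicit Types (q v : nat -> R) (F : nat -> R).

Definition periodic_seq F := forall i, F (i + n)%N = F i.
(** Gaps around the circle, indexed by all naturals with period n, so that an
   arc of k consecutive gaps never needs an index reduction. *)
Definition loop q := periodic_seq q /\ \sum_(0 <= i < n) q i = 0.
Definition arc q i k := \sum_(0 <= j < k) q (i + j)%N.
Definition short k := minn k (n - k).

Lemma window_sum F i : periodic_seq F -> \sum_(0 <= j < n) F (i + j)%N = \sum_(0 <= j < n) F j.
Proof.
move=> pF; elim: i => [|i IH]; first by apply: eq_bigr.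
have E1 : \sum_(0 <= j < n.+1) F (i + j)%N = \sum_(0 <= j < n) F (i + j)%N + F (i + n)%N.
  by rewrite big_nat_recr.
have E2 : \sum_(0 <= j < n.+1) F (i + j)%N = F i + \sum_(0 <= j < n) F (i.+1 + j)%N.
  by rewrite big_nat_recl//= addn0; congr (_ + _); apply: eq_bigr => j _; rewrite addSnnS.
by move: E1; rewrite E2 IH pF addrC => /addIr.
Qed.

Lemma arcD q i k l : arc q i (k + l) = arc q i k + arc q (i + k) l.
Proof.
rewrite /arc (@big_cat_nat _ _ _ k) ?leq_addr//=; congr (_ + _).
rewrite -{1}[k]add0n big_addn addKn; apply: eq_bigr => j _.
by congr q; lia.
Qed.

Lemma arcE q i k : arc q i k = arc q 0 (i + k) - arc q 0 i.
Proof. by rewrite arcD add0n addrAC subrr add0r. Qed.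

Lemma arc_periodic q k : periodic_seq q -> periodic_seq (arc q ^~ k).
Proof. by move=> pq i; apply: eq_bigr => j _; rewrite addnAC pq. Qed.

Lemma arc_full q i : loop q -> arc q i n = 0.
Proof. by move=> [pq q0]; rewrite /arc window_sum. Qed.

(** An arc and its complement have opposite sums, so k may always be replaced
   by the shorter of k and n - k. *)
Lemma arc_compl q i k : loop q -> (k <= n)%N -> arc q (i + k) (n - k) = - arc q i k.
Proof.
move=> lq kn; apply/eqP; rewrite -addr_eq0 addrC -arcD subnKC//; apply/eqP.
exact: arc_full.
Qed.

Lemma sum_arc q k : loop q -> \sum_(0 <= i < n) arc q i k = 0.
Proof.
move=> [pq q0]; rewrite /arc exchange_big /= big1_seq// => j _.
by under eq_bigr do rewrite addnC; rewrite window_sum.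
Qed.

Lemma arc0 i k : arc (fun=> 0) i k = 0.
Proof. by rewrite /arc big1. Qed.

Lemma sqr_sum_le (a : nat -> R) k :
  (\sum_(0 <= j < k) a j) ^+ 2 <= k%:R * \sum_(0 <= j < k) a j ^+ 2.
Proof.
have [->|k0] := posnP k; first by rewrite !big_geq// mul0r expr0n.
set S := \sum_(0 <= j < k) a j; set T := \sum_(0 <= j < k) a j ^+ 2.
have E : \sum_(0 <= j < k) (k%:R * a j - S) ^+ 2 = k%:R * (k%:R * T - S ^+ 2).
  transitivity (\sum_(0 <= j < k) (k%:R ^+ 2 * a j ^+ 2 - 2 * k%:R * S * a j + S ^+ 2)).
    by apply: eq_bigr => j _; ring.
  rewrite big_split sumrB /= -!mulr_sumr sumr_const_nat subn0 -/S -/T -mulr_natl; ring.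
have : 0 <= k%:R * (k%:R * T - S ^+ 2).
  by rewrite -E; apply: sumr_ge0 => j _; exact: sqr_ge0.
by rewrite pmulr_rge0 ?ltr0n// subr_ge0.
Qed.

Definition energy (e : nat) q := \sum_(0 <= i < n) q i ^+ e.

Lemma sum_shifted (e : nat) q k : periodic_seq q ->
  \sum_(0 <= i < n) \sum_(0 <= j < k) q (i + j)%N ^+ e = k%:R * energy e q.
Proof.
move=> pq; rewrite exchange_big /=.
transitivity (\sum_(0 <= j < k) energy e q); last first.
  by rewrite sumr_const_nat subn0 mulr_natl.
apply: eq_bigr => j _; under eq_bigr do rewrite addnC.
by rewrite (@window_sum (fun i => q i ^+ e))// => i; rewrite pq.
Qed.

Lemma sum_arc2 q k : periodic_seq q ->
  \sum_(0 <= i < n) arc q i k ^+ 2 <= k%:R ^+ 2 * energy 2 q.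
Proof.
move=> pq; rewrite expr2 -mulrA -sum_shifted// mulr_sumr.
by apply: ler_sum => i _; exact: sqr_sum_le.
Qed.

Lemma sum_arc4 q k : periodic_seq q ->
  \sum_(0 <= i < n) arc q i k ^+ 4 <= k%:R ^+ 4 * energy 4 q.
Proof.
move=> pq; rewrite exprSr -mulrA -sum_shifted// mulr_sumr.
apply: ler_sum => i _.
have h1 := sqr_sum_le (fun j => q (i + j)%N) k.
have h2 := sqr_sum_le (fun j => q (i + j)%N ^+ 2) k.
rewrite -/(arc q i k) in h1.
have S0 : 0 <= \sum_(0 <= j < k) q (i + j)%N ^+ 2.
  by apply: sumr_ge0 => j _; exact: sqr_ge0.
rewrite -[4%N]/(2 * 2)%N exprM.
apply: (@le_trans _ _ ((k%:R * \sum_(0 <= j < k) q (i + j)%N ^+ 2) ^+ 2)).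
  by rewrite ler_sqr ?nnegrE ?sqr_ge0// mulr_ge0.
rewrite exprMn [k%:R ^+ 3]exprSr -mulrA ler_wpM2l ?sqr_ge0//.
by apply: le_trans h2 _; under eq_bigr do rewrite -exprM.
Qed.

Lemma sum_arc_sym (F : R -> R) q k : loop q -> (k <= n)%N -> (forall x, F (- x) = F x) ->
  \sum_(0 <= i < n) F (arc q i (n - k)) = \sum_(0 <= i < n) F (arc q i k).
Proof.
move=> lq kn evF; case: (lq) => pq _.
rewrite -(@window_sum (fun i => F (arc q i (n - k))) k); last by move=> i; rewrite arc_periodic.
by apply: eq_bigr => i _; rewrite addnC arc_compl.
Qed.

Lemma sum_short2 q k : loop q -> (k <= n)%N ->
  \sum_(0 <= i < n) arc q i k ^+ 2 <= (short k)%:R ^+ 2 * energy 2 q.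
Proof.
move=> lq kn; case: (lq) => pq _; rewrite /short /minn; case: ifP => _; first exact: sum_arc2.
rewrite -(sum_arc_sym (F := fun x => x ^+ 2) lq kn); last by move=> x; rewrite sqrrN.
exact: sum_arc2.
Qed.

Lemma sum_short4 q k : loop q -> (k <= n)%N ->
  \sum_(0 <= i < n) arc q i k ^+ 4 <= (short k)%:R ^+ 4 * energy 4 q.
Proof.
move=> lq kn; case: (lq) => pq _; rewrite /short /minn; case: ifP => _; first exact: sum_arc4.
rewrite -(sum_arc_sym (F := fun x => x ^+ 4) lq kn); last by move=> x; ring.
exact: sum_arc4.
Qed.

Lemma arc_le q i k B : (forall i, `|q i| <= B) -> `|arc q i k| <= k%:R * B.
Proof.
move=> qB; apply: le_trans (ler_norm_sum _ _ _) _.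
apply: (@le_trans _ _ (\sum_(0 <= j < k) B)); first by apply: ler_sum.
by rewrite sumr_const_nat subn0 mulr_natl.
Qed.

Lemma arc_short_le q i k B : loop q -> (k <= n)%N -> (forall i, `|q i| <= B) ->
  `|arc q i k| <= (short k)%:R * B.
Proof.
move=> lq kn qB; rewrite /short /minn; case: ifP => _; first exact: arc_le.
by rewrite -normrN -arc_compl//; exact: arc_le.
Qed.

Lemma sum_inv_sqr k : \sum_(1 <= j < k.+2) (j%:R : R) ^- 2 <= 2 - k.+1%:R^-1.
Proof.
elim: k => [|k IH]; first by rewrite big_nat1 expr1n invr1; lra.
rewrite big_nat_recr//=; apply: (@le_trans _ _ (2 - k.+1%:R^-1 + k.+2%:R ^- 2)).
  by rewrite lerD2r.
have a0 : 0 < k.+1%:R :> R by rewrite ltr0n.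
have -> : k.+2%:R = k.+1%:R + 1 :> R by rewrite -natr1.
move: (k.+1%:R : R) a0 => a a0.
have b0 : 0 < a + 1 by rewrite addr_gt0.
rewrite -subr_ge0 (_ : _ - _ = a^-1 * (a + 1) ^- 2).
  by rewrite mulr_ge0// invr_ge0 ?exprn_ge0 ?ltW.
by field; rewrite !gt_eqF.
Qed.

End loops.

(** The constant 4 is twice the bound 2 for the sum of the inverse squares; it is
   what makes all sums over pairs converge uniformly in n. *)
Lemma sum_inv_short (R : realType) n : (0 < n)%N ->
  \sum_(1 <= k < n) ((short n k)%:R : R) ^- 2 <= 4.
Proof.
case: n => [//|[|m]] _; first by rewrite big_geq.
have H : \sum_(1 <= k < m.+2) (k%:R : R) ^- 2 <= 2.
  by apply: le_trans (sum_inv_sqr m) _; rewrite gerBl invr_ge0.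
have E : \sum_(1 <= k < m.+2) ((m.+2 - k)%:R : R) ^- 2 = \sum_(1 <= k < m.+2) (k%:R : R) ^- 2.
  rewrite [RHS]big_nat_rev; apply: eq_big_nat => k /andP[k1 k2].
  by congr (_%:R ^- _); lia.
apply: (@le_trans _ _ (\sum_(1 <= k < m.+2) ((k%:R : R) ^- 2 + ((m.+2 - k)%:R : R) ^- 2))).
  apply: ler_sum => k _; have h (x : nat) : 0 <= (x%:R : R) ^- 2 by rewrite invr_ge0 exprn_ge0.
  rewrite /short /minn; case: ifP => _; [by rewrite lerDl|by rewrite lerDr].
rewrite big_split /= E; lra.
Qed.

(** * The interaction energy of a loop of gaps *)

Lemma ler_sum_nat_cond (R : realType) (a b : nat) (F G : nat -> R) :
  (forall k, (a <= k)%N -> (k < b)%N -> F k <= G k) ->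
  \sum_(a <= k < b) F k <= \sum_(a <= k < b) G k.
Proof.
by move=> h; rewrite big_nat [leRHS]big_nat; apply: ler_sum => k /andP[]; exact: h.
Qed.

Lemma is_derive_sum_nat (R : realType) (a b : nat) (F : nat -> R -> R) dF (t : R) :
  (forall k, (a <= k)%N -> (k < b)%N -> is_derive t 1 (F k) (dF k)) ->
  is_derive t 1 (fun s : R => \sum_(a <= k < b) F k s) (\sum_(a <= k < b) dF k).
Proof.
move=> h; have [ba|ab] := leqP b a.
  rewrite big_geq// (_ : (fun s => _) = cst 0); first exact: is_derive_cst.
  by apply/funext => s; rewrite big_geq.
elim: b ab h => [//|b IH] ab h.
have [ba|ab'] := leqP b a.
  have -> : b = a by lia.
  rewrite big_nat1 (_ : (fun s => _) = F a); last by apply/funext => s; rewrite big_nat1.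
  by apply: h.
rewrite big_nat_recr// (_ : (fun s => _) = (fun s => \sum_(a <= k < b) F k s) \+ F b); last first.
  by apply/funext => s; rewrite big_nat_recr.
apply: is_deriveD; last exact: h.
by apply: IH => // k ak kb; apply: h => //; exact: ltnW.
Qed.

Section interaction.
Context {R : realType} (n : nat) (beta : R).
Implicit Types q v : nat -> R.
Hypotheses (n2 : (2 <= n)%N) (b0 : 0 < beta).
Local Notation N := (n%:R : R).
Local Notation arcs q i k := (arc q i k / N ^+ 2).

(** The sums below run over k = 1 .. n - 1 and all starting points i: each
   ordered pair of points is met once. *)
Definition ang k : R := 2 * pi * k%:R / N.
Definition pairsum (F : nat -> nat -> R) := \sum_(1 <= k < n) \sum_(0 <= i < n) F k i.
Definition Ven q := beta / 2 * pairsum (fun k i => csc2 (ang k + arcs q i k)).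
(** Ven is the interaction energy of the configuration whose gaps are
   2 pi / n + q_i / n^2; Qen is its quadratic part, Ren the Taylor remainder and
   dRen q v the derivative of Ren at q in the direction v. *)
Definition Qen q := beta / 4 * pairsum (fun k i => ddcsc2 (ang k) * (arcs q i k) ^+ 2).
Definition Ren q := beta / 2 * pairsum (fun k i => tay0 (ang k) (arcs q i k)).
Definition dRen q v := beta / 2 * pairsum (fun k i => tay1 (ang k) (arcs q i k) * arcs v i k).
Definition loop0 : nat -> R := fun=> 0.

Let n0 : 0 < N. Proof. by rewrite ltr0n; lia. Qed.
Let nn0 : N != 0. Proof. by rewrite gt_eqF. Qed.

Lemma pairsum_le F G :
  (forall k i, (0 < k)%N -> (k < n)%N -> F k i <= G k i) -> pairsum F <= pairsum G.
Proof. by move=> h; apply: ler_sum_nat_cond => k k1 k2; apply: ler_sum => i _; exact: h. Qed.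

Lemma pairsum_scale c F : pairsum (fun k i => c * F k i) = c * pairsum F.
Proof. by rewrite mulr_sumr; apply: eq_bigr => k _; rewrite mulr_sumr. Qed.

Lemma pairsumD F G : pairsum (fun k i => F k i + G k i) = pairsum F + pairsum G.
Proof. by rewrite -big_split; apply: eq_bigr => k _; rewrite -big_split. Qed.

Lemma pairsum_shortsum (f : nat -> nat -> R) (c : R) : 0 <= c ->
  (forall k, (0 < k)%N -> (k < n)%N ->
    \sum_(0 <= i < n) f k i <= c * ((short n k)%:R) ^- 2) ->
  pairsum f <= 4 * c.
Proof.
move=> c0 h; apply: (@le_trans _ _ (\sum_(1 <= k < n) c * ((short n k)%:R : R) ^- 2)).
  by apply: ler_sum_nat_cond => k k1 k2; exact: h.
rewrite -mulr_sumr mulrC ler_wpM2r//; apply: sum_inv_short; lia.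
Qed.

(** The first-order term of the Taylor expansion vanishes after summation over
   the starting point, since the arcs of length k sum to zero. *)
Lemma energy_split q : loop n q -> Ven q - Ven loop0 = Qen q + Ren q.
Proof.
move=> lq; rewrite /Ven /Qen /Ren.
have -> : pairsum (fun k i => csc2 (ang k + arcs q i k)) =
  pairsum (fun k i => csc2 (ang k + arcs loop0 i k)) +
  (pairsum (fun k i => dcsc2 (ang k) / N ^+ 2 * arc q i k) +
  (2^-1 * pairsum (fun k i => ddcsc2 (ang k) * (arcs q i k) ^+ 2) +
   pairsum (fun k i => tay0 (ang k) (arcs q i k)))).
  rewrite -pairsum_scale -!pairsumD; apply: eq_bigr => k _; apply: eq_bigr => i _.
  by rewrite arc0 mul0r addr0 /tay0; field.
have -> : pairsum (fun k i => dcsc2 (ang k) / N ^+ 2 * arc q i k) = 0.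
  by rewrite /pairsum big1// => k _; rewrite -mulr_sumr sum_arc// mulr0.
by rewrite add0r; field.
Qed.

Let kap k : R := (short n k)%:R / (2 * N).

Let ang_facts k : (0 < k)%N -> (k < n)%N -> [/\ 0 < (short n k)%:R :> R, 0 < kap k &
  2 * kap k <= sin (ang k / 2)].
Proof.
move=> k0 kn; have s0 : 0 < (short n k)%:R :> R by rewrite ltr0n /short; lia.
split => //; first by rewrite divr_gt0// mulr_gt0.
have -> : ang k / 2 = pi * k%:R / N by rewrite /ang; field.
apply: le_trans (sin_pi_frac k0 kn).
by rewrite le_eqVlt; apply/orP; left; apply/eqP; rewrite /kap /short; field.
Qed.

Let arcs_small q i k : loop n q -> (forall i, `|q i| <= N) -> (0 < k)%N -> (k < n)%N ->
  `|arcs q i k| <= 2 * kap k.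
Proof.
move=> lq qB k0 kn; have := arc_short_le i lq (ltnW kn) qB.
rewrite normrM [`|N ^- 2|]ger0_norm ?invr_ge0 ?exprn_ge0//.
rewrite ler_pdivrMr ?exprn_gt0// => /le_trans; apply.
by rewrite le_eqVlt; apply/orP; left; apply/eqP; rewrite /kap; field.
Qed.

(** The third derivative of 1/sin^2 at distance k / n is of order (n / k)^5, and
   the cubed displacement is at most (k B) (arc sum)^2 / n^6. Summing over the
   starting points gives k^2 E2, so that a convergent series in k remains. *)
Lemma Ren_bound q B : loop n q -> (forall i, `|q i| <= B) -> B <= N ->
  `|Ren q| <= 320 * beta * B * energy n 2 q / N.
Proof.
move=> lq qB BN.
have B0 : 0 <= B by apply: le_trans (normr_ge0 _) (qB 0%N).
have qN i : `|q i| <= N by apply: le_trans (qB i) BN.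
have E0 : 0 <= energy n 2 q by apply: sumr_ge0 => i _; exact: sqr_ge0.
have H : pairsum (fun k i => `|tay0 (ang k) (arcs q i k)|) <= 4 * (160 * B * energy n 2 q / N).
  apply: pairsum_shortsum.
    by apply: mulr_ge0; [apply: mulr_ge0 => //; apply: mulr_ge0|rewrite invr_ge0 ltW].
  move=> k k0 kn; have [s0 p0 hs] := ang_facts k0 kn.
  apply: (@le_trans _ _ (\sum_(0 <= i < n) (160 * B / N * (short n k)%:R ^- 4 * arc q i k ^+ 2))).
    apply: ler_sum => i _; apply: le_trans (tay0_bound p0 hs (arcs_small i lq qN k0 kn)) _.
    have -> : `|arcs q i k| ^+ 3 = `|arc q i k| * arc q i k ^+ 2 / N ^+ 6.
      rewrite normrM [`|N ^- 2|]ger0_norm ?invr_ge0 ?exprn_ge0//.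
      by rewrite -[arc q i k ^+ 2]real_normK ?num_real//; field.
    have := arc_short_le i lq (ltnW kn) qB.
    have a0 : 0 <= arc q i k ^+ 2 := sqr_ge0 _.
    move: (arc q i k ^+ 2) a0 `|arc q i k| => a a0 b hb.
    apply: (@le_trans _ _ (5 / kap k ^+ 5 * ((short n k)%:R * B * a / N ^+ 6))).
      apply: ler_wpM2l; first by rewrite divr_ge0// exprn_ge0// ltW.
      by apply: ler_wpM2r; [rewrite invr_ge0 exprn_ge0// ltW|exact: ler_wpM2r].
    rewrite le_eqVlt; apply/orP; left; apply/eqP; rewrite /kap; field.
    by rewrite nn0 gt_eqF.
  rewrite -mulr_sumr.
  apply: (@le_trans _ _ (160 * B / N * (short n k)%:R ^- 4 * ((short n k)%:R ^+ 2 * energy n 2 q))).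
    apply: ler_wpM2l; last exact: (sum_short2 lq (ltnW kn)).
    apply: mulr_ge0; last by rewrite invr_ge0 exprn_ge0.
    by apply: mulr_ge0; [apply: mulr_ge0|rewrite invr_ge0 ltW].
  rewrite le_eqVlt; apply/orP; left; apply/eqP; field.
  by rewrite nn0 gt_eqF.
rewrite normrM ger0_norm; last by rewrite divr_ge0// ltW.
apply: (@le_trans _ _ (beta / 2 * (4 * (160 * B * energy n 2 q / N)))); last first.
  by rewrite le_eqVlt; apply/orP; left; apply/eqP; field.
apply: ler_wpM2l; first by rewrite divr_ge0// ltW.
apply: le_trans H; apply: le_trans (ler_norm_sum _ _ _) _.
by apply: ler_sum => k _; exact: ler_norm_sum.
Qed.

(** As for Ren_bound, but the square of the displacement along q is multiplied by
   the displacement along v; Young's inequality 2 a^2 b <= l a^4 + b^2 / l,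
   scaled with k, separates them. *)
Lemma dRen_bound q v (l : R) : loop n q -> loop n v -> (forall i, `|q i| <= N) -> 0 < l ->
  `|dRen q v| <= 160 * beta / N * (l * energy n 4 q + energy n 2 v / l).
Proof.
move=> lq lv qN l0.
set E := l * energy n 4 q + energy n 2 v / l.
have E40 : 0 <= energy n 4 q by apply: sumr_ge0 => i _; rewrite -[4%N]/(2 * 2)%N exprM sqr_ge0.
have E20 : 0 <= energy n 2 v by apply: sumr_ge0 => i _; rewrite sqr_ge0.
have E0 : 0 <= E by rewrite addr_ge0// ?mulr_ge0// ?invr_ge0 ltW.
have H : pairsum (fun k i => `|tay1 (ang k) (arcs q i k) * arcs v i k|) <= 4 * (80 / N * E).
  apply: pairsum_shortsum; first by rewrite mulr_ge0// divr_ge0// ltW.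
  move=> k k0 kn; have [s0 p0 hs] := ang_facts k0 kn.
  set S := (short n k)%:R in s0 *.
  apply: (@le_trans _ _ (\sum_(0 <= i < n) (80 / N / S ^+ 5 *
      (l / S * arc q i k ^+ 4 + S / l * arc v i k ^+ 2)))).
    apply: ler_sum => i _; rewrite normrM.
    apply: le_trans (ler_wpM2r _ (tay1_bound_d p0 hs (arcs_small i lq qN k0 kn))) _ => //.
    rewrite normrM [`|N ^- 2|]ger0_norm ?invr_ge0 ?exprn_ge0//.
    have -> : arc v i k ^+ 2 = `|arc v i k| ^+ 2 by rewrite real_normK ?num_real.
    move: (arc q i k) `|arc v i k| => a b.
    rewrite (_ : 5 / kap k ^+ 5 * (a / N ^+ 2) ^+ 2 * (b / N ^+ 2) =
      80 / N / S ^+ 5 * (2 * a ^+ 2 * b)); last first.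
      by rewrite /kap -/S; field; rewrite nn0 gt_eqF.
    apply: ler_wpM2l; first by rewrite !mulr_ge0// invr_ge0 ?exprn_ge0// ltW.
    rewrite -subr_ge0 (_ : _ - _ = l / S * (a ^+ 2 - S / l * b) ^+ 2).
      by apply: mulr_ge0; [rewrite divr_ge0// ltW|exact: sqr_ge0].
    by field; rewrite !gt_eqF.
  rewrite -mulr_sumr big_split /= -!mulr_sumr.
  apply: (@le_trans _ _ (80 / N / S ^+ 5 * (l / S * (S ^+ 4 * energy n 4 q) + S / l * (S ^+ 2 * energy n 2 v)))).
    apply: ler_wpM2l; first by rewrite !mulr_ge0// invr_ge0 ?exprn_ge0// ltW.
    apply: lerD; apply: ler_wpM2l; [by rewrite divr_ge0// ltW|exact: sum_short4 (ltnW kn)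
      |by rewrite divr_ge0// ltW|exact: sum_short2 (ltnW kn)].
  rewrite le_eqVlt; apply/orP; left; apply/eqP; rewrite /E; field.
  by rewrite nn0 !gt_eqF.
rewrite normrM ger0_norm; last by rewrite divr_ge0// ltW.
apply: (@le_trans _ _ (beta / 2 * (4 * (80 / N * E)))); last first.
  by rewrite le_eqVlt; apply/orP; left; apply/eqP; field.
apply: ler_wpM2l; first by rewrite divr_ge0// ltW.
apply: le_trans H; apply: le_trans (ler_norm_sum _ _ _) _.
by apply: ler_sum => k _; exact: ler_norm_sum.
Qed.

Lemma arc_line q v (t : R) i k : arc (fun j => q j + t * v j) i k = arc q i k + t * arc v i k.
Proof. by rewrite /arc big_split mulr_sumr. Qed.

Lemma loop_line q v (t : R) : loop n q -> loop n v -> loop n (fun j => q j + t * v j).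
Proof.
move=> [pq q0] [pv v0]; split; first by move=> i; rewrite pq pv.
by rewrite big_split /= -mulr_sumr q0 v0 mulr0 addr0.
Qed.

Lemma is_derive_Ren q v (t : R) : loop n q -> loop n v ->
  (forall i, `|q i + t * v i| <= N) ->
  is_derive t 1 (fun s : R => Ren (fun j => q j + s * v j)) (dRen (fun j => q j + t * v j) v).
Proof.
move=> lq lv qN; rewrite /Ren /dRen.
apply: is_deriveZ; apply: is_derive_sum_nat => k k0 kn; apply: is_derive_sum_nat => i _ _.
have [s0 p0 hs] := ang_facts k0 kn.
have sm := arcs_small i (loop_line t lq lv) qN k0 kn.
have D1 := is_derive_tay0 p0 hs sm (lexx _).
have D2 : is_derive t 1 (fun s : R => arc (fun j => q j + s * v j) i k / N ^+ 2) (arcs v i k).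
  rewrite (_ : (fun s => _) = fun s : R => arc q i k / N ^+ 2 + arc v i k / N ^+ 2 * s); last first.
    by apply/funext => s; rewrite arc_line; ring.
  by apply: is_derive_eq; rewrite /GRing.scale /=; ring.
have := @is_derive1_comp _ (tay0 (ang k)) (fun s : R => arc (fun j => q j + s * v j) i k / N ^+ 2) t _ _ D1 D2.
by move=> H; apply: is_derive_eq.
Qed.

Lemma is_derive_dRen q v (t : R) : loop n q -> loop n v ->
  (forall i, `|q i + t * v i| <= N) ->
  is_derive t 1 (fun s : R => dRen (fun j => q j + s * v j) v)
    (beta / 2 * pairsum (fun k i =>
      (ddcsc2 (ang k + arcs (fun j => q j + t * v j) i k) - ddcsc2 (ang k)) * arcs v i k * arcs v i k)).
Proof.
move=> lq lv qN; rewrite /dRen.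
apply: is_deriveZ; apply: is_derive_sum_nat => k k0 kn; apply: is_derive_sum_nat => i _ _.
have [s0 p0 hs] := ang_facts k0 kn.
have sm := arcs_small i (loop_line t lq lv) qN k0 kn.
have D1 := is_derive_tay1 p0 hs sm (lexx _).
have D2 : is_derive t 1 (fun s : R => arc (fun j => q j + s * v j) i k / N ^+ 2) (arcs v i k).
  rewrite (_ : (fun s => _) = fun s : R => arc q i k / N ^+ 2 + arc v i k / N ^+ 2 * s); last first.
    by apply/funext => s; rewrite arc_line; ring.
  by apply: is_derive_eq; rewrite /GRing.scale /=; ring.
have H := @is_derive1_comp _ (tay1 (ang k)) (fun s : R => arc (fun j => q j + s * v j) i k / N ^+ 2) t _ _ D1 D2.
have := is_deriveM H (is_derive_cst (arcs v i k) t 1).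
by move=> D; apply: (is_derive_eq D); rewrite /GRing.scale /= mulr0 add0r mulrC.
Qed.

(** Only the pairs of neighbours are kept; the second derivative of 1/sin^2 at
   2 pi / n is at least n^4 / (2 pi^4). *)
Lemma Qen_ge q : beta / (8 * pi ^+ 4) * energy n 2 q <= Qen q.
Proof.
have pi0 := pi_gt0 R.
have dd0 (u : R) : 0 <= ddcsc2 u.
  rewrite /ddcsc2; apply: divr_ge0; last by rewrite -[4%N]/(2 * 2)%N exprM sqr_ge0.
  have := sin2cos2 (u / 2); have := sqr_ge0 (cos (u / 2)); lra.
have [s0 p0 hs] := @ang_facts 1 isT n2.
rewrite /Qen /pairsum big_ltn//.
have rest : 0 <= \sum_(2 <= k < n) \sum_(0 <= i < n) ddcsc2 (ang k) * (arcs q i k) ^+ 2.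
  by apply: sumr_ge0 => k _; apply: sumr_ge0 => i _; rewrite mulr_ge0// sqr_ge0.
have first_ : N ^+ 4 / (2 * pi ^+ 4) * (energy n 2 q / N ^+ 4) <=
    \sum_(0 <= i < n) ddcsc2 (ang 1) * (arcs q i 1) ^+ 2.
  rewrite -mulr_sumr (_ : energy n 2 q / N ^+ 4 = \sum_(0 <= i < n) (arcs q i 1) ^+ 2); last first.
    rewrite /energy mulr_suml; apply: eq_bigr => i _.
    by rewrite /arc big_nat1 addn0; field.
  apply: ler_wpM2r; first by apply: sumr_ge0 => i _; exact: sqr_ge0.
  have sle : sin (ang 1 / 2) <= pi / N.
    have h : 0 <= pi / N by rewrite divr_ge0// ltW.
    have := sin_lipschitz 0 (pi / N); rewrite sin0 subr0 add0r (ger0_norm h).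
    have -> : ang 1 / 2 = pi / N by rewrite /ang; field.
    by move/ler_normlW.
  have sp : 0 < sin (ang 1 / 2) by apply: lt_le_trans hs; rewrite mulr_gt0.
  rewrite /ddcsc2; have := sin2cos2 (ang 1 / 2); have := sqr_ge0 (cos (ang 1 / 2)).
  move: (sin _) (cos _) sle sp => s c sle sp c0 sc.
  apply: (@le_trans _ _ (2^-1 / s ^+ 4)).
    rewrite (_ : N ^+ 4 / _ = 2^-1 / (pi / N) ^+ 4); last first.
      by move: pi pi0 => P P0; field; rewrite nn0 gt_eqF.
    rewrite ler_pM2l ?invr_gt0// lef_pV2 ?posrE ?exprn_gt0 ?divr_gt0//.
    by apply: lerXn2r => //; rewrite nnegrE; [exact: ltW|rewrite divr_ge0// ltW].
  by rewrite ler_pM2r ?invr_gt0 ?exprn_gt0//; lra.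
apply: (@le_trans _ _ (beta / 4 * (N ^+ 4 / (2 * pi ^+ 4) * (energy n 2 q / N ^+ 4)))).
  rewrite le_eqVlt; apply/orP; left; apply/eqP.
  by move: pi pi0 => P P0; field; rewrite nn0 gt_eqF.
apply: ler_wpM2l; first by rewrite divr_ge0// ltW.
by apply: le_trans first_ _; rewrite lerDl.
Qed.

Lemma ang_gap q i k : ang k + arcs q i k = \sum_(0 <= j < k) (2 * pi / N + q (i + j)%N / N ^+ 2).
Proof.
rewrite big_split /= sumr_const_nat subn0 -mulr_suml /ang /arc -mulr_natl.
by congr (_ + _); ring.
Qed.

Lemma ang_compl k : (k <= n)%N -> ang (n - k) = 2 * pi - ang k.
Proof. by move=> kn; rewrite /ang natrB//; field. Qed.

(** Midpoint convexity of each term between q and the lattice; the angles stay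
   in (0, 2 pi) on both sides because all the gaps are positive. *)
Lemma Ven_midpoint q : loop n q -> (forall i, 0 < 2 * pi / N + q i / N ^+ 2) ->
  2 * (Ven (fun i => q i / 2) - Ven loop0) <= Ven q - Ven loop0.
Proof.
move=> lq pos.
have sum_gt0 i k : (0 < k)%N -> 0 < ang k + arcs q i k.
  case: k => // k _; rewrite ang_gap big_nat_recr//=; apply: ltr_wpDl => //.
  by apply: sumr_ge0 => j _; exact: ltW.
suff : 2 * Ven (fun i => q i / 2) <= Ven q + Ven loop0 by lra.
rewrite /Ven -mulrDr mulrCA; apply: ler_wpM2l; first by rewrite divr_ge0// ltW.
rewrite -pairsumD -pairsum_scale; apply: pairsum_le => k i k0 kn.
have -> : arc (fun j => q j / 2) i k = arc q i k / 2 by rewrite /arc mulr_suml.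
rewrite arc0 mul0r addr0 (_ : arc q i k / 2 / N ^+ 2 = arcs q i k / 2); last by ring.
have pi0 := pi_gt0 R.
apply: csc2_midpoint.
  have a0 j : (0 < j)%N -> 0 < ang j by move=> j0; rewrite /ang; apply: divr_gt0 => //; apply: mulr_gt0; [exact: mulr_gt0|rewrite ltr0n].
  have := a0 _ k0; have := a0 (n - k)%N; rewrite ang_compl ?(ltnW kn)//.
  by move=> /(_ ltac:(lia)); lra.
have h1 := sum_gt0 i _ k0.
have := sum_gt0 (i + k)%N (n - k)%N ltac:(lia).
rewrite arc_compl ?(ltnW kn)// ang_compl ?(ltnW kn)// mulNr.
by lra.
Qed.
End interaction.


(** * Point configurations in gap coordinates *)

(** By periodicity the pairs (i, j) can be indexed by j and the nonzero residue
   k of i - j. *)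
Lemma offdiag_sum (R : realType) n (f : nat -> nat -> R) : (0 < n)%N ->
  (forall j, periodic_seq n (f ^~ j)) ->
  \sum_(i < n) \sum_(j < n | i != j) f i j =
  \sum_(1 <= k < n) \sum_(0 <= j < n) f (j + k)%N j.
Proof.
move=> n0 pf; rewrite (exchange_big_dep xpredT)//= exchange_big /= [RHS]big_mkord.
apply: eq_bigr => j _; apply: (@addrI _ (f j j)).
transitivity (\sum_(i < n) f i j); first by rewrite [RHS](bigD1 j).
rewrite -(big_mkord xpredT (f ^~ j)) -(window_sum j (pf j)) [in LHS]big_ltn//.
by rewrite /= addn0.
Qed.

Section gaps.
Context {R : realType} (m : nat).
Local Notation N := (m.+1%:R : R).
Implicit Types (g : Rn R m) (x : Rn R m.+1) (q : nat -> R).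

(** The m free gaps determine the last one, which closes the loop; incidence i
   is the loop of gaps produced by the i-th free gap. *)
Definition incidence (i : 'I_m) (r : nat) : R :=
  (r %% m.+1 == i)%N%:R - (r %% m.+1 == m)%N%:R.
Definition gap g (r : nat) : R := \sum_(i < m) tnth g i * incidence i r.

Lemma gapE g (i : 'I_m) : gap g i = tnth g i.
Proof.
have im : (i %% m.+1 = i)%N by rewrite modn_small// ltnW// ltnS.
rewrite /gap (bigD1 i)//= big1 ?addr0 /incidence im.
  by rewrite eqxx (ltn_eqF (ltn_ord i)) subr0 mulr1.
move=> j ji; rewrite (ltn_eqF (ltn_ord i)) subr0 (_ : (_ == _) = false) ?mulr0//.
by apply/negbTE; rewrite eq_sym.
Qed.

Lemma gap_last g : gap g m = - \sum_(i < m) tnth g i.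
Proof.
rewrite /gap -sumrN; apply: eq_bigr => i _.
rewrite /incidence modn_small// eqxx gtn_eqF ?ltn_ord// sub0r mulrN mulr1//.
Qed.

Lemma loop_gap g : loop m.+1 (gap g).
Proof.
split; first by move=> r; apply: eq_bigr => i _; rewrite /incidence modnDr.
rewrite big_nat_recr//= gap_last big_mkord; apply/eqP; rewrite subr_eq0; apply/eqP.
by apply: eq_bigr => i _; rewrite gapE.
Qed.

Lemma arc_gap g (i : nat) (a b : R) : (i <= m)%N ->
  a * i%:R + b * arc (gap g) 0 i = \sum_(l < m | (l < i)%N) (b * tnth g l + a).
Proof.
move=> im; transitivity (\sum_(l < i) (b * gap g l + a)).
  rewrite big_split /= sumr_const card_ord -mulr_sumr /arc big_mkord mulr_natr addrC.
  by [].
rewrite (big_ord_widen m (fun l => b * gap g l + a))//.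
by apply: eq_bigr => l _; rewrite gapE.
Qed.

Lemma measurable_gap r : measurable_fun setT (fun g => gap g r).
Proof.
by apply: measurable_sum => i; apply: measurable_funM => //; exact: measurable_tnth.
Qed.

Lemma measurable_arc_gap i k : measurable_fun setT (fun g => arc (gap g) i k).
Proof. by apply: measurable_sum => j; exact: measurable_gap. Qed.

(** The points t + a i + b X_i, where t is the head and X_i the sum of the first
   i gaps. With a = 2 pi / n and b = n^-2 these are the angles of a
   configuration, with a = 0 and b = 1 a point of R^n lying over Gamma. *)
Definition chain (a b : R) x : Rn R m.+1 :=
  [tuple headR x + (a * (i : nat)%:R + b * arc (gap (tailR x)) 0 i) | i < m.+1].

Lemma jac_chain a b : 0 < b -> jac (chain a b) (b ^+ m).
Proof.
move=> b0; pose S (t : R) := fun z : Rn R m => [tuple 1 * tnth z i + t | i < m].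
pose U := fun z : Rn R m => [tuple b * tnth z i + a | i < m].
pose T (t : R) := S t \o (@cumT R m \o U).
have jU : jac (@cumT R m \o U) (b ^+ m).
  by rewrite -[b ^+ m]mul1r; apply: jac_comp; [exact: jac_cumT|exact: (jac_affine (fun=> a))].
have HT t : jac (T t) (b ^+ m).
  rewrite -[b ^+ m]mul1r; apply: jac_comp => //.
  by have := @jac_affine R m 1 (fun=> t) ltr01; rewrite expr1n.
apply: jac_ext (jac_tail (T := T) _ HT).
  move=> x; apply/esym/consR_ext; first by rewrite tnth_mktuple /arc big_geq// !mulr0 !addr0.
  move=> i; rewrite !tnth_mktuple addrC mul1r /= /bump leq0n add1n arc_gap ?ltn_ord//.
  by congr (_ + _); apply: eq_big => l; [rewrite ltnS|rewrite tnth_mktuple].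
apply: measurable_coordT => i.
apply: (@eq_measurable_fun _ _ _ _ _ (fun p : measurableTypeR R * Rn R m => 1 * tnth (cumT (U p.2)) i + p.1)).
  by move=> p _; rewrite [RHS]tnth_mktuple.
apply: measurable_funD; last exact: measurable_fst.
apply: measurable_funM => //.
have [mCU _ _] := jU.
have mC : measurable_fun setT (fun z => tnth (cumT (U z)) i) by exact: (measurableT_comp (measurable_tnth i) mCU).
exact: (measurableT_comp mC (@measurable_snd _ _ (measurableTypeR R) (Rn R m))).
Qed.

Definition arc_mean g : R := (\sum_(j < m.+1) arc (gap g) 0 j) / N.
(** The point of Gamma with the given gaps, that is, the rescaled displacements
   of the configuration; it does not depend on the rotation t. *)
Definition profile g : Rn R m.+1 := [tuple arc (gap g) 0 i - arc_mean g | i < m.+1].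

Lemma measurable_arc_mean : measurable_fun setT arc_mean.
Proof.
by apply: measurable_funM => //; apply: measurable_sum => j; exact: measurable_arc_gap.
Qed.

Lemma measurable_profile : measurable_fun setT profile.
Proof.
apply: measurable_coordT => i.
apply: (@eq_measurable_fun _ _ _ _ _ (fun g => arc (gap g) 0 i - arc_mean g)).
  by move=> g _; rewrite tnth_mktuple.
by apply: measurable_funB; [exact: measurable_arc_gap|exact: measurable_arc_mean].
Qed.

Let N0 : N != 0. Proof. by rewrite pnatr_eq0. Qed.

Lemma sum_ord_id : \sum_(i < m.+1) (i : nat)%:R = N * m%:R / 2.
Proof.
rewrite -(big_mkord xpredT (fun i => i%:R)) /=.
elim: m => [|k IH]; first by rewrite big_nat1 mulr0 mul0r.
by rewrite big_nat_recr//= IH -!natr1; field.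
Qed.

Lemma csum_chain a b x :
  csum (chain a b x) = N * headR x + a * (N * m%:R / 2) + b * (N * arc_mean (tailR x)).
Proof.
transitivity (\sum_(i < m.+1) (headR x + (a * (i : nat)%:R + b * arc (gap (tailR x)) 0 i))).
  by apply: eq_bigr => i _; rewrite /Defs.coord tnth_mktuple.
rewrite !big_split /= sumr_const card_ord -!mulr_sumr -mulr_natl sum_ord_id.
rewrite /arc_mean; set A := \sum_(j < m.+1) _; by field; rewrite addrC natr1 N0.
Qed.

Lemma proj_chain x : proj_hyperplane (chain 0 1 x) = profile (tailR x).
Proof.
apply: eq_from_tnth => i; rewrite !tnth_mktuple /mean csum_chain /Defs.coord tnth_mktuple.
by field; rewrite addrC natr1 N0.
Qed.

Lemma rescale_chain x : rescale (chain (2 * pi / N) (N ^- 2) x) = profile (tailR x).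
Proof.
apply: eq_from_tnth => i; rewrite !tnth_mktuple /psi.
have -> : \sum_(i0 < m.+1) Defs.coord (chain (2 * pi / N) (N ^- 2) x) i0 = csum (chain (2 * pi / N) (N ^- 2) x) by [].
rewrite csum_chain /Defs.coord tnth_mktuple -[m%:R]/(m%:R : R).
have -> : m%:R = N - 1 :> R by rewrite -natr1 addrK.
by move: N N0 (pi : R) => M M0 P; field.
Qed.
End gaps.

Section pair_energies.
Context {R : realType} (m : nat) (beta : R).
Local Notation n := m.+1.
Local Notation N := (m.+1%:R : R).
Implicit Types (g : Rn R m) (x : Rn R m.+1).

Let N0 : N != 0. Proof. by rewrite pnatr_eq0. Qed.

Lemma sin_half_period (u : R) : sin ((u + 2 * pi) / 2) ^+ 2 = sin (u / 2) ^+ 2.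
Proof.
have -> : (u + 2 * pi) / 2 = u / 2 + pi by move: (pi : R) => P; field.
by rewrite sinDpi sqrrN.
Qed.

Lemma csc2_period (u : R) : csc2 (u + 2 * pi) = csc2 u.
Proof. by rewrite /csc2 sin_half_period. Qed.

Lemma ddcsc2_period (u : R) : ddcsc2 (u + 2 * pi) = ddcsc2 u.
Proof. by rewrite /ddcsc2 -[4%N]/(2 * 2)%N !exprM sin_half_period. Qed.

Let node (i j : nat) : R := 2 * pi / N * (i%:R - j%:R).

Let node_shift i j : node (i + n) j = node i j + 2 * pi.
Proof. by rewrite /node natrD; move: N N0 (pi : R) => M M0 P; field. Qed.

Let node_ang j k : node (j + k) j = @ang R n k.
Proof. by rewrite /node /ang natrD; move: N N0 (pi : R) => M M0 P; field. Qed.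

Let disp_shift g i j : arc (gap g) 0 (i + n) - arc (gap g) 0 j = arc (gap g) 0 i - arc (gap g) 0 j.
Proof. by rewrite arcD (arc_full _ (loop_gap g)) addr0. Qed.

Lemma Hn_chain x :
  Hn beta (chain (2 * pi / N) (N ^- 2) x) = - Ven n beta (gap (tailR x)).
Proof.
set q := gap (tailR x).
pose f i j := csc2 (node i j + (arc q 0 i - arc q 0 j) / N ^+ 2).
rewrite /Hn /Ven mulNr; congr (- (_ * _)).
transitivity (\sum_(i < n) \sum_(j < n | i != j) f i j).
  apply: eq_bigr => i _; apply: eq_bigr => j _; rewrite /Defs.coord !tnth_mktuple div1r.
  rewrite /f /csc2; congr ((sin _ ^+ 2)^-1); congr (_ / 2); rewrite /node -/q; ring.
rewrite offdiag_sum//; last first.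
  by move=> j i; rewrite /f node_shift disp_shift addrAC csc2_period.
apply: eq_bigr => k _; apply: eq_bigr => j _.
by rewrite /f node_ang (arcE q j k).
Qed.

Lemma Gn_profile g : Gn beta (profile g) = - Qen n beta (gap g).
Proof.
set q := gap g.
pose f i j := ddcsc2 (node i j) * ((arc q 0 i - arc q 0 j) / N ^+ 2) ^+ 2.
rewrite /Gn /Qen -[RHS]mulrN; congr (_ * _).
transitivity (- \sum_(i < n) \sum_(j < n | i != j) f i j).
  rewrite -sumrN; apply: eq_bigr => i _; rewrite -sumrN; apply: eq_bigr => j _.
  rewrite /Defs.coord !tnth_mktuple /= /f /ddcsc2 -/q.
  have -> : node i j / 2 = pi * (i%:R - j%:R) / N.
    by rewrite /node; move: N N0 (pi : R) => M M0 P; field.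
  rewrite invfM; have -> : N ^- 4 = N ^- 2 * N ^- 2 :> R by rewrite -invfM -exprD.
  ring.
rewrite offdiag_sum//; last first.
  by move=> j i; rewrite /f node_shift disp_shift ddcsc2_period.
congr (- _); apply: eq_bigr => k _; apply: eq_bigr => j _.
by rewrite /f node_ang (arcE q j k).
Qed.
End pair_energies.


(** * The two laws as integrals over gaps *)

Section measurability.
Context {R : realType}.

Lemma measurable_inv_sqr : measurable_fun setT (fun x : R => (x ^+ 2)^-1).
Proof.
apply: (@eq_measurable_fun _ _ _ _ _ (fun x : R => (x ^+ 2) `^ (-1))).
  by move=> x _; rewrite powR_inv1// sqr_ge0.
apply: (measurableT_comp (@measurable_powR R (-1))); exact: measurable_funX.
Qed.

Lemma measurable_csc2 : measurable_fun setT (@csc2 R).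
Proof.
apply: (measurableT_comp measurable_inv_sqr).
apply: measurableT_comp; last by apply: measurable_funM.
by apply: continuous_measurable_fun; exact: continuous_sin.
Qed.

Lemma integral_indic_mul d (T : measurableType d) (mu : {measure set T -> \bar R})
  (D : set T) (f : T -> R) :
  (\int[mu]_(x in D) (f x)%:E = \int[mu]_x (f x * \1_D x)%:E)%E.
Proof.
rewrite integral_mkcond; apply: eq_integral => x _.
by rewrite patchE indicE; case: ifP; rewrite ?mulr1 ?mulr0.
Qed.

Lemma measurable_pre d (T : measurableType d) m (f : T -> Rn R m) (A : set (Rn R m)) :
  measurable_fun setT f -> measurable A -> measurable (f @^-1` A).
Proof. by move=> mf mA; rewrite -[X in measurable X]setTI; exact: mf. Qed.
End measurability.

Section torus.
Context {R : realType} (m : nat) (beta : R).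
Hypothesis b0 : 0 < beta.
Local Notation n := m.+1.
Local Notation N := (m.+1%:R : R).
Local Notation leb := (@lebesgueRn R).
Implicit Types (g : Rn R m) (x : Rn R m.+1) (q : nat -> R).

Let N0 : N != 0. Proof. by rewrite pnatr_eq0. Qed.
Let N_gt0 : 0 < N. Proof. by rewrite ltr0n. Qed.
Let pi0 := pi_gt0 R.

Definition cell q (r : nat) : R := 2 * pi / N + q r / N ^+ 2.
(** The factor 1 + q_m / (2 pi n) is the length of the interval of admissible
   rotations: the first point must lie in [0, last gap]. Configurations with a
   zero gap, where 1/sin^2 takes the value 0 by convention, are excluded; they
   form a null set. *)
Definition weight q : R :=
  if [forall r : 'I_n, 0 < cell q r] then
    (1 + q m / (2 * pi * N)) * expR (- (Ven n beta q - Ven n beta (@loop0 R)))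
  else 0.

Local Notation torus_chain := (@chain R m (2 * pi / N) (N ^- 2)).

Let node (t : R) q (i : nat) := t + (2 * pi / N * i%:R + N ^- 2 * arc q 0 i).

Let nodeS t q i : node t q i.+1 = node t q i + cell q i.
Proof.
rewrite /node /cell -[i.+1]addn1 arcD add0n {2}/arc big_nat1 addn0 natrD.
by move: (pi : R) => P; field.
Qed.

Let node_last t g : node t (gap g) m = t + 2 * pi - cell (gap g) m.
Proof.
have := nodeS t (gap g) m; rewrite /node arc_full; last exact: loop_gap.
rewrite (mulfVK N0) mulr0 addr0 => ->; by rewrite addrK.
Qed.

(** The last angle is t + 2 pi minus the last gap, so the upper bound 2 pi on the
   angles becomes an upper bound on t. *)
Lemma ordered_torus_chain x : ordered_torus (torus_chain x) <->
  0 <= headR x <= cell (gap (tailR x)) m /\ forall r : 'I_m, 0 <= cell (gap (tailR x)) r.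
Proof.
set t := headR x; set q := gap (tailR x).
have E (i : 'I_n) : Defs.coord (torus_chain x) i = node t q i by rewrite /Defs.coord tnth_mktuple.
have node0 : node t q 0 = t by rewrite /node /arc big_geq// !mulr0 !addr0.
split.
  move=> [H1 H2]; split.
    have := H1 ord0; rewrite E node0 => /andP[-> _].
    by have := H1 ord_max; rewrite E node_last => /andP[_]; rewrite -/q; lra.
  move=> r; have rm := ltn_ord r.
  have := H2 (Ordinal (ltnW rm : (r < n)%N)) (Ordinal (rm : (r.+1 < n)%N)) (leqnSn _).
  by rewrite !E /= nodeS lerDl.
move=> [/andP[t0 tm] H].
have mono i j : (i <= j)%N -> (j <= m)%N -> node t q i <= node t q j.
  elim: j => [|j IH]; first by rewrite leqn0 => /eqP ->.
  rewrite leq_eqVlt => /orP[/eqP ->//|ij] jm.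
  rewrite nodeS ler_wpDr//; first exact: (H (Ordinal jm)).
  by apply: IH => //; exact: ltnW.
split; last by move=> i j ij; rewrite !E; apply: mono => //; rewrite -ltnS.
move=> i; have im : (i <= m)%N by rewrite -ltnS.
rewrite E; apply/andP; split.
  by apply: le_trans (mono 0%N i (leq0n _) im); rewrite node0.
apply: le_trans (mono i m im (leqnn _)) _.
by rewrite node_last -/q; lra.
Qed.

Lemma measurable_ordered_torus : measurable (@ordered_torus R n).
Proof.
have mle (u v : Rn R n -> R) : measurable_fun setT u -> measurable_fun setT v ->
    measurable [set z | u z <= v z].
  move=> mu mv; rewrite -[X in measurable X]setTI.
  exact: (measurable_fun_ler mu mv measurableT (Y := [set true])).
have -> : @ordered_torus R n = (\bigcap_(i in [set: 'I_n]) ([set z | 0 <= Defs.coord z i] `&` [set z | Defs.coord z i <= 2 * pi]))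
  `&` (\bigcap_(i in [set: 'I_n]) \bigcap_(j in [set j : 'I_n | (i <= j)%N]) [set z | Defs.coord z i <= Defs.coord z j]).
  apply/seteqP; split => z /=.
    by move=> [h1 h2]; split => [i _|i _ j ij]; [apply/andP; exact: h1|exact: h2].
  by move=> [h1 h2]; split => [i|i j ij]; [apply/andP; exact: h1|exact: h2].
apply: measurableI; apply: fin_bigcap_measurable; [exact: finite_finset| |exact: finite_finset|].
  by move=> i _; apply: measurableI; apply: mle => //; exact: measurable_coord.
move=> i _; apply: fin_bigcap_measurable; first exact: finite_finset.
by move=> j _; apply: mle; exact: measurable_coord.
Qed.

Lemma measurable_Hn : measurable_fun setT (@Hn R n beta).
Proof.
apply: measurable_funM => //; apply: measurable_sum => i.
rewrite (_ : (fun _ => _) = fun x => \sum_(j < n) (if i != j then csc2 (Defs.coord x i - Defs.coord x j) else 0)); last first.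
  by apply/funext => x; rewrite big_mkcond; apply: eq_bigr => j _; rewrite div1r.
apply: measurable_sum => j; case: (i != j) => //.
apply: (measurableT_comp measurable_csc2).
by apply: measurable_funB; exact: measurable_coord.
Qed.

Lemma measurable_rescale : measurable_fun setT (@rescale R n).
Proof.
apply: measurable_coordT => i.
apply: (@eq_measurable_fun _ _ _ _ _ (fun z : Rn R n => N ^+ 2 * (Defs.coord z i - 2 * pi * (i : nat)%:R / N - psi z))).
  by move=> z _; rewrite tnth_mktuple.
apply: measurable_funM => //; apply: measurable_funB.
  by apply: measurable_funB => //; exact: measurable_coord.
apply: measurable_funB => //; apply: measurable_funM => //.
exact: measurable_csum.
Qed.

Lemma measurable_Ven_gap : measurable_fun setT (fun g => Ven n beta (gap g)).
Proof.
apply: measurable_funM => //; apply: measurable_sum => k; apply: measurable_sum => i.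
apply: (measurableT_comp measurable_csc2); apply: measurable_funD => //.
by apply: measurable_funM => //; exact: measurable_arc_gap.
Qed.

Lemma measurable_weight : measurable_fun setT (fun g => weight (gap g)).
Proof.
pose S := [set g : Rn R m | forall r : 'I_n, 0 < cell (gap g) r].
have mS : measurable S.
  have -> : S = \bigcap_(r in [set: 'I_n]) [set g | 0 < cell (gap g) r].
    by apply/seteqP; split => g /= h r => [_|]; exact: h.
  apply: fin_bigcap_measurable; first exact: finite_finset.
  move=> r _; rewrite -[X in measurable X]setTI.
  have mc : measurable_fun setT (fun g => cell (gap g) r).
    by apply: measurable_funD => //; apply: measurable_funM => //; exact: measurable_gap.
  exact: (measurable_fun_ltr (measurable_cst _) mc measurableT (Y := [set true])).
apply: (@eq_measurable_fun _ _ _ _ _ (fun g => (1 + gap g m / (2 * pi * N)) * expR (- (Ven n beta (gap g) - Ven n beta (@loop0 R))) * \1_S g)).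
  move=> g _; rewrite /weight indicE; case: ifPn => [/forallP h|/forallPn h].
    by rewrite mem_set// mulr1.
  rewrite memNset ?mulr0// => hS; case: h => r /negP; apply; exact: hS.
apply: measurable_funM; last exact: measurable_indic.
apply: measurable_funM.
  by apply: measurable_funD => //; apply: measurable_funM => //; exact: measurable_gap.
apply: measurableT_comp => //; apply: measurableT_comp => //; apply: measurable_funB => //.
exact: measurable_Ven_gap.
Qed.

Lemma weight_ge0 q : 0 <= weight q.
Proof.
rewrite /weight; case: ifP => // /forallP /(_ ord_max); rewrite /cell /= => h.
apply: mulr_ge0; last exact: expR_ge0.
have -> : 1 + q m / (2 * pi * N) = N / (2 * pi) * (2 * pi / N + q m / N ^+ 2).
  by move: (pi : R) pi0 => P P0; field; rewrite addrC natr1 N0 gt_eqF.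
by apply: mulr_ge0; [apply: divr_ge0 => //; apply: mulr_ge0 => //; exact: ltW|exact: ltW].
Qed.

Lemma cell_neq0_ae : \forall g \ae leb m, forall r : 'I_m, cell (gap g) r != 0.
Proof.
suff H k : \forall g \ae leb m, forall r : 'I_m, r = k :> nat -> cell (gap g) r != 0.
  have := ae_foralln H; apply: filterS => g hg r; exact: hg.
case: (ltnP k m) => km; last first.
  by apply: aeW => g r rk; have := ltn_ord r; rewrite rk ltnNge km.
pose r0 := Ordinal km.
pose B (i : 'I_m) : set (measurableTypeR R) := if i == r0 then [set - (2 * pi * N)] else setT.
have mB i : measurable (B i) by rewrite /B; case: ifP => _ //; exact: measurable_set1.
exists [set g | forall i, B i (tnth g i)]; split.
- have -> : [set g : Rn R m | forall i, B i (tnth g i)] = \bigcap_(i in [set: 'I_m]) [set g | B i (tnth g i)].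
    by apply/seteqP; split => g /= h r => [_|]; exact: h.
  apply: fin_bigcap_measurable; first exact: finite_finset.
  move=> i _; rewrite -[X in measurable X]setTI.
  by apply: (measurable_tnth i) => //.
- rewrite lebesgueRn_box// (bigD1 r0)//= {1}/B eqxx.
  by rewrite (lebesgue_measure_set1 (- (2 * pi * N))) mul0e.
move=> g /= /existsNP[r /not_implyP[rk /negP]]; rewrite negbK => /eqP c0.
have rr : r = r0 by exact: val_inj.
move=> i; rewrite /B; case: eqP => // -> /=.
move: c0; rewrite rr; rewrite /cell gapE; move: (tnth g r0) => y.
move=> /(congr1 ( *%R (N ^+ 2))); rewrite mulr0 => h.
have {}h : 2 * pi * N + y = 0 by rewrite -h; move: (pi : R) => P; field; rewrite addrC natr1 N0.
by apply/eqP; rewrite -addr_eq0 addrC h.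
Qed.

Definition torus_const : R := (N ^- 2) ^+ m * (2 * pi / N * expR (- Ven n beta (@loop0 R))).

Lemma torus_const_gt0 : 0 < torus_const.
Proof.
apply: mulr_gt0; first by rewrite exprn_gt0// invr_gt0 exprn_gt0.
by rewrite mulr_gt0 ?expR_gt0// divr_gt0// mulr_gt0.
Qed.

(** Pass to gap coordinates by jac_chain and integrate out the rotation t, on
   which neither the energy nor the rescaled displacements depend. *)
Lemma torus_integral (A : set (Rn R n)) : measurable A ->
  (\int[leb n]_(x in @ordered_torus R n `&` @rescale R n @^-1` A) (expR (Hn beta x))%:E =
   torus_const%:E * \int[leb m]_g (weight (gap g) * \1_A (profile g))%:E)%E.
Proof.
move=> mA; set D := _ `&` _.
have mD : measurable D.
  by apply: measurableI; [exact: measurable_ordered_torus|exact: (measurable_pre measurable_rescale)].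
rewrite integral_indic_mul.
pose F x := (expR (Hn beta x) * \1_D x)%:E.
have F0 x : (0 <= F x)%E by rewrite lee_fin mulr_ge0 ?expR_ge0// indicE.
have mF : measurable_fun setT F.
  apply/measurable_EFinP; apply: measurable_funM; last exact: measurable_indic.
  by apply: measurableT_comp => //; exact: measurable_Hn.
have bb : 0 < N ^- 2 by rewrite invr_gt0 exprn_gt0.
have [mT c0 HT] := @jac_chain R m (2 * pi / N) _ bb.
rewrite HT//; rewrite integral_consRn_swap//; last exact: (measurableT_comp mF mT).
rewrite /torus_const EFinM -muleA; congr (_ * _)%E.
have k0 : 0 <= 2 * pi / N * expR (- Ven n beta (@loop0 R)).
  by apply: mulr_ge0; [apply: divr_ge0 => //; apply: mulr_ge0 => //; exact: ltW|exact: expR_ge0].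
have mI : measurable_fun setT (fun g => \1_A (profile g) : R).
  by apply: measurableT_comp; [exact: measurable_indic|exact: measurable_profile].
have mW : measurable_fun setT (fun g => (weight (gap g) * \1_A (profile g))%:E).
  apply/measurable_EFinP; apply: measurable_funM => //; exact: measurable_weight.
have W0 g : (0 <= (weight (gap g) * \1_A (profile g))%:E)%E.
  by rewrite lee_fin mulr_ge0 ?weight_ge0// indicE.
rewrite -ge0_integralZl_EFin//.
apply: ge0_ae_eq_integral => //.
- have := @measurable_int_head R m (fun x => F (torus_chain x)) (measurableT_comp mF mT).
  by apply => x.
- exact: measurable_funeM.
- by move=> g _; apply: integral_ge0.
- by move=> g _; apply: mule_ge0 => //; rewrite lee_fin.
have := cell_neq0_ae; apply: filterS => g nz _.
set q := gap g; pose K := expR (- Ven n beta q) * \1_A (profile g) * [forall r : 'I_m, 0 <= cell q r]%:R.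
have K0 : 0 <= K by rewrite !mulr_ge0 ?expR_ge0// indicE.
transitivity (\int[lebesgue_measure]_a (K%:E * (\1_(`[0, cell q m]%classic) a)%:E))%E.
  apply: eq_integral => a _.
  rewrite /F Hn_chain tailRK -/q -EFinM; congr EFin.
  rewrite /K -[RHS]mulrA -[RHS]mulrA; congr (_ * _).
  have DE : D (torus_chain (consR a g)) <-> [/\ 0 <= a <= cell q m, (forall r : 'I_m, 0 <= cell q r) & A (profile g)].
    have H := ordered_torus_chain (consR a g); rewrite headRK tailRK -/q in H.
    have E : rescale (torus_chain (consR a g)) = profile g by rewrite rescale_chain tailRK.
    rewrite /D /setI /preimage /= E; split; first by move=> [/H[h1 h2] h3].
    by move=> [h1 h2 h3]; split => //; apply/H.
  rewrite !indicE; case: (boolP (_ \in D)) => [/set_mem hD|hD].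
    have [h1 h2 h3] := DE.1 hD.
    by rewrite !mem_set//= ?in_itv//= (introT forallP h2) !mulr1.
  case: (boolP (profile g \in A)) => [/set_mem h3|_]; last by rewrite !mul0r.
  case: (boolP [forall r, _]) => [/forallP h2|_]; last by rewrite mul0r mulr0.
  rewrite mul1r (_ : (a \in _) = false) ?mul1r//.
  apply/negbTE; apply: contra hD => /set_mem; rewrite /= in_itv /= => h1.
  by apply: mem_set; apply: DE.2.
rewrite ge0_integralZl_EFin//; last first.
  by apply/measurable_EFinP; exact: measurable_indic.
rewrite integral_indic//.
transitivity (K%:E * (if 0 < cell q m then cell q m else 0)%:E)%E.
  congr (_ * _)%E; rewrite setIT; apply: (etrans (lebesgue_measure_itv `[0, cell q m])).
  by rewrite /= lte_fin; case: ifP => // _; rewrite -EFinD subr0.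
rewrite -!EFinM; congr EFin.
rewrite /weight; case: (boolP [forall r : 'I_n, _]) => [/forallP h|/forallPn h].
  have hm := h ord_max; rewrite /= in hm; rewrite hm.
  have -> : K = expR (- Ven n beta q) * \1_A (profile g).
    rewrite /K (introT forallP) ?mulr1// => r; apply: ltW.
    exact: (h (widen_ord (leqnSn m) r)).
  have -> : - (Ven n beta q - Ven n beta (@loop0 R)) = - Ven n beta q - - Ven n beta (@loop0 R) by ring.
  rewrite expRB; have := expR_gt0 (- Ven n beta (@loop0 R)).
  move: (expR _) (\1_A _) (expR _) => e i e' e'0; rewrite /cell.
  by move: (pi : R) pi0 => P P0; field; rewrite addrC natr1 N0 !gt_eqF.
rewrite mul0r mulr0; case: ifP => [hm|]; last by rewrite mulr0.
rewrite (_ : K = 0) ?mul0r// /K (_ : [forall r, _] = false) ?mulr0//.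
apply/negbTE/forallPn; case: h => r hr.
have rm : (r < m)%N.
  rewrite ltn_neqAle -ltnS ltn_ord andbT; apply/eqP => rm.
  by move: hr; rewrite rm hm.
exists (Ordinal rm) => /=; rewrite -ltNge; rewrite -leNgt in hr.
by rewrite lt_neqAle hr (nz (Ordinal rm)).
Qed.

(** The energy is at most zero, so the density of the torus is bounded by one on
   a box of finite volume. *)
Lemma nnint_weight : nnint (leb m) (fun g => weight (gap g)).
Proof.
split; [exact: measurable_weight|by move=> g; exact: weight_ge0|].
have E := torus_integral (@measurableT _ (Rn R n)).
have {}E : (\int[leb n]_(x in @ordered_torus R n) (expR (Hn beta x))%:E =
   torus_const%:E * \int[leb m]_g (weight (gap g))%:E)%E.
  rewrite preimage_setT setIT in E; rewrite E; congr (_ * _)%E.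
  by apply: eq_integral => g _; rewrite indicT mulr1.
have Hn0 (x : Rn R n) : Hn beta x <= 0.
  rewrite /Hn mulNr oppr_le0; apply: mulr_ge0; first by rewrite divr_ge0// ltW.
  by do 2! (apply: sumr_ge0 => ? _); rewrite div1r invr_ge0 sqr_ge0.
have vol : (lebesgueRn n (@ordered_torus R n) < +oo)%E.
  pose B (i : 'I_n) : set (measurableTypeR R) := `[0, 2 * pi]%classic.
  apply: (@le_lt_trans _ _ (lebesgueRn n [set x | forall i, B i (tnth x i)])).
    apply: le_measure; rewrite ?inE; [exact: measurable_ordered_torus| |].
      have -> : [set g : Rn R n | forall i, B i (tnth g i)] = \bigcap_(i in [set: 'I_n]) [set g | B i (tnth g i)].
        by apply/seteqP; split => g /= h r => [_|]; exact: h.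
      apply: fin_bigcap_measurable; first exact: finite_finset.
      move=> i _; rewrite -[X in measurable X]setTI.
      by apply: (measurable_tnth i) => //; exact: measurable_itv.
    by move=> x [h _] i; rewrite /B /= in_itv; exact: h.
  rewrite lebesgueRn_box; last by move=> i; exact: measurable_itv.
  suff : (\prod_(i < n) lebesgue_measure (B i))%E \is a fin_num by rewrite fin_numElt => /andP[].
  elim/big_ind: _ => //; first by move=> a b; exact: fin_numM.
  move=> i _; rewrite (lebesgue_measure_itv `[0, 2 * pi]); case: ifP => _ //.
have fin : (torus_const%:E * \int[leb m]_g (weight (gap g))%:E < +oo)%E.
  rewrite -E; apply: le_lt_trans vol.
  rewrite -[leRHS]mul1e -(integral_cst (lebesgueRn n) measurable_ordered_torus 1%E).
  apply: ge0_le_integral => //.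
  - exact: measurable_ordered_torus.
  - apply/measurable_EFinP; apply: (measurable_funS measurableT) => //.
    by apply: measurableT_comp => //; exact: measurable_Hn.
  - by move=> x _; rewrite /cst lee_fin -expR0 ler_expR.
rewrite ltNge leye_eq; apply/negP => /eqP oo.
by move: fin; rewrite oo gt0_muley ?lte_fin ?torus_const_gt0 ?ltxx.
Qed.

Lemma Px_weight (A : set (Rn R n)) : measurable A ->
  Px beta A = (rint (leb m) (fun g => weight (gap g) * \1_A (profile g)) /
               rint (leb m) (fun g => weight (gap g)))%:E.
Proof.
move=> mA.
have c0 := torus_const_gt0.
have iw := nnint_weight.
have mpA : measurable (@profile R m @^-1` A) := measurable_pre (@measurable_profile R m) mA.
have iwA := nnint_restr mpA iw.
have ZE : @Zn R n beta = torus_const * rint (leb m) (fun g => weight (gap g)).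
  have := torus_integral (@measurableT _ (Rn R n)).
  rewrite preimage_setT setIT /Zn /Rintegral => ->.
  rewrite [X in (_ * X)%E](_ : _ = (rint (leb m) (fun g => weight (gap g)))%:E) ?fine_EFinM//.
  by rewrite -rintE//; apply: eq_integral => g _; rewrite indicT mulr1.
rewrite /Px /pushforward /theta_law.
have mD : measurable (@ordered_torus R n `&` @rescale R n @^-1` A).
  by apply: measurableI; [exact: measurable_ordered_torus|exact: (measurable_pre measurable_rescale)].
transitivity ((1 / Zn n beta)%:E * \int[leb n]_(x in @ordered_torus R n `&` @rescale R n @^-1` A) (expR (Hn beta x))%:E)%E.
  rewrite -ge0_integralZl_EFin//.
  - apply/measurable_EFinP; apply: (measurable_funS measurableT) => //.
    by apply: measurableT_comp => //; exact: measurable_Hn.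
  - rewrite ZE div1r invr_ge0 mulr_ge0 ?(ltW c0)//; apply: rint_ge0 => g; exact: weight_ge0.
rewrite torus_integral//.
have -> : (\int[leb m]_g (weight (gap g) * \1_A (profile g))%:E = (rint (leb m) (fun g => weight (gap g) * \1_A (profile g)))%:E)%E.
  by rewrite -rintE.
rewrite -!EFinM ZE; congr EFin.
by rewrite div1r invfM -mulrA mulrCA [torus_const^-1 * _]mulrA mulVf ?gt_eqF// mul1r mulrC.
Qed.
End torus.


Section hyperplane_integrals.
Context {R : realType} (m : nat) (beta : R).
Local Notation n := m.+1.
Local Notation N := (m.+1%:R : R).
Local Notation leb := (@lebesgueRn R).
Implicit Types (g : Rn R m) (x : Rn R m.+1).

Let N0 : N != 0. Proof. by rewrite pnatr_eq0. Qed.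
Let N_gt0 : 0 < N. Proof. by rewrite ltr0n. Qed.
Let s0 : 0 < Num.sqrt N. Proof. by rewrite sqrtr_gt0. Qed.
Let sN : Num.sqrt N ^+ 2 = N. Proof. by rewrite sqr_sqrtr. Qed.

(** In the coordinates of chain 0 1 the unit slab is an interval of length
   1 / sqrt n in t, whatever the gaps. *)
Lemma lebesgue_hyperplaneE (A : set (Rn R n)) : measurable A ->
  @lebesgue_hyperplane R n A = ((Num.sqrt N)^-1%:E * leb m (@profile R m @^-1` A))%E.
Proof.
move=> mA; rewrite /lebesgue_hyperplane /pushforward /mrestr.
set D := _ `&` _.
have mD : measurable D.
  by apply: measurableI; [exact: (measurable_pre (@measurable_proj_hyperplane R n))|exact: measurable_unit_slab].
have mpA : measurable (@profile R m @^-1` A) := measurable_pre (@measurable_profile R m) mA.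
rewrite -[D]setIT -(integral_indic _ measurableT mD).
have [mT c0 HT] := @jac_chain R m 0 1 ltr01.
have mF : measurable_fun setT (fun x => (\1_D x)%:E : \bar R).
  by apply/measurable_EFinP; exact: measurable_indic.
have F0 x : (0 <= (\1_D x)%:E :> \bar R)%E by rewrite lee_fin indicE.
rewrite HT// integral_consRn_swap//; last exact: (measurableT_comp mF mT).
rewrite expr1n mul1e -[_ @^-1` A]setIT -(integral_indic _ measurableT mpA).
have i0 : 0 <= (Num.sqrt N)^-1 by rewrite invr_ge0 ltW.
rewrite -ge0_integralZl_EFin//; last first.
  by apply/measurable_EFinP; exact: measurable_indic.
apply: eq_integral => g _.
set M := arc_mean g.
transitivity (\int[lebesgue_measure]_a ((\1_A (profile g) : R)%:E * (\1_(`[- M, (Num.sqrt N)^-1 - M]%classic) a)%:E))%E.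
  apply: eq_integral => a _; rewrite -EFinM; congr EFin.
  have DE : D (chain 0 1 (consR a g)) <-> A (profile g) /\ - M <= a <= (Num.sqrt N)^-1 - M.
    rewrite /D /setI /preimage /= proj_chain tailRK /unit_slab /= csum_chain headRK tailRK -/M.
    have aux (s N' a' k M' : R) : 0 < s -> s ^+ 2 = N' ->
        (N' * a' + 0 * k + 1 * (N' * M')) / s = (a' + M') * s.
      by move=> s_0 <-; field; rewrite gt_eqF.
    rewrite (aux _ _ _ _ _ s0 sN).
    have -> : (0 <= (a + M) * Num.sqrt N <= 1) = (- M <= a <= (Num.sqrt N)^-1 - M) => //.
    rewrite pmulr_lge0// -ler_pdivlMr// div1r; congr andb.
      by rewrite -lerBlDr sub0r.
    by rewrite lerBrDr.
  rewrite !indicE; case: (boolP (_ \in D)) => [/set_mem hD|hD].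
    have [h1 h2] := DE.1 hD.
    by rewrite !mem_set//= ?in_itv//= mulr1.
  case: (boolP (profile g \in A)) => [/set_mem h1|_]; last by rewrite mul0r.
  rewrite mul1r (_ : (a \in _) = false)//.
  apply/negbTE; apply: contra hD => /set_mem; rewrite /= in_itv /= => h2.
  by apply: mem_set; apply: DE.2.
rewrite ge0_integralZl_EFin//; last first.
  by apply/measurable_EFinP; exact: measurable_indic.
rewrite integral_indic// muleC indicE [in RHS]indicE; congr (_ * _)%E.
rewrite setIT; apply: (etrans (lebesgue_measure_itv `[- M, (Num.sqrt N)^-1 - M])).
rewrite /= lte_fin ltrBrDr addrC subrr invr_gt0 s0 -EFinD; congr EFin; ring.
Qed.

Lemma hyperplane_integral (F : Rn R n -> R) : measurable_fun setT F -> (forall x, 0 <= F x) ->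
  (\int[@lebesgue_hyperplane R n]_x (F x)%:E =
   (Num.sqrt N)^-1%:E * \int[leb m]_g (F (profile g))%:E)%E.
Proof.
move=> mF F0.
pose nu : {measure set (Rn R n) -> \bar R} :=
  measure_function_pushforward__canonical__measure_function_Measure (leb m) (@measurable_profile R m).
have i0 : 0 <= (Num.sqrt N)^-1 by rewrite invr_ge0 ltW.
rewrite (eq_measure_integral (mscale (NngNum i0) nu)); last first.
  by move=> A mA _; exact: (lebesgue_hyperplaneE mA).
have mE : measurable_fun setT (EFin \o F) by exact/measurable_EFinP.
rewrite ge0_integral_mscale//; last by move=> x _; rewrite lee_fin.
congr (_ * _)%E; rewrite (ge0_integral_pushforward (@measurable_profile R m))//.
by move=> x _; rewrite lee_fin.
Qed.

Lemma profile_hyperplane g : @hyperplane R n (profile g).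
Proof.
have -> : profile g = proj_hyperplane (chain 0 1 (consR 0 g)) by rewrite proj_chain tailRK.
exact: proj_hyperplaneP.
Qed.

Lemma measurable_Gn : measurable_fun setT (@Gn R n beta).
Proof.
apply: measurable_funM => //; apply: measurable_sum => i.
rewrite (_ : (fun _ => _) = fun x => \sum_(j < n) (if i != j then
    let s := sin (pi * ((i : nat)%:R - (j : nat)%:R) / N) in
    (- (3 / 2) + s ^+ 2) / (N ^+ 4 * s ^+ 4) * (Defs.coord x i - Defs.coord x j) ^+ 2 else 0)); last first.
  by apply/funext => x; rewrite big_mkcond.
apply: measurable_sum => j; case: (i != j) => //.
apply: measurable_funM => //; apply: measurable_funX.
by apply: measurable_funB; exact: measurable_coord.
Qed.

Lemma measurable_hyperplane : measurable (@hyperplane R n).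
Proof.
rewrite -[X in measurable X]setTI.
exact: (@measurable_csum R n measurableT [set 0] (measurable_set1 _)).
Qed.

Let E g := expR (- Qen n beta (gap g)).

Lemma Pg_gauss (A : set (Rn R n)) : measurable A -> nnint (leb m) E ->
  Pg beta A = (rint (leb m) (fun g => E g * \1_A (profile g)) / rint (leb m) E)%:E.
Proof.
move=> mA iE.
have mG : measurable_fun setT (fun x => expR (@Gn R n beta x)).
  by apply: measurableT_comp => //; exact: measurable_Gn.
have key (B : set (Rn R n)) : measurable B ->
    (\int[@lebesgue_hyperplane R n]_(x in B) (expR (Gn beta x))%:E =
     ((Num.sqrt N)^-1 * rint (leb m) (fun g => E g * \1_B (profile g)))%:E)%E.
  move=> mB; rewrite integral_indic_mul hyperplane_integral; last 2 first.
  - by apply: measurable_funM => //; exact: measurable_indic.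
  - by move=> x; rewrite mulr_ge0 ?expR_ge0// indicE.
  rewrite EFinM; congr (_ * _)%E.
  have mpB : measurable (@profile R m @^-1` B) := measurable_pre (@measurable_profile R m) mB.
  rewrite -rintE; last exact: (nnint_restr mpB iE).
  by apply: eq_integral => g _; rewrite Gn_profile.
have ZE : @Zg R n beta = (Num.sqrt N)^-1 * rint (leb m) E.
  rewrite /Zg /Rintegral key; last exact: measurable_hyperplane.
  rewrite /=; congr (_ * _); congr rint; apply/funext => g.
  by rewrite indicE mem_set ?mulr1//; exact: profile_hyperplane.
rewrite /Pg; transitivity ((1 / Zg n beta)%:E * \int[@lebesgue_hyperplane R n]_(x in A) (expR (Gn beta x))%:E)%E.
  rewrite -ge0_integralZl_EFin//.
  - by apply/measurable_EFinP; exact: (measurable_funS measurableT).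
  - rewrite ZE div1r invr_ge0 mulr_ge0 ?invr_ge0 ?(ltW s0)//.
    by apply: rint_ge0 => g; exact: expR_ge0.
rewrite key// -EFinM ZE; congr EFin.
by rewrite div1r invfM mulrACA mulVf ?mul1r 1?mulrC// invr_eq0 gt_eqF.
Qed.
End hyperplane_integrals.

Section gauss_coordinates.
Context {R : realType} (m : nat) (beta : R).
Hypotheses (m0 : (0 < m)%N) (b0 : 0 < beta).
Local Notation n := m.+1.
Local Notation N := (m.+1%:R : R).
Local Notation leb := (@lebesgueRn R).
Implicit Types (g z : Rn R m).

Lemma pairsum_sum (I : finType) (F : I -> nat -> nat -> R) :
  pairsum n (fun k i => \sum_(a : I) F a k i) = \sum_(a : I) pairsum n (F a).
Proof.
rewrite /pairsum [RHS]exchange_big /=; apply: eq_bigr => k _.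
by rewrite [RHS]exchange_big.
Qed.

Lemma arc_gap_sum g i k : arc (gap g) i k = \sum_(a < m) tnth g a * arc (incidence a) i k.
Proof. by rewrite /arc /gap exchange_big /=; apply: eq_bigr => a _; rewrite mulr_sumr. Qed.

Let A (a b : 'I_m) : R := beta / 4 * pairsum n (fun k i =>
  ddcsc2 (ang n k) * (arc (incidence a) i k / N ^+ 2 * (arc (incidence b) i k / N ^+ 2))).

Lemma qform_gap g : qform A g = Qen n beta (gap g).
Proof.
rewrite /qform /Qen; transitivity (beta / 4 * \sum_(a < m) \sum_(b < m)
   pairsum n (fun k i => tnth g a * tnth g b * (ddcsc2 (ang n k) *
     (arc (incidence a) i k / N ^+ 2 * (arc (incidence b) i k / N ^+ 2))))).
  rewrite mulr_sumr; apply: eq_bigr => a _; rewrite mulr_sumr; apply: eq_bigr => b _.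
  by rewrite pairsum_scale /A; ring.
congr (_ * _); under eq_bigr do rewrite -pairsum_sum.
rewrite -pairsum_sum; apply: eq_bigr => k _; apply: eq_bigr => i _.
rewrite arc_gap_sum mulr_suml [(\sum_(_ < _) _) ^+ 2]expr2 big_distrlr /= mulr_sumr; apply: eq_bigr => a _.
by rewrite mulr_sumr; apply: eq_bigr => b _; ring.
Qed.

Lemma sqn_energy g : sqn g <= energy n 2 (gap g).
Proof.
rewrite /energy big_nat_recr//= big_mkord; apply: (@le_trans _ _ (\sum_(i < m) gap g i ^+ 2)).
  by rewrite le_eqVlt; apply/orP; left; apply/eqP; apply: eq_bigr => i _; rewrite gapE.
by rewrite lerDl sqr_ge0.
Qed.

Lemma gauss_coordinates : exists L c, jac (lin L) c /\
  forall z, Qen n beta (gap (lin L z)) = sqn z.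
Proof.
have r0 : 0 < beta / (8 * pi ^+ 4) by rewrite divr_gt0// mulr_gt0// exprn_gt0// pi_gt0.
have [||L [c [jL HL]]] := @cholesky R m A _ r0.
- by move=> i j; rewrite /A; congr (_ * _); apply: eq_bigr => k _; apply: eq_bigr => l _; ring.
- move=> z; rewrite qform_gap; apply: le_trans (@Qen_ge R n beta m0 b0 _).
  by apply: ler_wpM2l (sqn_energy z); exact: ltW.
by exists L, c; split => // z; rewrite -qform_gap.
Qed.

(** Normalising constants, Jacobians and the factor 1 / sqrt n cancel in both
   laws, which are thus probability measures with explicit densities on the
   same space R^m. *)
Lemma laws_in_gauss_coordinates : exists L : 'I_m -> 'I_m -> R,
  [/\ forall z, Qen n beta (gap (lin L z)) = sqn z,
   nnint (leb m) (fun z => weight m beta (gap (lin L z))) &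
   forall A : set (Rn R n), measurable A -> exists2 B, measurable B &
   Px beta A = (rint (leb m) (fun z => weight m beta (gap (lin L z)) * \1_B z) /
               rint (leb m) (fun z => weight m beta (gap (lin L z))))%:E /\
   Pg beta A = (rint (leb m) (fun z => gsn z * \1_B z) / @Gam R m)%:E].
Proof.
have [L [c [jL HL]]] := gauss_coordinates; exists L.
have iw := @nnint_weight R m beta b0.
have [iwL ewL] := integral_jac jL iw.
have [mL c0 JL] := jL.
pose E g := expR (- Qen n beta (gap g)).
have EL z : E (lin L z) = gsn z by rewrite /E HL.
have mE : measurable_fun setT E.
  apply: measurableT_comp => //; apply: measurableT_comp => //.
  apply: measurable_funM => //; apply: measurable_sum => k; apply: measurable_sum => i.
  apply: measurable_funM => //; apply: measurable_funX; apply: measurable_funM => //.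
  exact: measurable_arc_gap.
have iE : nnint (leb m) E.
  split => //; first by move=> g; exact: expR_ge0.
  rewrite (JL (EFin \o E)); [|exact/measurable_EFinP|by move=> g; rewrite lee_fin expR_ge0].
  under eq_integral do rewrite /= EL.
  by have := @nnint_gsn R m; move=> i; rewrite rintE// -EFinM ltry.
split => //.
move=> S mS; have mpA : measurable (@profile R m @^-1` S) := measurable_pre (@measurable_profile R m) mS.
exists (lin L @^-1` (@profile R m @^-1` S)); first exact: measurable_pre.
have [_ ewA] := integral_jac jL (nnint_restr mpA iw).
have [_ eE] := integral_jac jL iE.
have [_ eEA] := integral_jac jL (nnint_restr mpA iE).
have cancel_c (x y u v : R) : c * u = x -> c * v = y -> x / y = u / v.
  by move=> <- <-; rewrite invfM mulrACA divff ?gt_eqF// mul1r.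
split.
  rewrite (@Px_weight R m beta b0 S mS).
  exact: (congr1 EFin (cancel_c _ _ _ _ ewA ewL)).
have eg : c * rint (leb m) (fun z => gsn z * \1_(lin L @^-1` (@profile R m @^-1` S)) z) =
    rint (leb m) (fun g => E g * \1_(@profile R m @^-1` S) g).
  by rewrite -eEA; congr (_ * _); congr rint; apply/funext => z /=; rewrite EL.
have eG : c * @Gam R m = rint (leb m) E.
  by rewrite -eE -rint_gsn; congr (_ * _); congr rint; apply/funext => z /=; rewrite EL.
rewrite (Pg_gauss mS iE).
exact: (congr1 EFin (cancel_c _ _ _ _ eg eG)).
Qed.
End gauss_coordinates.


(** * The density of the gaps relative to the Gaussian *)

Lemma periodic_mod (R : realType) n (q : nat -> R) i : periodic_seq n q -> q (i %% n)%N = q i.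
Proof.
move=> pq; rewrite {2}(divn_eq i n); elim: (i %/ n)%N => [|k IH]; first by rewrite mul0n.
by rewrite mulSn -addnA [X in _ = q X]addnC pq.
Qed.

Lemma even_pow_ge0 (R : realType) (x : R) e : 0 <= x ^+ (2 * e).
Proof. by rewrite exprM exprn_ge0// sqr_ge0. Qed.

Lemma energy_max (R : realType) n (q : nat -> R) e i : (0 < n)%N -> periodic_seq n q ->
  q i ^+ (2 * e) <= energy n (2 * e) q.
Proof.
move=> n0 pq; rewrite -(periodic_mod i pq) /energy big_mkord.
rewrite (bigD1 (Ordinal (ltn_pmod i n0)))//= lerDl.
by apply: sumr_ge0 => j _; exact: even_pow_ge0.
Qed.

Lemma energy_half (R : realType) n (q : nat -> R) :
  energy n 2 (fun i => q i / 2) = energy n 2 q / 4.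
Proof. by rewrite /energy mulr_suml; apply: eq_bigr => i _; field. Qed.

Section energy_growth.
Context {R : realType} (m : nat) (beta K : R).
Local Notation n := m.+1.
Local Notation N := (m.+1%:R : R).
Implicit Types q : nat -> R.
(** The lower bound of the quadratic form provided by Qen_ge. *)
Definition stiffness : R := beta / (8 * pi ^+ 4).
Local Notation rho := stiffness.
Hypotheses (m0 : (0 < m)%N) (b0 : 0 < beta) (K0 : 0 < K).
Hypothesis HK : rho * K ^+ 2 = 32.
Hypothesis KN : K ^+ 2 <= N.
Hypothesis bigN : 640 * beta * K / rho <= Num.sqrt N.

Let N_gt0 : 0 < N. Proof. by rewrite ltr0n. Qed.
Let sN : Num.sqrt N ^+ 2 = N. Proof. by rewrite sqr_sqrtr. Qed.
Let s0 : 0 < Num.sqrt N. Proof. by rewrite sqrtr_gt0. Qed.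

Lemma stiffness_gt0 : 0 < rho.
Proof. by rewrite divr_gt0// mulr_gt0// exprn_gt0// pi_gt0. Qed.

Lemma loop_half q : loop n q -> loop n (fun i => q i / 2).
Proof. by move=> [pq q0]; split; [move=> i; rewrite pq|rewrite -mulr_suml q0 mul0r]. Qed.

Lemma sup_le_sqrt q : periodic_seq n q -> energy n 2 q <= K ^+ 2 * N ->
  forall i, `|q i| <= K * Num.sqrt N.
Proof.
move=> pq qE i; have := le_trans (@energy_max R n q 1 i isT pq) qE.
rewrite muln1 -[X in _ <= _ * X -> _]sN -exprMn -[q i ^+ 2]real_normK ?num_real//.
by rewrite ler_sqr ?nnegrE ?normr_ge0 ?(mulr_ge0 (ltW K0) (ltW s0)).
Qed.

Lemma K_sqrt_le : K * Num.sqrt N <= N.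
Proof.
rewrite -[leRHS]sN expr2; apply: ler_wpM2r; first exact: ltW.
by rewrite -ler_sqr ?nnegrE ?(ltW K0) ?(ltW s0)// sN.
Qed.

(** If E2 <= K^2 n the quadratic part dominates the remainder. Otherwise halve the
   gaps: E2 is divided by four and V - V0 at least by two, so that the claim
   follows by induction on the number of halvings. *)
Lemma energy_growth q : loop n q -> (forall i, 0 < cell m q i) ->
  K ^+ 2 * N < 4 * energy n 2 q -> 2 * N <= Ven n beta q - Ven n beta (@loop0 R).
Proof.
have rho0 := stiffness_gt0.
have KK : 0 < K ^+ 2 * N by rewrite mulr_gt0// exprn_gt0.
have low q' : loop n q' -> energy n 2 q' <= K ^+ 2 * N -> K ^+ 2 * N < 4 * energy n 2 q' ->
    2 * N <= Ven n beta q' - Ven n beta (@loop0 R).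
  move=> lq hi lo; rewrite (@energy_split R n beta m0 b0 _ lq).
  have qB := sup_le_sqrt lq.1 hi.
  have E0 : 0 <= energy n 2 q' by apply: sumr_ge0 => i _; exact: sqr_ge0.
  have h1 := @Qen_ge R n beta m0 b0 q'.
  have := @Ren_bound R n beta m0 b0 q' _ lq qB K_sqrt_le.
  have -> : 320 * beta * (K * Num.sqrt N) * energy n 2 q' / N = 320 * beta * K / Num.sqrt N * energy n 2 q'.
    by rewrite -[X in _ / X = _]sN; field; rewrite gt_eqF.
  move=> h2; have h3 : 320 * beta * K / Num.sqrt N * energy n 2 q' <= rho / 2 * energy n 2 q'.
    apply: ler_wpM2r => //; rewrite ler_pdivrMr//.
    move: bigN; rewrite ler_pdivrMr// => h; lra.
  have h4 : rho / 4 * (K ^+ 2 * N) <= rho * energy n 2 q'.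
    by rewrite -mulrA ler_pM2l//; lra.
  have h5 : rho / 4 * (K ^+ 2 * N) = 8 * N.
    transitivity (rho * K ^+ 2 / 4 * N); first by field.
    by rewrite HK; congr (_ * _); lra.
  move: h2 h3; rewrite ler_norml => /andP[h2 _] h3; rewrite -/rho in h1.
  have h6 : rho / 2 * energy n 2 q' = rho * energy n 2 q' / 2 by field.
  rewrite h6 in h3; rewrite h5 in h4; move: h1 h2 h3 h4 N_gt0.
  move: (rho * energy n 2 q') (320 * beta * K / Num.sqrt N * energy n 2 q') => x y.
  by move: (Qen _ _ _) (Ren _ _ _) N => a b c; lra.
have [j] : exists j, energy n 2 q <= 4 ^+ j * (K ^+ 2 * N).
  exists (Num.truncn (energy n 2 q / (K ^+ 2 * N))).+1.
  rewrite -ler_pdivrMr//; set x := _ / _.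
  apply: (le_trans (ltW (truncnS_gt x))).
  rewrite -natrX ler_nat; exact/ltnW/ltn_expl.
elim: j q => [|j IH] q hj lq pos lo; first by apply: low => //; rewrite expr0 mul1r in hj.
have [hi|hi] := lerP (energy n 2 q) (K ^+ 2 * N); first exact: low.
have mid := @Ven_midpoint R n beta m0 b0 q lq pos.
have pos2 i : 0 < cell m (fun i => q i / 2) i.
  have := pos i; rewrite /cell; have := pi_gt0 R => p0.
  have : 0 < 2 * pi / N :> R by rewrite divr_gt0// mulr_gt0.
  rewrite (_ : q i / 2 / N ^+ 2 = q i / N ^+ 2 / 2); first by (move: (2 * pi / N) (q i / N ^+ 2) => a b; lra).
  by field; rewrite gt_eqF.
have a1 : energy n 2 (fun i => q i / 2) <= 4 ^+ j * (K ^+ 2 * N).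
  by rewrite energy_half; move: hj; rewrite exprS -mulrA; move: (4 ^+ j * _) => c; lra.
have a2 : K ^+ 2 * N < 4 * energy n 2 (fun i => q i / 2).
  by rewrite energy_half; move: hi; move: (K ^+ 2 * N) (energy n 2 q) => a b; lra.
have := IH _ a1 (loop_half lq) pos2 a2.
move: mid; move: (Ven n beta q) (Ven n beta (@loop0 R)) (Ven _ _ _) N N_gt0 => a b c d d0.
by lra.
Qed.
End energy_growth.


(** * A smooth cutoff *)

Section cutoff.
Context {R : realType}.
Implicit Types (x u t : R).

(** bump is (max 0 (1 - x))^2, which has a continuous derivative at x = 1. *)
Definition pos_part u : R := (u + `|u|) / 2.
Definition bump x : R := pos_part (1 - x) ^+ 2.
Definition dbump x : R := - 2 * pos_part (1 - x).

Lemma bumpE x : x <= 1 -> bump x = (1 - x) ^+ 2 /\ dbump x = - 2 * (1 - x).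
Proof.
move=> x1; rewrite /bump /dbump /pos_part ger0_norm ?subr_ge0//.
by split; [congr (_ ^+ 2)|congr (_ * _)]; field.
Qed.

Lemma bump0 x : 1 <= x -> bump x = 0 /\ dbump x = 0.
Proof.
move=> x1; rewrite /bump /dbump /pos_part ler0_norm ?subr_le0//.
by rewrite subrr mul0r expr0n mulr0.
Qed.

(** Applied to bump this treats the kink at one together with all other
   points. *)
Lemma is_derive_of_quadratic (f : R -> R) x d :
  (forall h, `|f (x + h) - f x - d * h| <= h ^+ 2) -> is_derive x 1 f d.
Proof.
move=> H.
have C : h^-1 *: (f (h *: 1 + x) - f x) @[h --> (0 : R)^'] --> d.
  apply/cvgrPdist_le => e e0; near=> h.
  have h0 : h != 0 by near: h; exact: nbhs_dnbhs_neq.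
  have he : `|h| <= e by near: h; exact: dnbhs0_le.
  apply: le_trans he; rewrite distrC.
  have -> : h^-1 *: (f (h *: 1 + x) - f x) - d = h^-1 * (f (x + h) - f x - d * h).
    by rewrite /GRing.scale /= mulr1 [h + x]addrC; field.
  rewrite normrM normfV ler_pdivrMl ?normr_gt0//.
  by apply: le_trans (H h) _; rewrite -expr2 real_normK ?num_real.
split; first exact: cvgP C.
exact: cvg_lim C.
Unshelve. all: by end_near.
Qed.

Lemma is_derive_bump x : is_derive x 1 bump (dbump x).
Proof.
apply: is_derive_of_quadratic => h; rewrite /bump /dbump /pos_part.
have -> : 1 - (x + h) = (1 - x) - h by ring.
move: (1 - x) => u; rewrite ler_norml.
case: (ger0P u) => u0; case: (ger0P (u - h)) => uh; apply/andP; split; nra.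
Qed.

Lemma continuous_dbump : continuous dbump.
Proof.
move=> x; rewrite /dbump /pos_part.
apply: (@cvgM _ _ (nbhs x) _ (cst (- 2)) _); first exact: cvg_cst.
apply: (@cvgM _ _ (nbhs x) _ _ (cst 2^-1)); last exact: cvg_cst.
have c : (1 - y @[y --> x] --> 1 - x)%classic by apply: cvgB; [exact: cvg_cst|exact: cvg_id].
by apply: cvgD => //; apply: (cvg_norm c).
Qed.

Lemma continuous_at_is_derive (f : R -> R) x d : is_derive x 1 f d -> {for x, continuous f}.
Proof. by move=> D; apply/differentiable_continuous/derivable1_diffP; case: D. Qed.

(** The cutoff makes a weight that is only differentiable where the argument
   of the cutoff is at most one continuously differentiable everywhere. *)
Lemma is_derive_cutoff (Nq dN Rq dR : R -> R) :
  (forall s : R, is_derive s 1 Nq (dN s)) -> continuous dN ->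
  (forall s : R, Nq s <= 1 -> is_derive s 1 Rq (dR s) /\ {for s, continuous dR}) ->
  let f s := bump (Nq s) * expR (- (Rq s / 2)) in
  let df s := (dbump (Nq s) * dN s - bump (Nq s) / 2 * dR s) * expR (- (Rq s / 2)) in
  (forall t : R, is_derive t 1 f (df t)) /\ continuous df.
Proof.
move=> DN cdN DR f df.
have cN := continuous_is_derive DN.
have far t : 1 < Nq t -> \forall s \near t, 1 < Nq s.
  move=> Nt; exact: (@cvgr_gt _ _ _ _ Nq (Nq t) (cN t) 1 Nt).
have E2 t : Nq t <= 1 -> is_derive t 1 (fun s => expR (- (Rq s / 2))) (expR (- (Rq t / 2)) * (- (dR t / 2))).
  move=> Nt; have [D _] := DR t Nt.
  have D' : is_derive t 1 (fun s => - (Rq s / 2)) (- (dR t / 2)).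
    rewrite (_ : (fun s => _) = fun s => Rq s * - 2^-1); last by apply/funext => s; ring.
    have D2 : is_derive t 1 (fun s => Rq s * - 2^-1) _ := is_deriveM D (is_derive_cst (- 2^-1 : R) t 1).
    apply: (is_derive_eq D2).
    by rewrite /GRing.scale /= mulr0 add0r; ring.
  exact: (@is_derive1_comp _ expR (fun s => - (Rq s / 2)) t _ _ (is_derive_expR _) D').
split=> t.
  case: (lerP (Nq t) 1) => Nt.
    have D1 := @is_derive1_comp _ bump Nq t _ _ (is_derive_bump _) (DN t).
    apply: (is_derive_eq (is_deriveM D1 (E2 t Nt))).
    by rewrite /df /GRing.scale /=; ring.
  have [b0 d0] := bump0 (ltW Nt).
  apply: (@near_eq_is_derive _ _ _ (cst 0)).
    have := far t Nt; apply: filterS => s Ns.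
    by rewrite /f (bump0 (ltW Ns)).1 mul0r.
  by rewrite /df b0 d0 !mul0r subrr mul0r; exact: is_derive_cst.
case: (lerP (Nq t) 1) => Nt; last first.
  have [b0 d0] := bump0 (ltW Nt).
  have dt0 : 0 = df t by rewrite /df b0 d0 !mul0r subrr mul0r.
  suff C : df s @[s --> t] --> (0 : R) by rewrite dt0 in C.
  apply: cvg_near_cst; have := far t Nt; apply: filterS => s Ns.
  by rewrite /df (bump0 (ltW Ns)).1 (bump0 (ltW Ns)).2 !mul0r subrr mul0r.
have [_ cR] := DR t Nt.
have cE := continuous_at_is_derive (E2 t Nt).
have cb : {for t, continuous (bump \o Nq)}.
  by apply: continuous_comp; [exact: cN|exact: (continuous_is_derive is_derive_bump)].
have cd : {for t, continuous (dbump \o Nq)}.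
  by apply: continuous_comp; [exact: cN|exact: continuous_dbump].
have c2 : {for t, continuous (cst 2^-1 : R -> R)} by exact: cvg_cst.
have c1 := continuousM (continuousB (continuousM cd (cdN t)) (continuousM (continuousM cb c2) cR)) cE.
exact: c1.
Qed.
End cutoff.


Section gauss_density.
Context {R : realType} (m : nat) (beta : R) (L : 'I_m -> 'I_m -> R).
Local Notation n := m.+1.
Local Notation N := (m.+1%:R : R).
Local Notation rho := (stiffness beta).
Hypotheses (m0 : (0 < m)%N) (b0 : 0 < beta).
Hypothesis HL : forall z, Qen n beta (gap (lin L z)) = sqn z.
Implicit Types (z : Rn R m) (k : 'I_m).

Let N_gt0 : 0 < N. Proof. by rewrite ltr0n. Qed.
Let N1 : 1 <= N. Proof. by rewrite ler1n. Qed.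
Let rho0 : 0 < rho := stiffness_gt0 b0.

Definition zgap z : nat -> R := gap (lin L z).
Definition dir k : nat -> R := gap [tuple L i k | i < m].
Local Notation p := zgap.

Lemma loop_zgap z : loop n (p z). Proof. exact: loop_gap. Qed.
Lemma loop_dir k : loop n (dir k). Proof. exact: loop_gap. Qed.

Lemma zgap_sum z r : p z r = \sum_(k < m) tnth z k * dir k r.
Proof.
rewrite /p /gap; under eq_bigr do rewrite tnth_mktuple mulr_suml.
rewrite exchange_big; apply: eq_bigr => k _; rewrite mulr_sumr; apply: eq_bigr => i _.
by rewrite tnth_mktuple; ring.
Qed.

Lemma zgap_shift z k s : p (shift z k s) = fun j => p z j + s * dir k j.
Proof.
apply/funext => r; rewrite !zgap_sum.
transitivity (\sum_(i < m) (tnth z i * dir i r + s * ((i == k)%:R * dir i r))).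
  by apply: eq_bigr => i _; rewrite tnth_mktuple; ring.
rewrite big_split /= -mulr_sumr; congr (_ + _ * _).
rewrite (bigD1 k)//= eqxx mul1r big1 ?addr0// => i /negbTE ->.
by rewrite mul0r.
Qed.

Lemma zgap_half z : p (half z) = fun j => p z j / 2.
Proof.
apply/funext => r; rewrite !zgap_sum mulr_suml; apply: eq_bigr => i _.
by rewrite tnth_mktuple; field.
Qed.

Definition gap_mx (r : 'I_n) k : R := dir k r.

Lemma lform_zgap r z : lform gap_mx r z = p z r.
Proof. by rewrite zgap_sum; apply: eq_bigr => k _; rewrite mulrC. Qed.

Lemma energy_lform e z : \sum_(r < n) lform gap_mx r z ^+ e = energy n e (p z).
Proof. by rewrite /energy big_mkord; apply: eq_bigr => r _; rewrite lform_zgap. Qed.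

Lemma energy_zgap_le z : energy n 2 (p z) <= sqn z / rho.
Proof.
rewrite ler_pdivlMr// mulrC -HL.
exact: (@Qen_ge R n beta m0 b0 _).
Qed.

Lemma measurable_zgap r : measurable_fun setT (fun z => p z r).
Proof.
rewrite (_ : (fun z => _) = fun z => \sum_(k < m) dir k r * tnth z k).
  exact: measurable_linear_form.
by apply/funext => z; rewrite zgap_sum; apply: eq_bigr => k _; rewrite mulrC.
Qed.

Lemma measurable_inv : measurable_fun setT (fun x : R => x^-1).
Proof.
rewrite (_ : (fun x => _) = fun x : R => x * (x ^+ 2)^-1).
  by apply: measurable_funM => //; exact: measurable_inv_sqr.
apply/funext => x; have [->|x0] := eqVneq x 0; first by rewrite invr0 mul0r.
by field.
Qed.

Lemma measurable_dcsc2 : measurable_fun setT (@dcsc2 R).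
Proof.
have h : measurable_fun setT (fun u : R => u / 2) by apply: measurable_funM.
apply: measurable_funM.
  apply: measurableT_comp => //; apply: (measurableT_comp _ h).
  by apply: continuous_measurable_fun; exact: continuous_cos.
apply: (measurableT_comp measurable_inv); apply: measurable_funX.
apply: (measurableT_comp _ h).
by apply: continuous_measurable_fun; exact: continuous_sin.
Qed.

Let measurable_arcs (i k : nat) : measurable_fun setT (fun z => arc (p z) i k / N ^+ 2).
Proof.
apply: measurable_funM => //; apply: measurable_sum => j; exact: measurable_zgap.
Qed.

Lemma measurable_Ren_zgap : measurable_fun setT (fun z => Ren n beta (p z)).
Proof.
apply: measurable_funM => //; apply: measurable_sum => k; apply: measurable_sum => i.
have ma := measurable_arcs i k.
apply: measurable_funB; last by apply: measurable_funM => //; exact: measurable_funX.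
apply: measurable_funB; last by apply: measurable_funM.
apply: measurable_funB => //; apply: (measurableT_comp measurable_csc2).
exact: measurable_funD.
Qed.

Lemma measurable_dRen_zgap k : measurable_fun setT (fun z => dRen n beta (p z) (dir k)).
Proof.
apply: measurable_funM => //; apply: measurable_sum => l; apply: measurable_sum => i.
have ma := measurable_arcs i l.
apply: measurable_funM => //; apply: measurable_funB; last by apply: measurable_funM.
apply: measurable_funB => //; apply: (measurableT_comp measurable_dcsc2).
exact: measurable_funD.
Qed.

(** * The weight close to the lattice configuration *)

Definition ell z : R := 1 + p z m / (2 * pi * N).
Local Notation W z := (weight m beta (p z)).

(** As long as the rescaled gaps are at most n all true gaps are positive and
   the length factor stays between 1/2 and 2. *)
Lemma weight_small z : (forall i, `|p z i| <= N) ->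
  W z = ell z * (expR (- Ren n beta (p z)) * gsn z) /\ 2^-1 <= ell z <= 2.
Proof.
move=> pN; have pi2 := @pi_ge2 R.
split; last first.
  have : `|p z m / (2 * pi * N)| <= 2^-1.
    rewrite normrM normfV [`|2 * pi * N|]gtr0_norm; last by rewrite !mulr_gt0// pi_gt0.
    rewrite ler_pdivrMr; last by rewrite !mulr_gt0// pi_gt0.
    rewrite mulrA; apply: le_trans (pN m) _; rewrite -[leLHS]mul1r.
    by apply: ler_wpM2r; [exact: ltW|lra].
  by rewrite /ell ler_norml => /andP[]; move: (_ / _) => x; lra.
rewrite /weight (introT forallP) => [|r].
  rewrite -expRD -[in RHS]HL (@energy_split R n beta m0 b0 _ (loop_zgap z)).
  by congr (_ * expR _); rewrite /p; ring.
rewrite /cell (_ : _ + _ = (2 * pi * N + p z r) / N ^+ 2); last first.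
  by move: (pi : R) N N_gt0 => P d d0; field; rewrite gt_eqF.
apply: divr_gt0; last by rewrite exprn_gt0.
have := pN r; rewrite ler_norml => /andP[h _].
have h2 : 2 * N < 2 * pi * N.
  by rewrite ltr_pM2r//; lra.
by move: h h2 N_gt0; move: N (2 * pi * N) => d e; lra.
Qed.

(** * The square root of the density and its gradient *)

Variable eps : R.
Hypotheses (e0 : 0 < eps) (e1 : eps < 1).

Definition quartic z : R := energy n 4 (p z) / (eps * N ^+ 2).
Definition dquartic k z : R := \sum_(0 <= r < n) 4 / (eps * N ^+ 2) * p z r ^+ 3 * dir k r.
(** The square root of the density relative to the Gaussian is e^(-R/2), up to the
   length factor; the cutoff removes the configurations where R is not
   differentiable or has a large gradient. *)
Definition root_density z : R := bump (quartic z) * expR (- (Ren n beta (p z) / 2)).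
Definition droot_density k z : R :=
  (dbump (quartic z) * dquartic k z - bump (quartic z) / 2 * dRen n beta (p z) (dir k)) *
  expR (- (Ren n beta (p z) / 2)).

Let c0 : 0 < eps * N ^+ 2. Proof. by rewrite mulr_gt0// exprn_gt0. Qed.

(** Inside the support of the cutoff each gap is at most sqrt n: the fourth power
   of a single gap is already at most eps n^2. *)
Lemma quartic_small z : quartic z <= 1 ->
  energy n 4 (p z) <= eps * N ^+ 2 /\ forall i, p z i ^+ 2 <= N /\ `|p z i| <= N.
Proof.
rewrite /quartic ler_pdivrMr// mul1r => E4; split => // i.
have q4 := le_trans (@energy_max R n (p z) 2 i isT (loop_zgap z).1) E4.
have q2 : p z i ^+ 2 <= N.
  rewrite -(ler_sqr (x := p z i ^+ 2)) ?nnegrE ?sqr_ge0 ?(ltW N_gt0)// -exprM.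
  apply: le_trans q4 _; rewrite -[leRHS]mul1r; apply: ler_wpM2r; [exact: sqr_ge0|exact: ltW].
split => //; rewrite -ler_sqr ?nnegrE ?(ltW N_gt0)// real_normK ?num_real//.
apply: le_trans q2 _; rewrite expr2 -[leLHS]mul1r.
by apply: ler_wpM2r; first exact: ltW.
Qed.

Lemma C1_root_density : C1partials root_density droot_density.
Proof.
have mq : measurable_fun setT quartic.
  apply: measurable_funM => //; apply: measurable_sum => r; apply: measurable_funX.
  exact: measurable_zgap.
have me : measurable_fun setT (fun z => expR (- (Ren n beta (p z) / 2))).
  apply: measurableT_comp => //; apply: measurableT_comp => //; apply: measurable_funM => //.
  exact: measurable_Ren_zgap.
have mb : measurable_fun setT (fun z => bump (quartic z)).
  apply: (measurableT_comp _ mq); apply: continuous_measurable_fun.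
  exact: (continuous_is_derive is_derive_bump).
have line k z := is_derive_cutoff (Nq := fun s : R => quartic (shift z k s))
  (dN := fun s => dquartic k (shift z k s)) (Rq := fun s => Ren n beta (p (shift z k s)))
  (dR := fun s => dRen n beta (p (shift z k s)) (dir k)).
have Hline k z : (forall t : R, is_derive t 1 (fun s => root_density (shift z k s)) (droot_density k (shift z k t))) /\
    continuous (fun t : R => droot_density k (shift z k t)).
  apply: line.
  - move=> s; rewrite /quartic /dquartic.
    rewrite (_ : (fun s0 : R => _) = fun s0 : R => \sum_(0 <= r < n) (p z r + s0 * dir k r) ^+ 4 / (eps * N ^+ 2)); last first.
      by apply/funext => s'; rewrite /energy mulr_suml zgap_shift.
    apply: is_derive_sum_nat => r _ _; rewrite zgap_shift.
    move: (p z r) (dir k r) (eps * N ^+ 2) c0 => a b c c_0.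
    by apply: is_derive_eq; rewrite /GRing.scale /=; field; rewrite gt_eqF.
  - have cp r : continuous (fun s : R => p (shift z k s) r).
      move=> s; rewrite (_ : (fun s0 : R => _) = fun s0 : R => p z r + s0 * dir k r); last first.
        by apply/funext => s'; rewrite zgap_shift.
      by apply: cvgD; [exact: cvg_cst|apply: cvgM; [exact: cvg_id|exact: cvg_cst]].
    move=> s; rewrite /dquartic; elim: (index_iota 0 n) => [|r l IH].
      rewrite (_ : (fun s0 : R => _) = cst 0); last by apply/funext => s'; rewrite big_nil.
      exact: cvg_cst.
    rewrite (_ : (fun s0 : R => _) = fun s0 : R => 4 / (eps * N ^+ 2) * p (shift z k s0) r ^+ 3 * dir k r +
       \sum_(r <- l) 4 / (eps * N ^+ 2) * p (shift z k s0) r ^+ 3 * dir k r); last first.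
      by apply/funext => s'; rewrite big_cons.
    apply: cvgD => //; apply: cvgM; last exact: cvg_cst.
    apply: cvgM; first exact: cvg_cst.
    apply: (@continuous_comp _ _ _ (fun s0 : R => p (shift z k s0) r) (fun x : R => x ^+ 3)); [exact: cp|exact: exprn_continuous].
  - move=> s /quartic_small[_ sm].
    have sm' i : `|p z i + s * dir k i| <= N by have [_] := sm i; rewrite zgap_shift.
    have D0 := @is_derive_Ren R n beta m0 b0 (p z) (dir k) s (loop_zgap z) (loop_dir k) sm'.
    have D1 := @is_derive_dRen R n beta m0 b0 (p z) (dir k) s (loop_zgap z) (loop_dir k) sm'.
    have E0 : (fun s : R => Ren n beta (p (shift z k s))) = (fun s : R => Ren n beta (fun j => p z j + s * dir k j)).
      by apply/funext => s'; rewrite zgap_shift.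
    have E1 : (fun s : R => dRen n beta (p (shift z k s)) (dir k)) = (fun s : R => dRen n beta (fun j => p z j + s * dir k j) (dir k)).
      by apply/funext => s'; rewrite zgap_shift.
    rewrite E0 E1 zgap_shift; split => //.
    exact: (continuous_at_is_derive D1).
split => [|k|k z t|k z].
- exact: measurable_funM.
- apply: measurable_funM => //; apply: measurable_funB; apply: measurable_funM.
  + apply: (measurableT_comp _ mq); apply: continuous_measurable_fun; exact: continuous_dbump.
  + apply: measurable_sum => r; apply: measurable_funM => //; apply: measurable_funM => //.
    by apply: measurable_funX; exact: measurable_zgap.
  + exact: measurable_funM.
  + exact: measurable_dRen_zgap.
- exact: (Hline k z).1.
- exact: (Hline k z).2.
Qed.

(** The gradient estimates below are obtained by duality: for S the squared norm
   of a covector d, one has S = d u for the vector u with the components of d,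
   so that d u <= A + S / 2 gives S <= 2 A. This lemma bounds the energy of the
   gaps of u by S. *)
Lemma dual_energy (d : 'I_m -> R) : energy n 2 (p [tuple d k | k < m]) <= (\sum_(k < m) d k ^+ 2) / rho.
Proof.
apply: le_trans (energy_zgap_le _) _; rewrite le_eqVlt; apply/orP; left; apply/eqP.
by congr (_ / _); apply: eq_bigr => k _; rewrite tnth_mktuple.
Qed.

Lemma sum_dquartic z : quartic z <= 1 ->
  \sum_(k < m) dquartic k z ^+ 2 <= 16 / (rho * (eps * N)).
Proof.
move=> /quartic_small[E4 sm].
set S := \sum_(k < m) _; set u := p [tuple dquartic k z | k < m].
pose c r := 4 / (eps * N ^+ 2) * p z r ^+ 3.
have SE : S = \sum_(0 <= r < n) c r * u r.
  rewrite /S /u; transitivity (\sum_(k < m) \sum_(0 <= r < n) c r * (dquartic k z * dir k r)).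
    by apply: eq_bigr => k _; rewrite expr2 {1}/dquartic mulr_suml; apply: eq_bigr => r _; rewrite /c; ring.
  rewrite exchange_big; apply: eq_bigr => r _; rewrite zgap_sum mulr_sumr.
  by apply: eq_bigr => k _; rewrite tnth_mktuple.
have uE : rho * energy n 2 u <= S by rewrite mulrC -ler_pdivlMr//; exact: dual_energy.
have cE : \sum_(0 <= r < n) c r ^+ 2 <= 16 / (eps * N).
  apply: (@le_trans _ _ (\sum_(0 <= r < n) 16 / (eps * N ^+ 2) ^+ 2 * N * p z r ^+ 4)).
    apply: ler_sum => r _; rewrite (_ : c r ^+ 2 = 16 / (eps * N ^+ 2) ^+ 2 * p z r ^+ 2 * p z r ^+ 4).
      apply: ler_wpM2r; first exact: (even_pow_ge0 _ 2).
      by apply: ler_wpM2l; [rewrite divr_ge0// sqr_ge0|exact: (sm r).1].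
    by rewrite /c; move: (p z r) => x; field; rewrite !gt_eqF.
  rewrite -mulr_sumr -/(energy n 4 (p z)).
  apply: (@le_trans _ _ (16 / (eps * N ^+ 2) ^+ 2 * N * (eps * N ^+ 2))).
    by apply: ler_wpM2l => //; apply: mulr_ge0; [rewrite divr_ge0// sqr_ge0|exact: ltW].
  rewrite le_eqVlt; apply/orP; left; apply/eqP.
  by move: N N_gt0 => x x0; field; rewrite !gt_eqF.
have : S <= (\sum_(0 <= r < n) c r ^+ 2) / (2 * rho) + rho * energy n 2 u / 2.
  rewrite {1}SE mulr_suml -[rho * _ / 2]mulrAC mulr_sumr -big_split /=.
  apply: ler_sum => r _; rewrite -subr_ge0.
  rewrite (_ : _ - _ = (c r - rho * u r) ^+ 2 / (2 * rho)).
    by rewrite divr_ge0 ?sqr_ge0// mulr_ge0// ltW.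
  by field; rewrite gt_eqF.
have -> : (\sum_(0 <= r < n) c r ^+ 2) / (2 * rho) = (\sum_(0 <= r < n) c r ^+ 2) / rho / 2.
  by field; rewrite gt_eqF.
have : (\sum_(0 <= r < n) c r ^+ 2) / rho <= 16 / (rho * (eps * N)).
  rewrite ler_pdivrMr//; apply: le_trans cE _; rewrite le_eqVlt; apply/orP; left; apply/eqP.
  by move: N N_gt0 => x x0; field; rewrite !gt_eqF.
move: uE; move: (rho * energy n 2 u) (_ / rho) (16 / _) => a b d; lra.
Qed.

Lemma dRen_lin q (d : 'I_m -> R) :
  dRen n beta q (p [tuple d k | k < m]) = \sum_(k < m) d k * dRen n beta q (dir k).
Proof.
rewrite /dRen; transitivity (beta / 2 * \sum_(k < m) pairsum n (fun l i =>
    d k * (tay1 (ang n l) (arc q i l / N ^+ 2) * (arc (dir k) i l / N ^+ 2)))).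
  rewrite -pairsum_sum; congr (_ * _); apply: eq_bigr => l _; apply: eq_bigr => i _.
  have -> : arc (p [tuple d k | k < m]) i l = \sum_(k < m) d k * arc (dir k) i l.
    rewrite /arc; under eq_bigr do rewrite zgap_sum.
    rewrite exchange_big; apply: eq_bigr => k _; rewrite mulr_sumr.
    by apply: eq_bigr => j _; rewrite tnth_mktuple.
  by rewrite [(\sum_(_ < _) _) / _]mulr_suml mulr_sumr; apply: eq_bigr => k _; ring.
rewrite mulr_sumr; apply: eq_bigr => k _; rewrite pairsum_scale; ring.
Qed.

(** dRen_bound with l proportional to 1 / n: the term E2(u) / l is then at most
   half of the sum itself. *)
Lemma sum_dRen z : quartic z <= 1 ->
  \sum_(k < m) dRen n beta (p z) (dir k) ^+ 2 <= 320 ^+ 2 * beta ^+ 2 * eps / rho.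
Proof.
move=> /quartic_small[E4 sm].
pose d k := dRen n beta (p z) (dir k).
set S := \sum_(k < m) _; set u := p [tuple d k | k < m].
have SE : S = dRen n beta (p z) u by rewrite dRen_lin; apply: eq_bigr => k _; rewrite expr2.
have uE : energy n 2 u <= S / rho by exact: dual_energy.
have l0 : 0 < 2 * (160 * beta / N) / rho by apply: divr_gt0 => //; apply: mulr_gt0 => //; apply: divr_gt0 => //; exact: mulr_gt0.
have := @dRen_bound R n beta m0 b0 (p z) u _ (loop_zgap z) (loop_zgap _) (fun i => (sm i).2) l0.
rewrite -SE => /ler_normlW H.
have : S <= 160 * beta / N * (2 * (160 * beta / N) / rho * (eps * N ^+ 2) + S / rho / (2 * (160 * beta / N) / rho)).
  apply: le_trans H _; apply: ler_wpM2l; first by apply: divr_ge0 => //; apply: mulr_ge0 => //; exact: ltW.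
  by apply: lerD; [apply: ler_wpM2l => //; exact: ltW|apply: ler_wpM2r => //; rewrite invr_ge0 ltW].
rewrite (_ : _ * (_ + _) = 160 * 320 * beta ^+ 2 * eps / rho + S / 2); last first.
  by move: N N_gt0 => x x0; field; rewrite !gt_eqF.
have -> : 320 ^+ 2 * beta ^+ 2 * eps / rho = 2 * (160 * 320 * beta ^+ 2 * eps / rho) by field; rewrite gt_eqF.
by move: (160 * 320 * beta ^+ 2 * eps / rho) => x; lra.
Qed.

(** The squared gradient of root_density relative to e^(-R), with one term for the
   cutoff, which decays in n, and one for R, which is small with eps. *)
Definition slope : R := 128 / (rho * (eps * N)) + 160 * 320 * beta ^+ 2 * eps / rho.

Lemma sum_droot_density z : quartic z <= 1 ->
  \sum_(k < m) droot_density k z ^+ 2 <= slope * expR (- Ren n beta (p z)).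
Proof.
move=> q1; have q0 : 0 <= quartic z.
  by apply: divr_ge0; [apply: sumr_ge0 => r _; exact: (even_pow_ge0 _ 2)|exact: ltW].
have [bE dE] := bumpE q1.
have B1 : dbump (quartic z) ^+ 2 <= 4 by rewrite dE; move: (quartic z) q0 q1 => x; nra.
have B2 : (bump (quartic z) / 2) ^+ 2 <= 4^-1.
  have h : 0 <= bump (quartic z) <= 1 by rewrite bE; move: (quartic z) q0 q1 => x; nra.
  by move: (bump _) h => x /andP[]; nra.
have EE : expR (- (Ren n beta (p z) / 2)) ^+ 2 = expR (- Ren n beta (p z)).
  by rewrite expr2 -expRD; congr expR; field.
apply: (@le_trans _ _ (\sum_(k < m) (8 * dquartic k z ^+ 2 + 2^-1 * dRen n beta (p z) (dir k) ^+ 2) * expR (- Ren n beta (p z)))).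
  apply: ler_sum => k _; rewrite /droot_density exprMn EE; apply: ler_wpM2r; first exact: expR_ge0.
  move: (dbump _) (bump _ / 2) (dquartic k z) (dRen _ _ _ _) B1 B2 => a b x y h1 h2.
  have := sqr_ge0 (a * x + b * y); have := sqr_ge0 x; have := sqr_ge0 y => y2 x2.
  have := ler_wpM2r x2 h1; have := ler_wpM2r y2 h2; rewrite -!exprMn => h3 h4 h5.
  have -> : (a * x - b * y) ^+ 2 = 2 * (a * x) ^+ 2 + 2 * (b * y) ^+ 2 - (a * x + b * y) ^+ 2 by ring.
  by move: (_ ^+ 2) ((b * y) ^+ 2) ((a * x + b * y) ^+ 2) (x ^+ 2) (y ^+ 2) h3 h4 h5 => *; lra.
rewrite -mulr_suml big_split /= -!mulr_sumr; apply: ler_wpM2r; first exact: expR_ge0.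
have h1 := sum_dquartic q1; have h2 := sum_dRen q1.
rewrite /slope (_ : 128 / _ = 8 * (16 / (rho * (eps * N)))); last first.
  by move: N N_gt0 => x x0; field; rewrite !gt_eqF.
rewrite (_ : 160 * 320 * beta ^+ 2 * eps / rho = 2^-1 * (320 ^+ 2 * beta ^+ 2 * eps / rho)); last by field; rewrite gt_eqF.
by move: (16 / _) (_ / rho) h1 h2 => a b; lra.
Qed.
End gauss_density.


Section comparison.
Context {R : realType} (m : nat) (beta : R) (L : 'I_m -> 'I_m -> R).
Local Notation n := m.+1.
Local Notation N := (m.+1%:R : R).
Local Notation rho := (stiffness beta).
Hypotheses (m0 : (0 < m)%N) (b0 : 0 < beta).
Hypothesis HL : forall z, Qen n beta (gap (lin L z)) = sqn z.
Variables (K eps : R).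
Hypotheses (K0 : 0 < K) (HK : rho * K ^+ 2 = 32) (KN : K ^+ 2 <= N).
Hypothesis bigN : 640 * beta * K / rho <= Num.sqrt N.
Hypotheses (e0 : 0 < eps) (e1 : eps < 1) (eN : 1 <= eps * N).
Implicit Types (z : Rn R m).
Local Notation p := (zgap L).
Local Notation W z := (weight m beta (zgap L z)).
Local Notation h := (root_density beta L eps).

Let N_gt0 : 0 < N. Proof. by rewrite ltr0n. Qed.
Let rho0 : 0 < rho := stiffness_gt0 b0.
Let s0 : 0 < Num.sqrt N. Proof. by rewrite sqrtr_gt0. Qed.
Let sN : Num.sqrt N ^+ 2 = N. Proof. by rewrite sqr_sqrtr. Qed.
Let G0 z : 0 < gsn z := expR_gt0 _.

Lemma root_densityE z : h z ^+ 2 = bump (quartic L eps z) ^+ 2 * expR (- Ren n beta (p z)).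
Proof. by rewrite exprMn [X in _ * X]expr2 -expRD; congr (_ * expR _); field. Qed.

Lemma quartic_ge0 z : 0 <= quartic L eps z.
Proof.
apply: divr_ge0; first by apply: sumr_ge0 => r _; exact: (even_pow_ge0 _ 2).
by apply: mulr_ge0; [exact: ltW|exact: sqr_ge0].
Qed.

Lemma weight_ge_half z : quartic L eps z <= 1 ->
  expR (- Ren n beta (p z)) * gsn z <= 2 * W z.
Proof.
move=> /(quartic_small e0 e1)[_ sm].
have [-> /andP[h1 _]] := weight_small m0 b0 HL (fun i => (sm i).2).
have : 0 <= expR (- Ren n beta (p z)) * gsn z by rewrite mulr_ge0 ?expR_ge0// ltW.
move: (_ * gsn z) (ell _ _) h1 => x l; nra.
Qed.

Lemma slope_gt0 : 0 < slope m beta eps.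
Proof.
apply: addr_gt0.
  by apply: divr_gt0 => //; apply: mulr_gt0 => //; exact: mulr_gt0.
apply: divr_gt0 => //; apply: mulr_gt0 => //; apply: mulr_gt0; last exact: exprn_gt0.
exact: mulr_gt0.
Qed.

Lemma gradient_le_weight z :
  (\sum_(k < m) droot_density beta L eps k z ^+ 2) * gsn z <=
  Num.sqrt (2 * slope m beta eps) ^+ 2 * W z.
Proof.
have sl0 := slope_gt0; rewrite sqr_sqrtr ?mulr_ge0 ?(ltW sl0)//.
case: (lerP (quartic L eps z) 1) => q1; last first.
  rewrite big1 ?mul0r => [|k _].
    by rewrite mulr_ge0 ?weight_ge0// mulr_ge0// ltW.
  by rewrite /droot_density (bump0 (ltW q1)).1 (bump0 (ltW q1)).2 !mul0r subrr mul0r expr0n.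
apply: le_trans (ler_wpM2r (ltW (G0 z)) (sum_droot_density m0 b0 HL e0 e1 q1)) _.
rewrite -mulrA [2 * _]mulrC -mulrA; apply: ler_wpM2l; first exact: ltW.
exact: weight_ge_half.
Qed.

Lemma density_close z : `|W z - h z ^+ 2 * gsn z| <= 2 * W z.
Proof.
have w0 := @weight_ge0 R m beta (p z).
case: (lerP (quartic L eps z) 1) => q1; last first.
  by rewrite root_densityE (bump0 (ltW q1)).1 expr0n !mul0r subr0 ger0_norm//; lra.
have h2 := weight_ge_half q1.
have b1 : 0 <= bump (quartic L eps z) ^+ 2 <= 1.
  have q0 := quartic_ge0 z; rewrite (bumpE q1).1 -exprM.
  by rewrite exprn_ge0 ?subr_ge0//= exprn_ile1// ?subr_ge0// gerBl.
have x0 : 0 <= expR (- Ren n beta (p z)) * gsn z by rewrite mulr_ge0 ?expR_ge0// ltW.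
rewrite root_densityE -mulrA ler_norml; case/andP: b1 => b1 b2.
move: (bump _ ^+ 2) (_ * gsn z) (weight _ _ _) h2 b1 b2 x0 w0 => b x w; nra.
Qed.

(** Where E4 <= eps^2 n^2 the argument of the cutoff is at most eps, and the last
   gap is at most eps n. *)
Lemma density_closer z : energy n 4 (p z) <= eps ^+ 2 * N ^+ 2 ->
  `|W z - h z ^+ 2 * gsn z| <= 10 * eps * W z.
Proof.
move=> E4; have N2 : 0 < N ^+ 2 by rewrite exprn_gt0.
have qe : quartic L eps z <= eps.
  rewrite /quartic ler_pdivrMr ?mulr_gt0//; apply: le_trans E4 _.
  by rewrite le_eqVlt; apply/orP; left; apply/eqP; ring.
have q1 : quartic L eps z <= 1 by apply: le_trans qe (ltW e1).
have q0 := quartic_ge0 z; have h2 := weight_ge_half q1.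
have [_ sm] := quartic_small e0 e1 q1.
have [WE _] := weight_small m0 b0 HL (fun i => (sm i).2).
have pm : `|p z m / (2 * pi * N)| <= eps.
  have q4 : p z m ^+ 4 <= (eps * N) ^+ 4.
    apply: le_trans (@energy_max R n (p z) 2 m isT (loop_zgap L z).1) _.
    apply: le_trans E4 _; rewrite -exprMn -[leLHS]mul1r -[4%N]/(2 + 2)%N exprD.
    by apply: ler_wpM2r; [exact: sqr_ge0|rewrite -[leLHS](expr1n _ 2) lerXn2r// ?nnegrE// (le_trans ler01)].
  have pa : `|p z m| <= eps * N.
    have -> : `|p z m| = Num.sqrt (Num.sqrt (p z m ^+ 4)).
      by rewrite (exprM _ 2 2) sqrtr_sqr (ger0_norm (sqr_ge0 _)) sqrtr_sqr.
    have -> : eps * N = Num.sqrt (Num.sqrt ((eps * N) ^+ 4)).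
      by rewrite (exprM _ 2 2) sqrtr_sqr (ger0_norm (sqr_ge0 _)) sqrtr_sqr ger0_norm// mulr_ge0// ltW.
    by rewrite !ler_wsqrtr.
  have pi2 := @pi_ge2 R.
  rewrite normrM normfV [`|2 * pi * N|]gtr0_norm; last by rewrite !mulr_gt0// pi_gt0.
  rewrite ler_pdivrMr; last by rewrite !mulr_gt0// pi_gt0.
  apply: le_trans pa _; apply: ler_wpM2l; first exact: ltW.
  by rewrite -[leLHS]mul1r; apply: ler_wpM2r; [exact: ltW|lra].
rewrite root_densityE WE -mulrA -mulrBl normrM.
have x0 : 0 <= expR (- Ren n beta (p z)) * gsn z by rewrite mulr_ge0 ?expR_ge0// ltW.
rewrite WE in h2.
have D : `|ell L z - bump (quartic L eps z) ^+ 2| <= 5 * eps.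
  rewrite (bumpE q1).1 -exprM /ell ler_norml.
  move: pm; rewrite ler_norml; move: (p z m / _) (quartic _ _ _) q0 qe q1 => x q q0 qe q1 /andP[x1 x2].
  have y0 : 0 <= q ^+ 2 by exact: sqr_ge0.
  have a1 : (1 - q) ^+ (2 * 2) <= 1 by rewrite exprn_ile1// ?subr_ge0// gerBl.
  have a2 : 1 - 4 * q <= (1 - q) ^+ (2 * 2).
    rewrite -subr_ge0 (_ : _ - _ = q ^+ 2 * ((q - 2) ^+ 2 + 2)); last by ring.
    by rewrite mulr_ge0// addr_ge0// sqr_ge0.
  by move: a1 a2; move: (_ ^+ (2 * 2)) => y; lra.
rewrite [X in _ * X]ger0_norm//.
apply: le_trans (ler_wpM2r x0 D) _.
rewrite (_ : 10 * eps = 5 * eps * 2); last by ring.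
by rewrite -[leRHS]mulrA; apply: ler_wpM2l h2; rewrite mulr_ge0// ltW.
Qed.

Definition growth_rate : R := 320 * beta * K ^+ 3.

(** Here the gaps are at most K sqrt n, hence |R| <= C sqrt n by Ren_bound. *)
Lemma weight_bulk z : energy n 2 (p z) <= K ^+ 2 * N ->
  W z <= 2 * expR (growth_rate * Num.sqrt N) * gsn z /\
  gsn z <= 2 * expR (growth_rate * Num.sqrt N) * W z.
Proof.
move=> E2; have lq := loop_zgap L z.
have qB := sup_le_sqrt K0 lq.1 E2.
have KsN := K_sqrt_le K0 KN.
have qN i : `|p z i| <= N by apply: le_trans (qB i) KsN.
have [-> /andP[l1 l2]] := weight_small m0 b0 HL qN.
have := @Ren_bound R n beta m0 b0 (p z) _ lq qB KsN.
have : 320 * beta * (K * Num.sqrt N) * energy n 2 (p z) / N <= growth_rate * Num.sqrt N.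
  rewrite ler_pdivrMr//; apply: (@le_trans _ _ (320 * beta * (K * Num.sqrt N) * (K ^+ 2 * N))).
    by apply: ler_wpM2l => //; rewrite !mulr_ge0// ltW.
  by rewrite le_eqVlt; apply/orP; left; apply/eqP; rewrite /growth_rate; ring.
move=> h1 /le_trans/(_ h1); rewrite ler_norml => /andP[r1 r2].
set c := growth_rate * Num.sqrt N in r1 r2 *.
have a1 : expR (- Ren n beta (p z)) <= expR c by rewrite ler_expR; lra.
have a2 : 1 <= expR c * expR (- Ren n beta (p z)) by rewrite -expRD -expR0 ler_expR; lra.
have g0 := ltW (G0 z); have x0 := expR_ge0 (- Ren n beta (p z)); have y0 := expR_ge0 c.
move: (ell _ _) (expR (- _)) (expR c) (gsn z) l1 l2 a1 a2 g0 x0 y0 => l x y g l1 l2 a1 a2 g0 x0 y0.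
split.
  rewrite mulrA; apply: ler_wpM2r => //; apply: ler_pM => //.
  by apply: le_trans l1; rewrite invr_ge0.
rewrite (_ : 2 * y * (l * (x * g)) = (2 * l) * (y * x) * g); last by ring.
rewrite -[leLHS]mul1r; apply: ler_wpM2r => //.
rewrite -[leLHS]mul1r; apply: ler_pM => //; lra.
Qed.

(** By midpoint convexity the energy of z is at least twice that of z/2, and the
   latter is at least 2 n by energy_growth. *)
Lemma weight_half z : K ^+ 2 * N < energy n 2 (p z) ->
  W z <= 2 * expR (- 2 * N) * W (half z).
Proof.
move=> E2; have R0 : 0 <= 2 * expR (- 2 * N) * W (half z).
  by rewrite mulr_ge0 ?weight_ge0// mulr_ge0// expR_ge0.
rewrite {1}/weight; case: ifP => // /forallP pos'.
have lq := loop_zgap L z.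
have pos i : 0 < cell m (p z) i.
  have := pos' (Ordinal (ltn_pmod i (isT : (0 < m.+1)%N))).
  by rewrite /cell /= (periodic_mod i lq.1).
have pi0 := pi_gt0 R.
have pos2 i : 0 < cell m (fun i => p z i / 2) i.
  have := pos i; rewrite /cell.
  have : 0 < 2 * pi / N :> R by rewrite divr_gt0// mulr_gt0.
  rewrite (_ : p z i / 2 / N ^+ 2 = p z i / N ^+ 2 / 2).
    by move: (2 * pi / N) (p z i / N ^+ 2) => a b; lra.
  by field; rewrite gt_eqF.
have mid := @Ven_midpoint R n beta m0 b0 _ lq pos.
have gr := energy_growth m0 b0 K0 HK KN bigN (loop_half lq) pos2.
have E4 : 4 * (energy n 2 (p z) / 4) = energy n 2 (p z) by field.
rewrite energy_half E4 in gr; have {}gr := gr E2.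
rewrite /weight zgap_half (introT forallP) => [|r]; last exact: pos2.
set V0 := Ven n beta (@loop0 R) in mid gr *.
set V1 := Ven n beta (p z) in mid gr *; set V2 := Ven n beta (fun j => p z j / 2) in mid gr *.
have lm : 0 <= 1 + p z m / 2 / (2 * pi * N).
  have := pos2 m; rewrite /cell => /ltW pm.
  have -> : 1 + p z m / 2 / (2 * pi * N) = N / (2 * pi) * (2 * pi / N + p z m / 2 / N ^+ 2).
    by move: (pi : R) pi0 N N_gt0 => P P0 x x0; field; rewrite !gt_eqF.
  by apply: mulr_ge0 => //; apply: divr_ge0; [exact: ltW|apply: mulr_ge0 => //; exact: ltW].
rewrite [leRHS](_ : _ = (2 * (1 + p z m / 2 / (2 * pi * N))) * (expR (- 2 * N) * expR (- (V2 - V0)))); last by ring.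
rewrite -expRD; apply: (@le_trans _ _ (2 * (1 + p z m / 2 / (2 * pi * N)) * expR (- (V1 - V0)))).
  apply: ler_wpM2r; first exact: expR_ge0.
  rewrite [leRHS](_ : _ = 2 + p z m / (2 * pi * N)).
    by move: (p z m / _) => x; lra.
  by move: (pi : R) pi0 N N_gt0 => P P0 x x0; field; rewrite !gt_eqF.
apply: ler_wpM2l; first by rewrite mulr_ge0.
rewrite ler_expR; move: mid gr; move: N => d; lra.
Qed.

Lemma density_bound (A : set (Rn R m)) :
  nnint (lebesgueRn m) (fun z => W z) -> measurable A ->
  let bad := bad_mass n rho K growth_rate eps in
  10 * eps + 2 * bad <= 2^-1 ->
  `|rint (lebesgueRn m) (fun z => W z * \1_A z) / rint (lebesgueRn m) (fun z => W z) -
    rint (lebesgueRn m) (fun z => gsn z * \1_A z) / @Gam R m| <=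
  2 * (10 * eps + 2 * bad) + 6 * Num.sqrt (2 * slope m beta eps).
Proof.
move=> iW mA bad small.
have C0 : 0 <= growth_rate by rewrite mulr_ge0 ?exprn_ge0 ?(ltW K0)// mulr_ge0// ltW.
have k0 : 0 < Num.sqrt (2 * slope m beta eps) by rewrite sqrtr_gt0 mulr_gt0// slope_gt0.
have eta0 : 0 <= 10 * eps by rewrite mulr_ge0// ltW.
apply: (@tv_bound R n m (gap_mx L) _ _ (droot_density beta L eps) rho K growth_rate
  (Num.sqrt (2 * slope m beta eps)) (10 * eps) eps A) => //.
- by rewrite HK; lra.
- by move=> z; rewrite energy_lform; exact: energy_zgap_le.
- by move=> z; rewrite energy_lform; exact: weight_bulk.
- by move=> z; rewrite energy_lform; exact: weight_half.
- exact: C1_root_density.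
- exact: gradient_le_weight.
- exact: density_close.
- by move=> z; rewrite energy_lform; exact: density_closer.
Qed.
End comparison.


(** * The limit *)

Lemma expRN_le_sqr (R : realType) (x : R) : 0 < x -> expR (- x) <= 4 / x ^+ 2.
Proof.
move=> x0; rewrite expRN -[leRHS]invrK invf_div lef_pV2 ?posrE ?expR_gt0 ?divr_gt0 ?exprn_gt0//.
have h := @expR_ge1Dx R (x / 2).
have -> : expR x = expR (x / 2) * expR (x / 2) by rewrite -expRD; congr expR; field.
by move: (expR (x / 2)) h => y; nra.
Qed.

(** The linear term in n wins against the one in sqrt n; any polynomial rate
   suffices, so e^(-x) <= 4 / x^2 is enough. *)
Lemma bad_mass_decay (R : realType) (rho K C eps : R) :
  0 < rho -> 0 < K -> 0 < eps ->
  exists2 D, 0 < D & forall n, (0 < n)%N -> bad_mass n rho K C eps <= D / n%:R.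
Proof.
move=> rho0 K0 e0; pose a := rho * eps ^+ 2 / K ^+ 2.
have a0 : 0 < a := divr_gt0 (mulr_gt0 rho0 (exprn_gt0 2 e0)) (exprn_gt0 2 K0).
have aE x : rho * (eps ^+ 2 * x / K ^+ 2) = a * x by rewrite /a; ring.
clearbody a; have c0 : 0 < 256 :> R by rewrite ltr0n.
exists (2 + 256 * expR (2 * C ^+ 2 / a) / a ^+ 2).
  exact: addr_gt0 (ltr0n R 2) (divr_gt0 (mulr_gt0 c0 (expR_gt0 _)) (exprn_gt0 2 a0)).
move=> n n0; have N0 : 0 < n%:R :> R by rewrite ltr0n.
rewrite /bad_mass [leRHS]mulrDl; apply: lerD.
  apply: ler_wpM2l => //; rewrite expRN lef_pV2 ?posrE ?expR_gt0//.
  by have := @expR_ge1Dx R n%:R; lra.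
have sN : Num.sqrt (n%:R : R) ^+ 2 = n%:R by rewrite sqr_sqrtr.
(* completing the square in the square root of n *)
have E : 2 * C * Num.sqrt n%:R - rho * (eps ^+ 2 * n%:R / K ^+ 2) <= 2 * C ^+ 2 / a + - (a * n%:R / 2).
  rewrite aE -{2 3}sN; move: (Num.sqrt _) => s.
  rewrite -subr_ge0 (_ : _ - _ = a / 2 * (s - 2 * C / a) ^+ 2); last by field; rewrite gt_eqF.
  by rewrite mulr_ge0 ?sqr_ge0// divr_ge0// ltW.
have an0 : 0 < a * n%:R / 2 by rewrite divr_gt0// mulr_gt0.
apply: (@le_trans _ _ (16 * n%:R * (expR (2 * C ^+ 2 / a) * (4 / (a * n%:R / 2) ^+ 2)))).
  apply: ler_wpM2l; first by rewrite mulr_ge0// ltW.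
  apply: (@le_trans _ _ (expR (2 * C ^+ 2 / a + - (a * n%:R / 2)))); first by rewrite ler_expR.
  by rewrite expRD; apply: ler_wpM2l; [exact: expR_ge0|exact: expRN_le_sqr].
rewrite le_eqVlt; apply/orP; left; apply/eqP.
by move: (expR _) (n%:R : R) N0 => x y y0; field; rewrite !gt_eqF.
Qed.

Lemma le_of_sum5_le (R : realType) (d x1 x2 x3 x4 x5 : R) : x1 + x2 + x3 + x4 + x5 <= d ->
  0 <= x1 -> 0 <= x2 -> 0 <= x3 -> 0 <= x4 -> 0 <= x5 ->
  [/\ x1 <= d, x2 <= d, x3 <= d, x4 <= d & x5 <= d].
Proof. by move=> *; split; lra. Qed.

(** First eps is chosen small in terms of e, which controls the part of the bound
   that does not decay, then n is taken large. The five terms in the bound on n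
   ensure in turn: gaps of size K sqrt n are below n, the quadratic part
   dominates R, 1 <= eps n, the bad regions are negligible, and so is the
   gradient of the cutoff. *)
Lemma laws_close (R : realType) (beta e : R) : 0 < beta -> 0 < e -> e <= 1 ->
  exists n0 : nat, forall m, (n0 <= m)%N -> forall A : set (Rn R m.+1), measurable A ->
  (`|Px beta A - Pg beta A| <= e%:E)%E.
Proof.
move=> b0 e0 e1; have rho0 := stiffness_gt0 b0; set rho := stiffness beta in rho0.
have [K K0 HK] : exists2 K, 0 < K & rho * K ^+ 2 = 32.
  have h : 0 < 32 / rho := divr_gt0 (ltr0n R 32) rho0.
  exists (Num.sqrt (32 / rho)); first by rewrite sqrtr_gt0.
  by rewrite sqr_sqrtr ?(ltW h)// mulrC divfK// gt_eqF.
have [t t0 tE] : exists2 t, 0 < t & t + t = (e / 18) ^+ 2.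
  exists ((e / 18) ^+ 2 / 2); last by field.
  by apply: divr_gt0 => //; apply: exprn_gt0; exact: divr_gt0.
pose c := 320 ^+ 2 * beta ^+ 2 / rho.
have c0 : 0 < c := divr_gt0 (mulr_gt0 (exprn_gt0 2 (ltr0n R 320)) (exprn_gt0 2 b0)) rho0.
have [eps [eps0 eps80 ceps]] : exists eps, [/\ 0 < eps, eps <= e / 80 & c * eps <= t].
  clearbody c; exists (Num.min (e / 80) (t / c)); rewrite lt_min !divr_gt0//; split => //.
    by rewrite ge_min lexx.
  by rewrite mulrC -ler_pdivlMr// ge_min lexx orbT.
have eps1 : eps < 1 by lra.
pose C := growth_rate beta K.
have [D D0 HD] := bad_mass_decay C rho0 K0 eps0.
pose X2 := (640 * beta * K / rho) ^+ 2.
pose X5 := 256 / (rho * eps * t).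
have X10 : 0 <= K ^+ 2 by exact: sqr_ge0.
have X20 : 0 <= X2 by exact: sqr_ge0.
have X30 : 0 <= eps^-1 by rewrite invr_ge0 ltW.
have X40 : 0 <= 32 * D / e by apply: divr_ge0; [exact: mulr_ge0 (ler0n R 32) (ltW D0)|exact: ltW].
have X50 : 0 <= X5 := divr_ge0 (ler0n R 256) (ltW (mulr_gt0 (mulr_gt0 rho0 eps0) t0)).
exists (Num.truncn (K ^+ 2 + X2 + eps^-1 + 32 * D / e + X5)).+1 => m mn A mA.
have m0 : (0 < m)%N by apply: leq_trans mn.
have NX : K ^+ 2 + X2 + eps^-1 + 32 * D / e + X5 <= m.+1%:R :> R.
  apply: le_trans (ltW (truncnS_gt _)) _; rewrite ler_nat.
  by apply: leq_trans mn _; exact: leqnSn.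
have N0 : 0 < m.+1%:R :> R by rewrite ltr0n.
have [KN N2 N3 N4 N5] : [/\ K ^+ 2 <= m.+1%:R, X2 <= m.+1%:R, eps^-1 <= m.+1%:R,
    32 * D / e <= m.+1%:R & X5 <= m.+1%:R].
  exact: le_of_sum5_le NX X10 X20 X30 X40 X50.
have bigN : 640 * beta * K / rho <= Num.sqrt m.+1%:R.
  have h : 0 <= 640 * beta * K / rho :=
    divr_ge0 (mulr_ge0 (mulr_ge0 (ler0n R 640) (ltW b0)) (ltW K0)) (ltW rho0).
  by rewrite -ler_sqr ?nnegrE ?sqrtr_ge0// sqr_sqrtr.
have eN : 1 <= eps * m.+1%:R by move: N3; rewrite -[X in X <= _]mul1r ler_pdivrMr// mulrC.
have bad : bad_mass m.+1 rho K C eps <= e / 32.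
  apply: le_trans (HD _ _) _ => //; rewrite ler_pdivrMr//.
  by move: N4; rewrite ler_pdivrMr//; move: (m.+1%:R : R) => d h; lra.
have sl : 2 * slope m beta eps <= (e / 18) ^+ 2.
  have a2 : 256 / (rho * (eps * m.+1%:R)) <= t.
    move: N5; rewrite /X5 ler_pdivrMr; last exact: mulr_gt0 (mulr_gt0 rho0 eps0) t0.
    rewrite ler_pdivrMr; last exact: mulr_gt0 rho0 (mulr_gt0 eps0 N0).
    by rewrite (_ : m.+1%:R * (rho * eps * t) = t * (rho * (eps * m.+1%:R)))//; ring.
  rewrite -tE (_ : 2 * _ = 256 / (rho * (eps * m.+1%:R)) + c * eps); first exact: lerD.
  rewrite /slope /c -/rho; move: (m.+1%:R : R) N0 => d d0; field.
  by rewrite !gt_eqF.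
have ks : Num.sqrt (2 * slope m beta eps) <= e / 18.
  have -> : e / 18 = Num.sqrt ((e / 18) ^+ 2) by rewrite sqrtr_sqr ger0_norm// divr_ge0// ltW.
  by rewrite ler_wsqrtr.
have [L [HL iW HA]] := laws_in_gauss_coordinates m0 b0.
have [B mB [-> ->]] := HA A mA.
rewrite -EFinB abse_EFin lee_fin.
have small : 10 * eps + 2 * bad_mass m.+1 rho K C eps <= 2^-1.
  by move: (bad_mass _ _ _ _ _) bad eps80 e1 => u; lra.
apply: le_trans (density_bound m0 b0 HL K0 HK KN bigN eps0 eps1 eN iW mB small) _.
by rewrite -/rho -/C; move: (bad_mass _ _ _ _ _) (Num.sqrt (2 * _)) bad ks eps80 e0 => u v; lra.
Qed.

Theorem theorem11 (R : realType) (beta : R) (hbeta : 0 < beta) :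
  (fun n : nat =>
     ereal_sup [set `|Px beta A - Pg beta A|%E
               | A in [set A : set (Rn R n) |
                         measurable A /\ A `<=` @hyperplane R n]])
    @ \oo --> (0 : \bar R).
Proof.
set u := fun n : nat => _.
have ub e : 0 < e -> \forall n \near \oo, (0 <= u n <= e%:E)%E.
  move=> e0; have e'0 : 0 < Num.min e 1 by rewrite lt_min e0 ltr01.
  have e'1 : Num.min e 1 <= 1 by rewrite ge_min lexx orbT.
  have [n0 H] := laws_close hbeta e'0 e'1.
  exists n0.+1 => // -[//|m] /= n0m; apply/andP; split.
    apply: (@le_trans _ _ `|Px beta (@set0 (Rn R m.+1)) - Pg beta (@set0 (Rn R m.+1))|%E).
      exact: abse_ge0.
    by apply: ereal_sup_ubound; exists set0 => //; split => //; exact: measurable0.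
  apply: ge_ereal_sup => _ [A [mA _] <-].
  apply: le_trans (H m n0m A mA) _.
  by rewrite lee_fin ge_min lexx.
apply/fine_cvgP; split.
  have := ub 1 ltr01; apply: filterS => n /andP[h1 h2].
  by rewrite ge0_fin_numE//; apply: le_lt_trans h2 _; rewrite ltry.
apply/cvgrPdist_le => e e0; have := ub e e0; apply: filterS => n /andP[h1 h2].
have f : u n \is a fin_num by rewrite ge0_fin_numE//; apply: le_lt_trans h2 _; rewrite ltry.
rewrite sub0r normrN /= ger0_norm; last exact: fine_ge0.
by rewrite -lee_fin fineK.
Qed.
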